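(* Two-memory stochastic strategies (with both randomization of moves and stochastic memory update) are sufficient for $\mathsf{MDP}^{\{\mathbb{E},\mathrm{VaR},\mathrm{CVaR}\}}_{\mathsf{m},\mathsf{single}}$: for every MDP $\mathcal{M}$ with reward function $\mathbf{r}:S\to\mathbb{Q}$ and every strategy $\sigma$, there is a two-memory stochastic strategy $\sigma'$ achieving at least the expectation, VaR and CVaR (for every probability level in $(0,1)$) of the mean payoff $R^{\mathsf{m}}$ that $\sigma$ achieves.
   Context: An MDP $\mathcal{M}=(S,\mathsf{A},\mathsf{Av},\Delta,s_0)$: finite states and actions, $\mathsf{Av}(s)\neq\emptyset$ partitioning $\mathsf{A}$, $\Delta:\mathsf{A}\to\mathcal{D}(S)$, initial state $s_0$. A strategy $\sigma=(\sigma_u,\sigma_n,\alpha)$ over countable memory $\mathsf{M}$ has memory update $\sigma_u:\mathsf{A}\times S\times\mathsf{M}\to\mathcal{D}(\mathsf{M})$, next move $\sigma_n:S\times\mathsf{M}\to\mathcal{D}(\mathsf{A})$ (supported on $\mathsf{Av}(s)$) and initial memory distribution $\alpha$; it induces $\mathbb{P}^\sigma$ on runs. Two-memory means $|\mathsf{M}|=2$. Mean payoff: $R^{\mathsf{m}}(\rho)=\liminf_{n\to\infty}\frac1n\sum_{i=1}^n\mathbf{r}(\rho_i)$. $\mathrm{VaR}_p(X)=\sup\{r\mid F_X(r)\le p\}$; with $v=\mathrm{VaR}_p(X)$, $\mathrm{CVaR}_p(X)=\frac1p\big(\int_{(-\infty,v)}x\,dF_X+(p-\mathbb{P}[X<v])v\big)$.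 *)

(* Defs.v *)
From HB Require Import structures.
From mathcomp Require Import all_boot all_order all_algebra.
From mathcomp Require Import all_classical all_reals all_analysis.
From mathcomp Require Import measurable_realfun.

Set Implicit Arguments.
Unset Strict Implicit.
Unset Printing Implicit Defensive.

Import Order.TTheory GRing.Theory Num.Theory.
Import numFieldNormedType.Exports.

Local Open Scope classical_set_scope.
Local Open Scope ring_scope.

Lemma esum_pickle (R : realType) (T : countType) (f : T -> \bar R) :
  (forall x, 0 <= f x)%E ->
  (\esum_(x in [set: T]) f x = \sum_(n <oo) oapp f 0 (pickle_inv n))%E.
Proof.
move=> f0; have g0 n : (0 <= oapp f 0 (@pickle_inv T n))%E.
  by case: (pickle_inv n) => /=.
rewrite nneseries_esumT//.
transitivity (\esum_(n in range (@pickle T)) oapp f 0 (pickle_inv n))%E.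
  rewrite esum_image; last by move=> x y _ _; exact: (pcan_inj pickleK).
  by apply: eq_esum => x _; rewrite pickleK_inv.
rewrite esum_mkcond; apply: eq_esum => n _; case: ifPn => // /negP nP.
case E : (pickle_inv n) => [x|]//; exfalso; apply: nP; rewrite inE.
by exists x => //; have := @pickle_invK T n; rewrite E.
Qed.

Lemma esumZl (R : realType) (T : countType) (f : T -> \bar R) (c : R) :
  0 <= c -> (forall x, 0 <= f x)%E ->
  (\esum_(x in [set: T]) (c%:E * f x) = c%:E * \esum_(x in [set: T]) f x)%E.
Proof.
move=> c0 f0; rewrite !esum_pickle//; last by move=> x; rewrite mule_ge0.
rewrite -nneseriesZl//; last by move=> n _; case: (pickle_inv n) => /=.
by apply: eq_eseriesr => n _; case: (pickle_inv n) => //=; rewrite mule0.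
Qed.

Record distr (R : realType) (T : countType) := Distr {
  distr_fun :> T -> R ;
  distr_ge0 : forall x, 0 <= distr_fun x ;
  distr_sum1 : \esum_(x in [set: T]) (distr_fun x)%:E = 1%E
}.

Section distr_monad.
Variable R : realType.

Lemma distr_le1 (T : countType) (d : distr R T) x : d x <= 1.
Proof.
rewrite -lee_fin -(distr_sum1 d) (esumID [set x])//; last first.
  by move=> y _; rewrite lee_fin distr_ge0.
rewrite setTI esum_set1 ?lee_fin ?distr_ge0// leeDl// esum_ge0// => y _.
by rewrite lee_fin distr_ge0.
Qed.

Lemma distr_inhabited (T : countType) (d : distr R T) : exists x : T, True.
Proof.
apply: contrapT => noT; have := distr_sum1 d; rewrite esum1.
  by move=> /eqP; rewrite eqe eq_sym oner_eq0.
by move=> x; case: noT; exists x.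
Qed.

Section dunit.
Variables (T : countType) (x : T).

Let f (y : T) : R := (y == x)%:R.

Let f_ge0 y : 0 <= f y. Proof. by rewrite /f ler0n. Qed.

Let f_sum1 : \esum_(y in [set: T]) (f y)%:E = 1%E.
Proof.
rewrite (esumID [set x])//; last by move=> y _; rewrite lee_fin f_ge0.
rewrite setTI esum_set1 ?lee_fin ?f_ge0// esum1 ?adde0 /f ?eqxx// => y [_ /= yx].
by case: eqP yx.
Qed.

Definition dunit : distr R T := Distr f_ge0 f_sum1.
End dunit.

Section dbind.
Variables (T U : countType) (d : distr R T) (k : T -> distr R U).

Let g y : \bar R := (\esum_(x in [set: T]) (d x * k x y)%:E)%E.

Let g_ge0 y : (0 <= g y)%E.
Proof. by apply: esum_ge0 => x _; rewrite lee_fin mulr_ge0// distr_ge0. Qed.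

Let g_fin y : g y \is a fin_num.
Proof.
rewrite ge0_fin_numE//; apply: (@le_lt_trans _ _ 1%E); last exact: ltry.
rewrite -(distr_sum1 d); apply: le_esum => x _.
by rewrite lee_fin ler_piMr ?distr_ge0 ?distr_le1.
Qed.

Let f_ge0 y : 0 <= fine (g y). Proof. by rewrite fine_ge0. Qed.

Let f_sum1 : \esum_(y in [set: U]) (fine (g y))%:E = 1%E.
Proof.
have dk0 x y : (0 <= (d x * k x y)%:E)%E by rewrite lee_fin mulr_ge0// distr_ge0.
under eq_esum do rewrite fineK//.
rewrite /g esum_esum//.
transitivity (\esum_(x in [set: T]) \esum_(y in [set: U]) (d x * k x y)%:E)%E.
  rewrite esum_esum//; symmetry.
  rewrite (@reindex_esum _ _ _ ([set: U] `*`` fun=> [set: T])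
    ([set: T] `*`` fun=> [set: U]) (fun p => (p.2, p.1)))//.
  split => //=; first by move=> [? ?] [? ?] _ _ /= [-> ->].
  by move=> [x y] _; exists (y, x).
rewrite -[RHS](distr_sum1 d); apply: eq_esum => x _.
under eq_esum do rewrite EFinM.
rewrite esumZl ?distr_ge0//; last by move=> y; rewrite lee_fin distr_ge0.
by rewrite distr_sum1 mule1.
Qed.

Definition dbind : distr R U := Distr f_ge0 f_sum1.
End dbind.

End distr_monad.

Notation "'dlet' x '<-' d 'in' e" := (dbind d (fun x => e))
  (at level 200, x name, d at level 99, e at level 200,
   format "'dlet'  x  '<-'  d  'in' '//' e").

(* Infinite sequences over T, with the sigma-algebra generated by the
   cylinder sets; x0 only serves to make the type inhabited. *)
Definition traj (T : countType) (x0 : T) : Type := nat -> T.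

Definition cylinder (T : countType) (x0 : T) (w : seq T) : set (traj x0) :=
  [set u | mkseq u (size w) = w].
Arguments cylinder {T} x0 w.

Section traj_measurable.
Variables (T : countType) (x0 : T).

HB.instance Definition _ := Choice.copy (traj x0) (nat -> T).
HB.instance Definition _ := isPointed.Build (traj x0) (fun=> x0).

Let G : set (set (traj x0)) := range (cylinder x0).

HB.instance Definition _ := @isMeasurable.Build (sigma_display G) (traj x0)
  <<s G >> (@sigma_algebra0 _ setT G) (@sigma_algebraC _ G)
  (@sigma_algebra_bigcup _ setT G).

Lemma measurable_cylinder w : measurable (cylinder x0 w).
Proof. by apply: sub_sigma_algebra; exists w. Qed.

Lemma measurable_fun_traj d (S : measurableType d) (f : S -> traj x0) :
  (forall w, measurable (f @^-1` cylinder x0 w)) ->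
  measurable_fun [set: S] f.
Proof.
move=> mf; apply: (@measurability _ _ _ _ _ _ G) => //.
by move=> _ [_ [w _ <-] <-]; rewrite setTI.
Qed.

Lemma measurable_coord (n : nat) (B : set T) :
  measurable [set u : traj x0 | B (u n)].
Proof.
rewrite (_ : [set _ | _] = \bigcup_k oapp
    (fun w => if `[< size w = n.+1 /\ B (nth x0 w n) >] then cylinder x0 w
              else set0) set0 (@pickle_inv (seq T) k)).
  apply: bigcupT_measurable => k; case: (pickle_inv k) => [w|] //=.
  by case: ifP => // _; exact: measurable_cylinder.
apply/seteqP; split=> [u /= Bu|u [k _]].
  have [w [sw nw uw]] : exists w,
      [/\ size w = n.+1, nth x0 w n = u n & mkseq u n.+1 = w].
    by exists (mkseq u n.+1); rewrite size_mkseq nth_mkseq.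
  exists (pickle w) => //; rewrite pickleK_inv /= asboolT ?nw//.
  by rewrite /cylinder /mkset sw.
case: (pickle_inv k) => [w|] //=; case: asboolP => // -[sw Bw].
by rewrite /cylinder/= sw => uw; move: Bw; rewrite -uw nth_mkseq.
Qed.

End traj_measurable.

(* Markov chains with countably many locations. *)
Record markov_chain (R : realType) := MarkovChain {
  location : countType ;
  chain_init : distr R location ;
  chain_trans : location -> distr R location
}.

Section markov_chain_measure.
Variables (R : realType) (C : markov_chain R).
Local Notation L := (location C).
Local Notation init := (@chain_init R C).
Local Notation trans := (@chain_trans R C).

Definition chain_point : L := sval (cid (distr_inhabited init)).

Fixpoint word_weight (d : distr R L) (w : seq L) : R :=
  if w is x :: w' then d x * word_weight (trans x) w' else 1.

(* Existence of the measure: the trajectory is drawn from a single uniform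
   variable u in [0, 1[ by nested subdivision of the interval. *)
Let term (d : distr R L) (k : nat) : R := oapp d 0 (pickle_inv k).

Let cumul (d : distr R L) (n : nat) : R := \sum_(0 <= k < n) term d k.

Let slot (d : distr R L) (u : R) (x : L) :=
  cumul d (pickle x) <= u < cumul d (pickle x) + d x.

Let term_ge0 (d : distr R L) k : 0 <= oapp d 0 (@pickle_inv L k).
Proof. by case: (pickle_inv k) => //= x; exact: distr_ge0. Qed.

Let cumul_ge0 d n : 0 <= cumul d n.
Proof. by apply: sumr_ge0 => k _; exact: term_ge0. Qed.

Let cumulS d x : cumul d (pickle x) + d x = cumul d (pickle x).+1.
Proof. by rewrite /cumul big_nat_recr//= /term pickleK_inv. Qed.

Let cumul_le d : {homo cumul d : m n / (m <= n)%N >-> m <= n}.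
Proof.
apply: homo_leq => //; first by move=> ? ? ?; exact: le_trans.
by move=> n; rewrite /cumul big_nat_recr//= lerDl term_ge0.
Qed.

Let termE d k : (term d k)%:E =
  oapp (fun x => (d x)%:E) 0%E (@pickle_inv L k).
Proof. by rewrite /term; case: (pickle_inv k). Qed.

Let term_sum1 d : (\sum_(k <oo) (term d k)%:E = 1)%E.
Proof.
rewrite -(distr_sum1 d) esum_pickle => [|x]; last by rewrite lee_fin distr_ge0.
by apply: eq_eseriesr => k _; rewrite termE.
Qed.

Let cumul_cvg d : (cumul d n)%:E @[n --> \oo] --> 1%E.
Proof.
rewrite -(term_sum1 d) (_ : (fun n => (cumul d n)%:E) =
    (fun n => \sum_(0 <= k < n) (term d k)%:E)%E).
  by apply: is_cvg_nneseries => k _ _; rewrite lee_fin term_ge0.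
by apply/funext => n; rewrite /cumul -sumEFin.
Qed.

Let cumul_le1 d n : cumul d n <= 1.
Proof.
rewrite -lee_fin -(term_sum1 d) /cumul -sumEFin.
by apply: nneseries_lim_ge => k _ _; rewrite lee_fin term_ge0.
Qed.

Let slot_ex d (u : R) : 0 <= u < 1 -> exists x, slot d u x.
Proof.
move=> /andP[u0 u1].
have [n un] : exists n, u < cumul d n.
  apply: contrapT => nu; have : (1 <= u%:E)%E.
    rewrite -(cvg_lim _ (@cumul_cvg d))//; apply: lime_le.
      by apply/cvg_ex; exists 1%E; exact: cumul_cvg.
    apply: nearW => n; rewrite lee_fin leNgt; apply/negP => un.
    by apply: nu; exists n.
  by rewrite lee_fin leNgt u1.
case: (ex_minnP (ex_intro (fun n => u < cumul d n) n un)) => -[|m].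
  by rewrite /cumul big_nil ltNge u0.
move=> um mmin; have mu : cumul d m <= u.
  by rewrite leNgt; apply/negP => /mmin; rewrite ltnn.
case E : (@pickle_inv L m) => [x|].
  have mx : pickle x = m by have := @pickle_invK L m; rewrite E.
  by exists x; rewrite /slot cumulS mx mu.
by move: um; rewrite /cumul big_nat_recr//= /term E /= addr0 ltNge mu.
Qed.

Let slot_uniq d u x y : slot d u x -> slot d u y -> x = y.
Proof.
wlog xy : x y / (pickle x <= pickle y)%N.
  move=> h sx sy; case: (leqP (pickle x) (pickle y)) => [|/ltnW] xy.
    exact: h.
  by symmetry; exact: h.
rewrite /slot !cumulS => /andP[_ ux] /andP[uy _].
apply: (pcan_inj (@pickleK L)); apply/eqP; rewrite eqn_leq xy leqNgt.
apply/negP => /(@cumul_le d) h.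
by have := lt_le_trans ux (le_trans h uy); rewrite ltxx.
Qed.

Let sample (d : distr R L) (u : R) : L := xget chain_point [set x | slot d u x].

Let sampleP d (u : R) x : 0 <= u < 1 -> sample d u = x <-> slot d u x.
Proof.
move=> u01; have [y sy] := slot_ex d u01.
have sd : slot d u (sample d u) by exact: (@xgetI _ _ [set x | slot d u x] y).
by split=> [<-//|sx]; exact: slot_uniq sd sx.
Qed.

Let rescale (d : distr R L) (u : R) : R :=
  let x := sample d u in (u - cumul d (pickle x)) / d x.

Let rescale01 d (u : R) : 0 <= u < 1 -> 0 <= rescale d u < 1.
Proof.
move=> u01; have /andP[cu uc] : slot d u (sample d u) by apply/sampleP.
have dx : 0 < d (sample d u) by have := le_lt_trans cu uc; rewrite ltrDl.
rewrite /rescale /= ltr_pdivrMr// mul1r ltrBlDl uc andbT.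
by rewrite mulr_ge0 ?invr_ge0 ?subr_ge0// ltW.
Qed.

Let draws := fix draws (n : nat) (d : distr R L) (u : R) : L :=
  if n is n'.+1 then draws n' (trans (sample d u)) (rescale d u)
  else sample d u.

Let draws_cons d u x w :
  (mkseq (fun n => draws n d u) (size (x :: w)) = x :: w) <->
  sample d u = x /\
  mkseq (fun n => draws n (trans x) (rescale d u)) (size w) = w.
Proof.
have -> : mkseq (fun n => draws n d u) (size (x :: w)) = sample d u ::
    mkseq (fun n => draws n (trans (sample d u)) (rescale d u)) (size w).
  by rewrite /mkseq /= (iotaDl 1 0) -map_comp.
by split=> [[-> ?]|[-> ->]].
Qed.

Lemma word_weight_ge0 d w : 0 <= word_weight d w.
Proof.
by elim: w d => //= x w ih d; rewrite mulr_ge0// distr_ge0.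
Qed.

Let draws_itv w d : exists a : R, [/\ 0 <= a, a + word_weight d w <= 1 &
  forall u : R, 0 <= u < 1 ->
  (mkseq (fun n => draws n d u) (size w) = w) <-> (a <= u < a + word_weight d w)].
Proof.
elim: w d => [|x w ih] d; first by exists 0; rewrite add0r; split.
have [a [a0 a1 aP]] := ih (trans x).
have := distr_ge0 d x; rewrite le_eqVlt => /predU1P[dx0|dx0].
  exists 0; rewrite /= -dx0 mul0r addr0; split => // u u01.
  rewrite draws_cons; split => [[]|/andP[/le_lt_trans h /h]]; last by rewrite ltxx.
  move/(sampleP _ _ u01); rewrite /slot -dx0 addr0 => /andP[/le_lt_trans h /h].
  by rewrite ltxx.
exists (cumul d (pickle x) + d x * a); split.
- by rewrite addr_ge0// mulr_ge0// ltW.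
- rewrite /= -addrA -mulrDr (le_trans _ (cumul_le1 d (pickle x).+1))//.
  by rewrite -cumulS lerD2l ler_piMr// ltW.
move=> u u01; rewrite draws_cons /= -addrA -mulrDr.
have rsE : sample d u = x -> rescale d u = (u - cumul d (pickle x)) / d x.
  by rewrite /rescale => ->.
split=> [[sx]|].
  rewrite aP ?rescale01// (rsE sx) ler_pdivlMr// ltr_pdivrMr//.
  by rewrite lerBrDl ltrBlDl ![_ * d x]mulrC.
move=> /andP[au ua].
have sx : sample d u = x.
  apply/sampleP => //; rewrite /slot (le_trans _ au) ?lerDl ?mulr_ge0 ?(ltW dx0)//=.
  by rewrite (lt_le_trans ua)// lerD2l ler_piMr// ltW.
split=> //; rewrite aP ?rescale01// (rsE sx) ler_pdivlMr// ltr_pdivrMr//.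
by rewrite lerBrDl ltrBlDl ![_ * d x]mulrC au ua.
Qed.

Local Notation TR := (measurableTypeR R).

Let I01 : set TR := `[0, 1[%classic.

Let draw_traj (u : TR) : traj chain_point :=
  if 0 <= u < 1 then fun n => draws n init u else fun=> chain_point.

Let draw_traj_preimage w : I01 `&` draw_traj @^-1` cylinder chain_point w =
  [set` `[sval (cid (draws_itv w init)),
          sval (cid (draws_itv w init)) + word_weight init w[].
Proof.
case: cid => a /= [a0 a1 aP]; apply/seteqP; split=> [u /= []|u /=].
  by rewrite /I01 /= !in_itv/= /cylinder /draw_traj /mkset => /[dup] u01 -> /(aP _ u01).
rewrite !in_itv/= => /andP[au ua].
have u01 : 0 <= u < 1 by rewrite (le_trans a0 au) (lt_le_trans ua a1).
by split=> //; rewrite /cylinder /draw_traj /mkset u01; apply/aP => //; rewrite au.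
Qed.

Let mI01 : measurable I01. Proof. exact: measurable_itv. Qed.

Let measurable_draw_traj : measurable_fun [set: TR] draw_traj.
Proof.
apply: measurable_fun_traj => w.
set A := draw_traj @^-1` _.
have -> : A = (I01 `&` A) `|` (~` I01 `&` A) by rewrite -setIUl setUv setTI.
apply: measurableU; first by rewrite /A draw_traj_preimage; exact: measurable_itv.
have [Ap|nAp] := pselect (cylinder chain_point w (fun=> chain_point)).
  rewrite (_ : _ `&` _ = ~` I01); first exact: measurableC.
  apply/setIidPl => u /=; rewrite /I01 /A /preimage /= in_itv/= /draw_traj.
  by move=> /negP/negbTE ->.
rewrite (_ : _ `&` _ = set0)//; apply/seteqP; split=> // u /= [].
by rewrite /I01 /= in_itv/= /A /preimage/= /draw_traj => /negP/negbTE ->.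
Qed.

Lemma chain_prob_ex : exists P : probability (traj chain_point) R,
  forall w, P (cylinder chain_point w) = (word_weight init w)%:E.
Proof.
pose lebesgue01 : {measure set TR -> \bar R} := mrestr lebesgue_measure mI01.
have lebesgue01T : lebesgue01 setT = 1%E.
  rewrite /lebesgue01 /= /mrestr setTI.
  by rewrite lebesgue_measure_itv/= lte_fin ltr01 oppr0 adde0.
pose U : probability TR R := HB.pack (Measure.sort lebesgue01)
  (Measure_isProbability.Build _ _ _ lebesgue01 lebesgue01T).
pose X : {mfun TR >-> traj chain_point} := HB.pack draw_traj
  (isMeasurableFun.Build _ _ _ _ draw_traj measurable_draw_traj).
exists (distribution U X) => w.
rewrite /distribution /pushforward /U /= /mrestr setIC draw_traj_preimage.
rewrite lebesgue_measure_itv/= lte_fin ltrDl.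
case: ltP => [_|w0]; first by rewrite -EFinB addrC addKr.
by congr EFin; apply/le_anti; rewrite w0 word_weight_ge0.
Qed.

Definition chain_prob : probability (traj chain_point) R :=
  sval (cid chain_prob_ex).

Lemma chain_probE w :
  chain_prob (cylinder chain_point w) = (word_weight init w)%:E.
Proof. exact: (svalP (cid chain_prob_ex)). Qed.

Lemma chain_prob_unique (P : probability (traj chain_point) R) :
  (forall w, P (cylinder chain_point w) = (word_weight init w)%:E) ->
  forall A, measurable A -> P A = chain_prob A.
Proof.
move=> Pw A mA.
pose G := range (cylinder chain_point) `|` [set set0].
have GE : measurable = <<s G >> :> set (set (traj chain_point)).
  apply/seteqP; split; last first.
    apply: smallest_sub; first exact: sigma_algebra_measurable.
    by move=> _ [[w _ <-]|->]; [exact: measurable_cylinder|exact: measurable0].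
  apply: sub_smallest2r; first exact: smallest_sigma_algebra.
  by move=> _ [w _ <-]; left; exists w.
apply: (@measure_unique _ _ _ G (fun=> setT)) => //.
- have take_cyl (u : traj chain_point) m w : (m <= size w)%N ->
      cylinder chain_point w u -> mkseq u m = take m w.
    by move=> mw <-; rewrite /mkseq -map_take take_iota (minn_idPl mw).
  move=> _ _ [[v _ <-]|->] [[w _ <-]|->]; rewrite ?set0I ?setI0; try by right.
  wlog vw : v w / (size v <= size w)%N.
    move=> h; case: (leqP (size v) (size w)) => [|/ltnW]; first exact: h.
    by rewrite setIC; exact: h.
  have [vE|vN] := eqVneq (take (size v) w) v.
    left; exists w => //; apply/esym/setIidPr => u wu.
    by rewrite /cylinder/mkset (take_cyl _ _ _ vw wu).
  right; apply/seteqP; split=> // u [vu wu]; move/eqP: vN; apply.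
  by rewrite -(take_cyl _ _ _ vw wu).
- by move=> n; left; exists [::] => //; apply/seteqP; split.
- by rewrite bigcup_const.
- move=> _ [[w _ <-]|->]; last by rewrite !measure0.
  exact: etrans (Pw w) (esym (chain_probE w)).
- by move=> n; rewrite (le_lt_trans (probability_le1 _ _))// ltry.
Qed.

End markov_chain_measure.

Record mdp (R : realType) := MDP {
  state : finType ;
  action : finType ;
  avail : state -> {set action} ;
  avail_ex : forall s, exists a, a \in avail s ;
  avail_partition : forall a, exists! s, a \in avail s ;
  delta : action -> distr R state ;
  init_state : state
}.

Record strategy (R : realType) (M : mdp R) (Mem : countType) := Strategy {
  mem_update : action M -> state M -> Mem -> distr R Mem ;
  next_move : state M -> Mem -> distr R (action M) ;
  next_move_avail : forall s m a, next_move s m a != 0 -> a \in avail s ;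
  mem_init : distr R Mem
}.

(* The play of M under sigma: a Markov chain on S x Mem x A in which
   mem_update is applied to the action played and the state it leads to. *)
Definition play_chain (R : realType) (M : mdp R) (Mem : countType)
    (sigma : strategy M Mem) : markov_chain R :=
  @MarkovChain R (state M * Mem * action M)%type
    (dlet m <- mem_init sigma in
     dlet a <- next_move sigma (init_state M) m in
     dunit R (init_state M, m, a))
    (fun l => let: (s, m, a) := l in
     dlet s' <- delta a in
     dlet m' <- mem_update sigma a s' m in
     dlet a' <- next_move sigma s' m' in
     dunit R (s', m', a')).

(* Runs s_0 a_0 s_1 a_1 ... of M. *)
Definition run (R : realType) (M : mdp R) :=
  traj (init_state M, sval (cid (avail_ex (init_state M)))).

Section run_prob.
Variables (R : realType) (M : mdp R) (Mem : countType) (sigma : strategy M Mem).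
Local Notation C := (play_chain sigma).

Definition erase_memory (u : traj (chain_point C)) : run M :=
  fun n => let: (s, _, a) := u n in (s, a).

Let measurable_erase_memory : measurable_fun setT erase_memory.
Proof.
apply: measurable_fun_traj => w.
set x0 := (_, _) in w *.
rewrite (_ : _ @^-1` _ = \bigcap_(i in [set i | (i < size w)%N])
  [set u : traj (chain_point C) |
    [set l | (let: (s, _, a) := l in (s, a)) = nth x0 w i] (u i)]).
  by apply: bigcap_measurableType => i _; exact: measurable_coord.
apply/seteqP; split=> [u /= uw i /= iw|u uw].
  by rewrite -[in RHS]uw nth_mkseq.
apply: (@eq_from_nth _ x0); rewrite size_mkseq// => i iw.
by rewrite nth_mkseq//; exact: uw.
Qed.

HB.instance Definition _ :=
  isMeasurableFun.Build _ _ _ _ erase_memory measurable_erase_memory.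

Definition run_prob : probability (run M) R :=
  distribution (chain_prob C) erase_memory.

End run_prob.

Section mean_payoff.
Variables (R : realType) (M : mdp R) (r : state M -> rat).

Definition mean_payoff (rho : run M) : R :=
  limn_inf (arithmetic_mean (fun i => ratr (r (rho i).1))).

Let avg (n : nat) (rho : run M) : R :=
  arithmetic_mean (fun i => ratr (r (rho i).1)) n.

Let B : R := \sum_(s : state M) `|ratr (r s)|.

Let avg_bound n rho : - B <= avg n rho <= B.
Proof.
rewrite -ler_norml /avg /arithmetic_mean normrM ger0_norm// ler_pdivrMl//.
rewrite seriesEnat/= (le_trans (ler_norm_sum _ _ _))//.
rewrite mulr_natl -[in leRHS](subn0 n.+1) -sumr_const_nat.
apply: ler_sum_nat => i _.
by rewrite /B (bigD1 (rho i).1)//= lerDl sumr_ge0.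
Qed.

Let measurable_avg n : measurable_fun setT (avg n).
Proof.
rewrite /avg /arithmetic_mean; apply: measurable_funM => //=.
rewrite /series /=; apply: measurable_sum => i.
move=> _ Y mY; rewrite setTI.
exact: (@measurable_coord _ _ i [set l | Y (ratr (r l.1))]).
Qed.

Let avg_lb rho : has_lbound (range (avg ^~ rho)).
Proof. by exists (- B) => _ [n _ <-]; have /andP[] := avg_bound n rho. Qed.

Let avg_ub rho : has_ubound (range (avg ^~ rho)).
Proof. by exists B => _ [n _ <-]; have /andP[] := avg_bound n rho. Qed.

Let measurable_mean_payoff : measurable_fun setT mean_payoff.
Proof.
apply: (@measurable_fun_cvg _ _ _ _ (fun n rho => infs (avg ^~ rho) n)).
  by move=> n; exact: measurable_fun_infs.
by move=> rho _; apply/cvg_ex; eexists; exact: cvg_infs_sup.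
Qed.

HB.instance Definition _ :=
  isMeasurableFun.Build _ _ _ _ mean_payoff measurable_mean_payoff.

End mean_payoff.

Section risk.
Context d (T : measurableType d) (R : realType) (P : probability T R).

Definition VaR (X : {RV P >-> R}) (p : R) : R :=
  sup [set x | (cdf X x <= p%:E)%E].

Definition CVaR (X : {RV P >-> R}) (p : R) : \bar R :=
  let v := VaR X p in
  (p^-1%:E * (\int[distribution P X]_(x in `]-oo, v[) x%:E +
              (p%:E - P [set w | (X w < v)%R]) * v%:E))%E.

End risk.

Arguments VaR {d T R} P X p.
Arguments CVaR {d T R} P X p.

(* Main.v *)
(**
  Call a stationary flow (a vector of long-run action frequencies) simple when it
  is the only stationary flow on its support. By the law of large numbers for
  bounded martingale differences, the action frequencies of almost every run
  accumulate only at stationary flows, whatever the strategy. Every stationary flow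
  dominates in reward a simple one with smaller support, so almost surely the mean
  payoff is at most the value of some state visited infinitely often, the value of
  a state being the best reward of a simple flow through it; and a run that always
  plays an action of the best simple flow through its current state has, almost
  surely, mean payoff at least the value of the state where it started doing so,
  since the index of that flow never decreases.

  It remains to reach the values with the right probabilities. Given a strategy,
  observe the best value visited in a long time window and then stop when it
  recurs: the law of the stopping state nearly dominates the law of the mean
  payoff. The expected numbers of plays before stopping solve linear flow
  equations, in which circulations can be discarded; the remaining flows are
  bounded, so an exact solution exists in the limit. Randomizing moves and the
  memory switch proportionally to this solution gives a strategy whose first
  memory state stops with that law and whose second memory state plays the best
  simple flow. Its mean payoff stochastically dominates the original one, which is
  enough for expectation, VaR and CVaR.
*)

Require Import Defs.
From HB Require Import structures.
From mathcomp Require Import all_boot all_order all_algebra.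
From mathcomp Require Import all_classical all_reals all_analysis.
From mathcomp Require Import measurable_realfun ring lra.
Import Order.TTheory GRing.Theory Num.Theory.
Import numFieldNormedType.Exports.
Set Implicit Arguments.
Unset Strict Implicit.
Unset Printing Implicit Defensive.
Local Open Scope classical_set_scope.
Local Open Scope ring_scope.

(** * Stochastic dominance, VaR and CVaR *)

(** The second memory state offers a single mode of optimal play, so every state commits in advance
    to one simple flow, and these commitments have to agree along a run. This is why sets of actions
    are ranked with ties broken: equal gains alone would let a run wander between different flows,
    whereas a rank that has stopped growing pins down one support, on which uniqueness forces the
    limit of the frequencies. The bound must be attained exactly, while the windows used to
    approximate it grow without bound. The linear flow equations are what passes to the limit, so a
    stopping rule is forgotten as soon as its flow is known. The law of the final strategy is never
    computed exactly, since a flow may carry a circulation that its own strategy never reaches. An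
    inequality between actual and prescribed arrivals is enough: it bounds the switching mass at
    each state from above, and it makes the probability of not having switched vanish. As the
    prescribed law has total mass one, upper bounds for the low values settle the comparison. *)

Section shortfall.
Context d (T : measurableType d) (R : realType) (P : probability T R).
Variables (X : {RV P >-> R}) (B : R).
Hypothesis XB : forall w, `|X w| <= B.

(** Expectation and CVaR are both affine in the mean of this variable, taken at [c = B] and at the
    VaR respectively. Being nonnegative, it has a mean that is an integral of tail probabilities,
    which stochastic dominance compares directly. *)
Definition shortfall (c : R) (w : T) : R := Num.max (c - X w) 0.

Lemma measurable_shortfall c : measurable_fun setT (shortfall c).
Proof. by apply: measurable_maxr => //; apply: measurable_funB. Qed.

HB.instance Definition _ c :=
  isMeasurableFun.Build _ _ _ _ (shortfall c) (measurable_shortfall c).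

Lemma shortfall_ge0 c w : 0 <= shortfall c w.
Proof. by rewrite /shortfall le_max lexx orbT. Qed.

Lemma bounded_integrable (D : set T) (f : T -> R) (C : R) :
  measurable D -> measurable_fun D f -> (forall w, `|f w| <= C) ->
  P.-integrable D (EFin \o f).
Proof.
move=> mD mf fC; apply: measurable_bounded_integrable => //.
  by rewrite (le_lt_trans (probability_le1 _ _))// ltry.
by exists C; split; [exact: num_real|move=> x Cx w _; exact: le_trans (fC w) (ltW Cx)].
Qed.

Lemma measurable_lt (v : R) : measurable [set w | X w < v].
Proof.
have -> : [set w | X w < v] = X @^-1` `]-oo, v[.
  by apply/seteqP; split=> w /=; rewrite in_itv.
by rewrite -[_ @^-1` _]setTI; exact: measurable_funP.
Qed.

Lemma shortfallE c :
  (\int[P]_w (shortfall c w)%:E = \int[P]_(w in [set w | (X w < c)%R]) (c - X w)%:E)%E.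
Proof.
rewrite [RHS]integral_mkcond; apply: eq_integral => w _.
rewrite patchE /shortfall; case: (ltP (X w) c) => h.
  by rewrite mem_set//= max_l// subr_ge0 ltW.
by rewrite memNset/= ?max_r// ?subr_le0//; apply/negP; rewrite -leNgt.
Qed.

Lemma shortfall_fin c : (\int[P]_w (shortfall c w)%:E)%E \is a fin_num.
Proof.
apply: integrable_fin_num => //.
apply: (@bounded_integrable _ _ (`|c| + B)) => //.
move=> w; rewrite ger0_norm ?shortfall_ge0// /shortfall ge_max.
have := XB w; have := ler_norm c; have := normr_ge0 c; rewrite ler_norml => ? ? /andP[? ?].
apply/andP; split; lra.
Qed.

Definition mean_shortfall c : R := fine (\int[P]_w (shortfall c w)%:E)%E.

Lemma expectation_shortfall : ('E_P[X] = (B - mean_shortfall B)%:E)%E.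
Proof.
rewrite unlock EFinB /mean_shortfall fineK ?shortfall_fin//.
have -> : (\int[P]_w (shortfall B w)%:E = \int[P]_w (B%:E - (X w)%:E))%E.
  apply: eq_integral => w _; rewrite -EFinB /shortfall max_l//.
  by rewrite subr_ge0 (le_trans (ler_norm _)).
have iX : P.-integrable setT (EFin \o X) by exact: bounded_integrable.
have iB : P.-integrable setT (EFin \o cst B).
  by apply: (@bounded_integrable _ _ `|B|).
rewrite integralB//=.
have -> : (\int[P]_w B%:E = B%:E)%E by have := expectation_cst P B; rewrite unlock.
have : (\int[P]_w (X w)%:E)%E \is a fin_num by exact: integrable_fin_num.
by case: (integral _ _ _) => //= r _; rewrite -!EFinB opprB addrC subrK.
Qed.

(** Collecting the terms in [v] turns the partial integral over [X < v] into minus a mean shortfall;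
    this is the Rockafellar-Uryasev form of CVaR. *)
Lemma CVaR_shortfall p : let v := VaR P X p in
  CVaR P X p = (p^-1 * (p * v - mean_shortfall v))%:E.
Proof.
move=> v; rewrite /CVaR -/v EFinM; congr (_ * _)%E.
set D := [set w | (X w < v)%R]; have mD : measurable D by exact: measurable_lt.
have iX : P.-integrable D (EFin \o X).
  by apply: bounded_integrable => //; exact: measurable_funTS.
have iv : P.-integrable D (EFin \o cst v).
  by apply: (@bounded_integrable _ _ `|v|).
have -> : (\int[distribution P X]_(x in `]-oo, v[) x%:E = \int[P]_(w in D) (X w)%:E)%E.
  have DE : D = X @^-1` `]-oo, v[ by apply/seteqP; split=> w /=; rewrite in_itv.
  by rewrite DE integral_pushforward//= -DE.
have PD : P D \is a fin_num by exact: fin_num_measure.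
rewrite EFinB /mean_shortfall fineK ?shortfall_fin// shortfallE -/D.
under [in RHS]eq_integral do rewrite EFinB.
rewrite integralB//= integral_cst//.
have : (\int[P]_(w in D) (X w)%:E)%E \is a fin_num by exact: integrable_fin_num.
case: (integral _ _ _) => //= r _; move: PD; case: (P D) => //= q _.
have e : r + (p - q) * v = p * v - (v * q - r) by lra.
exact: (congr1 EFin e).
Qed.

(** Without this [sup] could be a default value. The range of [X] lies in [[- B, B]], so the
    distribution function is 0 at [- B - 1] and 1 beyond [B]. *)
Lemma VaR_set_sup (p : R) : 0 < p < 1 -> has_sup [set x | (cdf X x <= p%:E)%E].
Proof.
move=> /andP[p0 p1]; split.
  exists (- B - 1) => /=; rewrite (_ : cdf X _ = 0%E) ?lee_fin ?ltW//.
  rewrite /cdf/= /distribution /pushforward (_ : _ @^-1` _ = set0) ?measure0//.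
  apply/seteqP; split=> // w /=; rewrite in_itv/= => h.
  by have := XB w; rewrite ler_norml => /andP[]; lra.
exists B => x /= h; rewrite leNgt; apply/negP => Bx; move: h.
rewrite (_ : cdf X _ = 1%E) ?lee_fin ?leNgt ?p1//.
rewrite /cdf/= /distribution /pushforward (_ : _ @^-1` _ = setT) ?probability_setT//.
apply/seteqP; split=> // w _ /=; rewrite in_itv/=.
by have := XB w; rewrite ler_norml => /andP[]; lra.
Qed.

Lemma cdfE x : cdf X x = P [set w | X w <= x].
Proof.
by rewrite /cdf/= /distribution /pushforward; congr (P _); apply/seteqP; split=> w /=;
  rewrite in_itv.
Qed.

Lemma measurable_le (v : R) : measurable [set w | X w <= v].
Proof.
have -> : [set w | X w <= v] = X @^-1` `]-oo, v].
  by apply/seteqP; split=> w /=; rewrite in_itv.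
by rewrite -[_ @^-1` _]setTI; exact: measurable_funP.
Qed.

(** The event is the increasing union of the events [X <= v - 1 / (n + 1)], and each of these
    thresholds lies below a point where the distribution function is at most [p]. *)
Lemma prob_lt_VaR (p : R) : 0 < p < 1 ->
  (P [set w | (X w < VaR P X p)%R] <= p%:E)%E.
Proof.
move=> p01; have [S0 Sub] := VaR_set_sup p01; set v := VaR P X p.
pose F n := [set w | X w <= v - n.+1%:R^-1].
have -> : [set w | X w < v] = \bigcup_n F n.
  apply/seteqP; split=> [w /= h|w [n _]]; last first.
    by rewrite /F /= => /le_lt_trans; apply; rewrite gtrBl invr_gt0 ltr0n.
  exists (Num.trunc ((v - X w)^-1)) => //; rewrite /F /= lerBrDr -lerBrDl.
  by rewrite -[leRHS]invrK lef_pV2 ?posrE ?invr_gt0 ?subr_gt0// ltW// truncnS_gt.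
have ndF : nondecreasing_seq F.
  move=> m n mn; apply/subsetPset => w /= /le_trans; apply.
  by rewrite lerD2l lerN2 lef_pV2 ?posrE ?ltr0n// ler_nat.
have mF n : measurable (F n) by exact: measurable_le.
have cF := @nondecreasing_cvg_mu _ _ _ P F mF (bigcupT_measurable F mF) ndF : P \o F @ \oo --> P (\bigcup_n F n).
rewrite -(cvg_lim _ cF)//; apply: lime_le; first by apply/cvg_ex; eexists; exact: cF.
apply: nearW => n /=.
have : v - n.+1%:R^-1 < v by rewrite gtrBl invr_gt0 ltr0n.
move=> _.
have [x /= Sx vx] : exists2 x, [set x | (cdf X x <= p%:E)%E] x & v - n.+1%:R^-1 < x.
  have e0 : 0 < n.+1%:R^-1 :> R by rewrite invr_gt0 ltr0n.
  by have [x ? ?] := sup_adherent e0 (conj S0 Sub); exists x.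
apply: le_trans Sx; rewrite cdfE le_measure ?inE//; first exact: measurable_le.
by move=> w /= /le_trans; apply; exact: ltW.
Qed.
End shortfall.

Section dominance.
Context d1 (T1 : measurableType d1) d2 (T2 : measurableType d2) (R : realType).
Variables (P1 : probability T1 R) (P2 : probability T2 R).
Variables (X1 : {RV P1 >-> R}) (X2 : {RV P2 >-> R}) (B : R).
Hypotheses (X1B : forall w, `|X1 w| <= B) (X2B : forall w, `|X2 w| <= B).
Hypothesis dom : forall x, (P2 [set w | (X2 w < x)%R] <= P1 [set w | (X1 w < x)%R])%E.

Lemma mean_shortfall_dominance c :
  mean_shortfall X2 c <= mean_shortfall X1 c.
Proof.
rewrite /mean_shortfall fine_le ?(shortfall_fin X1B) ?(shortfall_fin X2B)//.
pose Y1 : {RV P1 >-> R} := shortfall X1 c.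
pose Y2 : {RV P2 >-> R} := shortfall X2 c.
rewrite -[leLHS](expectation_def Y2) -[leRHS](expectation_def Y1).
rewrite !ge0_expectation_ccdf; try by move=> w; exact: shortfall_ge0.
have ccE d (T : measurableType d) (P : probability T R) (X : {RV P >-> R}) r : 0 <= r ->
    ccdf (shortfall X c : {RV P >-> R}) r = P [set w | X w < c - r].
  move=> r0; rewrite /ccdf/= /distribution /pushforward; congr (P _).
  apply/seteqP; split=> w /=; rewrite in_itv/= andbT /shortfall lt_max.
    by rewrite [r < 0]ltNge r0 orbF ltrBrDl -ltrBrDr.
  by rewrite ltrBrDl -ltrBrDr => ->.
apply: ge0_le_integral => //.
- by apply: measurable_funTS; exact: ccdf_measurable.
- by apply: measurable_funTS; exact: ccdf_measurable.
- by move=> r /=; rewrite in_itv/= andbT => r0; rewrite !ccE.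
Qed.

Lemma expectation_dominance : ('E_P1[X1] <= 'E_P2[X2])%E.
Proof.
rewrite (expectation_shortfall X1B) (expectation_shortfall X2B) lee_fin lerB//.
exact: mean_shortfall_dominance.
Qed.

Lemma VaR_dominance (p : R) : 0 < p < 1 -> VaR P1 X1 p <= VaR P2 X2 p.
Proof.
move=> p01; have [S0 Sub] := VaR_set_sup X2B p01.
have [S10 _] := VaR_set_sup X1B p01.
(* [dom] compares strict sublevel sets and [cdf] uses weak ones; the shift by [e] passes from one to
   the other. *)
apply: ge_sup => // x /= x1; apply/ler_addgt0Pr => e e0; rewrite -lerBlDr.
apply: ub_le_sup => //=; apply: le_trans x1; rewrite !cdfE.
apply: (@le_trans _ _ (P1 [set w | X1 w < x])); last first.
  by apply: le_measure; rewrite ?inE; [exact: measurable_lt|exact: measurable_le|move=> w /ltW].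
apply: le_trans (dom x); apply: le_measure; rewrite ?inE;
  [exact: measurable_le|exact: measurable_lt|].
by move=> w /= /le_lt_trans; apply; rewrite gtrBl.
Qed.

(** The two quantiles differ, so shortfalls are compared at [v1]. Moving from [v1] to [v2] does not
    decrease [p * c - mean_shortfall X2 c], because [X2] lies below [v2] with probability at most
    [p]. *)
Lemma CVaR_dominance (p : R) : 0 < p < 1 -> (CVaR P1 X1 p <= CVaR P2 X2 p)%E.
Proof.
move=> p01; have /andP[p0 _] := p01.
rewrite (CVaR_shortfall X1B) (CVaR_shortfall X2B) lee_fin ler_pM2l ?invr_gt0//.
set v1 := VaR P1 X1 p; set v2 := VaR P2 X2 p.
have v12 : v1 <= v2 by exact: VaR_dominance.
have PD := prob_lt_VaR X2B p01; rewrite -/v2 in PD.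
pose q := fine (P2 [set w | X2 w < v2]).
have qE : P2 [set w | X2 w < v2] = q%:E by rewrite /q fineK// fin_num_measure//; exact: measurable_lt.
have qp : q <= p by move: PD; rewrite qE lee_fin.
(* [max(v2 - x, 0) - max(v1 - x, 0)] is at most [v2 - v1], and vanishes for [x >= v2]. *)
have : mean_shortfall X2 v2 <= mean_shortfall X2 v1 + (v2 - v1) * q.
  rewrite -lee_fin EFinD EFinM -qE /mean_shortfall !fineK ?(shortfall_fin X2B)//.
  have mD := measurable_lt X2 v2.
  rewrite -integral_cst// integral_mkcond -ge0_integralD//=; last 4 first.
  - by move=> w _; rewrite lee_fin shortfall_ge0.
  - by apply/measurable_EFinP; exact: measurable_shortfall.
  - by move=> w _; apply: erestrict_ge0 => ? _; rewrite lee_fin subr_ge0.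
  - by apply/(measurable_restrictT _ _).1 => //.
  apply: ge0_le_integral => //.
  - by move=> w _; rewrite lee_fin shortfall_ge0.
  - by apply/measurable_EFinP; exact: measurable_shortfall.
  - apply: emeasurable_funD; first by apply/measurable_EFinP; exact: measurable_shortfall.
    by apply/(measurable_restrictT _ _).1 => //.
  - move=> w _; rewrite patchE; case: (ltP (X2 w) v2) => h.
      rewrite mem_set//= -EFinD lee_fin /shortfall max_l; last by rewrite subr_ge0 ltW.
      by rewrite [leRHS]addrC -lerBlDl (_ : _ - _ = v1 - X2 w) ?le_max ?lexx//; lra.
    rewrite memNset/= ?adde0 ?lee_fin; last by apply/negP; rewrite -leNgt.
    by rewrite {1}/shortfall max_r ?shortfall_ge0// subr_le0.
have := mean_shortfall_dominance v1.
have : (v2 - v1) * q <= (v2 - v1) * p by rewrite ler_wpM2l// subr_ge0.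
lra.
Qed.

End dominance.

(** * Flows *)

Section ultralimits.
Variables (R : realType) (T : Type) (U : set_system T).
Context {UU : UltraFilter U}.

(** Compactness of the segment. One ultrafilter thus makes all bounded sequences converge at once
    and replaces successive extractions of subsequences. *)
Lemma cvg_ultra_bounded (u : T -> R) (a b : R) :
  U [set t | a <= u t <= b] -> exists l : R, u t @[t --> U] --> l.
Proof.
move=> Uu.
have [G [GU sub]] := ultraFilterLemma (fmap_proper_filter u _ : ProperFilter (u @ U)).
have := @segment_compact R a b; rewrite compact_ultra => /(_ G GU).
have Gab : G `[a, b]%classic.
  have Uab : U (u @^-1` `[a, b]%classic).
    have sab : [set t | a <= u t <= b] `<=` u @^-1` `[a, b]%classic.
      by move=> t /=; rewrite in_itv.
    exact: filterS sab Uu.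
  exact: sub.
move=> /(_ Gab)[l [_ Gl]]; exists l => A lA.
have [//|UnA] := in_ultra_setVsetC (u @^-1` A) UU.
have GnA : G (~` A) by apply: sub.
have := Gl _ lA => GA.
have /filter_ex[x []] // : G (A `&` ~` A) by exact: filterI.
Qed.

Lemma cvg_sumr (I : finType) (P : pred I) (f : I -> T -> R) (l : I -> R) :
  (forall i, f i t @[t --> U] --> l i) ->
  (\sum_(i | P i) f i t) @[t --> U] --> \sum_(i | P i) l i.
Proof.
move=> fl; rewrite -[X in X @ _](_ : \sum_(i | P i) f i = _); last first.
  by apply/funext => t; rewrite fct_sumE.
elim/big_ind2 : _ => [|g a h b ga hb|i _]; [exact: cvg_cst|exact: cvgD|exact: fl].
Qed.

Lemma cvg_ge (u : T -> R) (l c : R) :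
  u t @[t --> U] --> l -> U [set t | c <= u t] -> c <= l.
Proof.
move=> ul h; rewrite -(cvg_lim (@Rhausdorff R) ul); apply: limr_ge => //.
by apply/cvg_ex; exists l.
Qed.

End ultralimits.

Section finite_distributions.
Variable R : realType.

Lemma esum_fin (T : finType) (f : T -> R) : (forall x, 0 <= f x) ->
  (\esum_(x in [set: T]) (f x)%:E = (\sum_x f x)%:E)%E.
Proof.
move=> f0; rewrite esum_fset; last 2 first.
- exact: finite_finset.
- by move=> x _; rewrite lee_fin.
rewrite fsbig_finite/=; last exact: finite_finset.
rewrite sumEFin; congr EFin.
rewrite (perm_big (index_enum T))//=.
apply: uniq_perm; [exact: finmap.fset_uniq|exact: index_enum_uniq|].
by move=> x; rewrite mem_index_enum; have /(_ x) := in_fset_set (@finite_finset T setT); rewrite in_setT.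
Qed.

Lemma distr_sum (T : finType) (d : distr R T) : \sum_x d x = 1.
Proof.
have := distr_sum1 d; rewrite esum_fin; last exact: distr_ge0.
by move=> -[].
Qed.

Definition fin_distr (T : finType) (f : T -> R) (f0 : forall x, 0 <= f x)
  (f1 : \sum_x f x = 1) : distr R T :=
  Distr f0 (etrans (esum_fin f0) (congr1 EFin f1)).

End finite_distributions.

(** * Net flow, circulations, and closedness of the flow constraints *)

Section flows.
Variables (R : realType) (M : mdp R).
Implicit Types (y c f : action M -> R) (z : state M -> R).

Lemma owner_ex (a : action M) : exists s : state M, unique (fun s => a \in avail s) s.
Proof. exact: avail_partition. Qed.

Definition owner (a : action M) : state M := sval (cid (owner_ex a)).

Lemma ownerP (a : action M) s : (a \in avail s) = (owner a == s).
Proof.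
rewrite /owner; case: cid => s' [s'a uni] /=.
by apply/idP/eqP => [/uni//|<-].
Qed.

Definition supp y : {set action M} := [set a | y a != 0].

(** Departures from [s] minus expected arrivals in [s]. *)
Definition net y (s : state M) : R :=
  \sum_(a | owner a == s) y a - \sum_a y a * delta a s.

Definition circulation y := (forall a, 0 <= y a) /\ forall s, net y s = 0.

Lemma net_sub y c t s : net (fun a => y a - t * c a) s = net y s - t * net c s.
Proof.
rewrite /net sumrB -mulr_sumr.
under [X in _ - X]eq_bigr do rewrite mulrBl -mulrA.
by rewrite sumrB -mulr_sumr; lra.
Qed.

Lemma sum_net y : \sum_s net y s = 0.
Proof.
rewrite /net sumrB exchange_big/=.
under [X in _ - X]eq_bigr do rewrite -mulr_sumr distr_sum mulr1.
rewrite [X in _ - X](partition_big owner xpredT)//=.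
by rewrite -sumrB big1// => s _; rewrite subrr.
Qed.

(** The ratio test of the simplex method: [t] is the least ratio [y b / c b] over positive [c b], so
    nothing becomes negative and the minimizing coordinate drops out. It serves both to remove
    circulations and to reach simple flows. *)
Lemma reduce_support y c : (forall a, 0 <= y a) ->
  (forall a, c a != 0 -> 0 < y a) -> (exists a, 0 < c a) ->
  exists t, [/\ 0 <= t, (forall a, 0 <= y a - t * c a) &
    supp (fun a => y a - t * c a) \proper supp y].
Proof.
move=> y0 cy [a0 ca0].
have [b cb bmin] : exists2 b, 0 < c b & forall a, 0 < c a -> y b / c b <= y a / c a.
  by case: (@Order.TotalTheory.arg_minP _ _ _ a0 (fun a => 0 < c a) (fun a => y a / c a)) => // b;
    exists b.
pose t := y b / c b.
have t0 : 0 <= t by rewrite /t divr_ge0// ltW.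
exists t; split => //.
  move=> a; rewrite subr_ge0; have [ca|ca] := ltP 0 (c a).
    by rewrite -ler_pdivlMr// bmin.
  by rewrite (le_trans _ (y0 a))// mulr_ge0_le0.
apply/properP; split.
  apply/fintype.subsetP => a; rewrite !inE; apply: contraNneq => ya.
  have [->|/cy] := eqVneq (c a) 0; first by rewrite ya mulr0 subrr.
  by rewrite ya ltxx.
have yb : 0 < y b by apply: cy; rewrite gt_eqF.
exists b; rewrite !inE; first by rewrite gt_eqF.
by rewrite /t -mulrA mulVf ?mulr1 ?subrr ?eqxx// gt_eqF.
Qed.

(* [z s] is the probability of stopping in [s] and [y a] the expected number
   of times [a] is played before. *)
Definition flow y z :=
  [/\ (forall a, 0 <= y a), (forall s, 0 <= z s) &
      forall s, z s + net y s = (s == init_state M)%:R].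

Lemma flow_sum y z : flow y z -> \sum_s z s = 1.
Proof.
move=> [_ _ yz].
have : \sum_s (z s + net y s) = \sum_(s : state M) (s == init_state M)%:R.
  by apply: eq_bigr => s _.
rewrite big_split/= sum_net addr0 => ->.
by rewrite (bigD1 (init_state M))//= eqxx big1 ?addr0// => s /negbTE ->.
Qed.

Lemma flow_le1 y z s : flow y z -> z s <= 1.
Proof.
move=> /[dup] yz [_ z0 _]; rewrite -(flow_sum yz) (bigD1 s)//= lerDl.
exact: sumr_ge0.
Qed.

(** Subtracting a multiple of a circulation leaves [z] unchanged, since its net flow is zero, and
    can be chosen to shrink the support; hence the process ends. *)
Lemma flow_reduced y z : flow y z -> exists y', flow y' z /\
  forall c, circulation c -> (forall a, 0 < c a -> 0 < y' a) -> forall a, c a = 0.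
Proof.
have [n] := ubnP #|supp y|; elim: n y => // n ih y; rewrite ltnS => yn fyz.
have [h|] := pselect (forall c, circulation c -> (forall a, 0 < c a -> 0 < y a) ->
  forall a, c a = 0); first by exists y.
move=> /existsNP[c /not_implyP[cc /not_implyP[cy /existsNP[a /eqP ca]]]].
have [y0 z0 yz] := fyz; have [c0 nc] := cc.
have [||t [t0 yt prop]] := @reduce_support y c y0.
- by move=> b cb; apply: cy; rewrite lt0r cb c0.
- by exists a; rewrite lt0r ca c0.
apply: (ih (fun a => y a - t * c a)); last first.
  by split => // s; rewrite net_sub nc mulr0 subr0.
exact: leq_trans (proper_card prop) yn.
Qed.

Lemma cvg_net (T : Type) (U : set_system T) {UU : UltraFilter U}
    (y : T -> action M -> R) (l : action M -> R) s :
  (forall a, y t a @[t --> U] --> l a) -> net (y t) s @[t --> U] --> net l s.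
Proof.
move=> yl; apply: cvgB; first exact: cvg_sumr.
apply: cvg_sumr => a; apply: cvgMl => //; exact: yl.
Qed.

(* A flow carrying no circulation is bounded in terms of its net flow: otherwise
   the normalized flows would accumulate at a circulation. *)
Lemma flow_closed (lev : state M -> nat) (c : nat -> R) :
  (forall e, 0 < e -> exists y z, flow y z /\
    forall k, c k - e <= \sum_(s | (k <= lev s)%N) z s) ->
  exists y z, flow y z /\ forall k, c k <= \sum_(s | (k <= lev s)%N) z s.
Proof.
move=> approx.
have /choice[yz yzP] : forall n : nat, exists yz : (action M -> R) * (state M -> R),
    [/\ flow yz.1 yz.2,
      (forall c, circulation c -> (forall a, 0 < c a -> 0 < yz.1 a) -> forall a, c a = 0) &
      forall k, c k - n.+1%:R^-1 <= \sum_(s | (k <= lev s)%N) yz.2 s].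
  move=> n; have [|y [z [fyz cz]]] := approx n.+1%:R^-1; first by rewrite invr_gt0.
  by have [y' [fy'z red]] := flow_reduced fyz; exists (y', z).
pose y n := (yz n).1; pose z n := (yz n).2.
have fl n : flow (y n) (z n) by have [] := yzP n.
have [U [UU sub]] := ultraFilterLemma eventually_filter.
have /choice[lz zlz] : forall s, exists l : R, z n s @[n --> U] --> l.
  move=> s; apply: (@cvg_ultra_bounded _ _ _ _ _ 0 1); apply: filterE => n /=.
  by rewrite (flow_le1 s (fl n)) andbT; have [] := fl n.
have inv0 : (n.+1%:R^-1 : R) @[n --> U] --> 0.
  by move=> A /(@cvg_harmonic R); exact: sub.
have net_z s : net (y n) s @[n --> U] --> (s == init_state M)%:R - lz s.
  rewrite (_ : (fun n => net (y n) s) = (fun n => (s == init_state M)%:R - z n s)).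
    by apply: cvgB; [exact: cvg_cst|exact: zlz].
  by apply/funext => n; have [_ _ /(_ s) <-] := fl n; rewrite addrAC subrr add0r.
pose N n := \sum_a y n a.
have yN n a : 0 <= y n a <= N n.
  have [y0 _ _] := fl n; rewrite y0 /N (bigD1 a)//= lerDl.
  exact: sumr_ge0.
(* If the totals are bounded along [U], the flows themselves converge and the constraints, closed
   and linear, pass to the limit. *)
have [[C UC]|unb] := pselect (exists C, U [set n | N n <= C]).
  have /choice[ly yly] : forall a, exists l : R, y n a @[n --> U] --> l.
    move=> a; apply: (@cvg_ultra_bounded _ _ _ _ _ 0 C); apply: filterS UC => n /= nC.
    by have /andP[-> /le_trans->] := yN n a.
  exists ly, lz; split; first split.
  - by move=> a; apply: (cvg_ge (yly a)); apply: filterE => n; have /andP[] := yN n a.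
  - by move=> s; apply: (cvg_ge (zlz s)); apply: filterE => n /=; have [] := fl n.
  - move=> s; have /(cvg_unique (@Rhausdorff R) (net_z s)) <- := @cvg_net _ _ UU _ _ s yly.
    by rewrite addrC subrK.
  - move=> k; rewrite -subr_ge0.
    have : (\sum_(s | (k <= lev s)%N) z n s - (c k - n.+1%:R^-1)) @[n --> U] -->
      \sum_(s | (k <= lev s)%N) lz s - (c k - 0).
      by apply: cvgB; [exact: cvg_sumr|apply: cvgB => //; exact: cvg_cst].
    rewrite subr0 => /cvg_ge; apply; apply: filterE => n /=.
    by rewrite subr_ge0; have [] := yzP n.
have Ny C : U [set n | C < N n].
  have [UC|] := in_ultra_setVsetC [set n | N n <= C] UU.
    by exfalso; apply: unb; exists C.
  by apply: filterS => n /=; rewrite ltNge => /negP.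
have invN0 : (N n)^-1 @[n --> U] --> 0.
  apply/cvgrPdist_lt => e e0; near=> n.
  have Ne : e^-1 < N n by near: n; exact: Ny.
  rewrite sub0r normrN gtr0_norm ?invr_gt0 ?(lt_trans _ Ne) ?invr_gt0//.
  by rewrite -[e]invrK ltf_pV2// posrE ?(lt_trans _ Ne)// invr_gt0.
have /choice[lc clc] : forall a, exists l : R, y n a / N n @[n --> U] --> l.
  move=> a; apply: (@cvg_ultra_bounded _ _ _ _ _ 0 1); apply: filterS (Ny 0) => n /= N0.
  by have /andP[? ?] := yN n a; rewrite divr_ge0 ?ler_pdivrMr ?mul1r// ltW.
have lc0 a : 0 <= lc a.
  apply: (cvg_ge (clc a)); apply: filterE => n /=; have /andP[? ?] := yN n a.
  by rewrite divr_ge0// (le_trans _ (proj2 (andP (yN n a)))).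
(* The net flows converge while the totals [N n] tend to infinity, so the net flow of the normalized
   limit is zero. *)
have circ : circulation lc.
  split=> // s; have h := @cvg_net _ _ UU _ _ s clc.
  have /cvg_unique : net (y n) s * (N n)^-1 @[n --> U] --> ((s == init_state M)%:R - lz s) * 0.
    exact: cvgM.
  move=> /(_ (@Rhausdorff R)); rewrite mulr0 => u; apply/esym/u.
  rewrite (_ : (fun n => _ * _) = (fun n => net (fun a => y n a / N n) s))//.
  apply/funext => n; rewrite /net mulrBl !mulr_suml; congr (_ - _).
  by apply: eq_bigr => a _; rewrite mulrAC.
have sum1 : \sum_a lc a = 1.
  have h : (\sum_a (y n a / N n)) @[n --> U] --> \sum_a lc a by exact: cvg_sumr.
  have : (1 : R) @[n --> U] --> (1 : R) by exact: cvg_cst.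
  apply: (cvg_unique (@Rhausdorff R)); apply: cvg_trans h; apply: near_eq_cvg.
  near=> n; rewrite -mulr_suml divff//.
  have N0 : 0 < N n by near: n; exact: Ny.
  by rewrite gt_eqF.
have pos a : U [set n | 0 < lc a -> 0 < y n a].
  have [la|la] := ltP 0 (lc a); last by apply: filterE.
  near=> n => _ /=.
  have N0 : 0 < N n by near: n; exact: Ny.
  have : 0 < y n a / N n.
    by near: n; exact: (cvgr_gt _ (clc a)).
  by rewrite pmulr_lgt0// invr_gt0.
(* There are finitely many actions, so a single index [n] carries the whole support of the limit
   circulation; this contradicts the reducedness of [y n], as [lc] has sum 1. *)
have [n nP] : exists n, forall a, 0 < lc a -> 0 < y n a.
  apply: (@filter_ex _ U); apply: filter_forall => a; exact: pos.
have [_ /(_ _ circ nP) lc00 _] := yzP n.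
by move: sum1; rewrite big1// => /esym/eqP; rewrite oner_eq0.
Unshelve.
all: by end_near.
Qed.

End flows.

(** * Simple flows and state values *)

Section levels.
Variables (R : realType) (M : mdp R) (r : state M -> rat).
Implicit Types (f : action M -> R) (J : {set action M}).

Definition stationary f := circulation f /\ \sum_a f a = 1.

Definition reward f : R := \sum_a f a * ratr (r (owner a)).

(** These are the vertices of the polytope of stationary flows; naming the support [J] makes them a
    finite family. *)
Definition simple J f := [/\ stationary f, supp f = J &
  forall f', stationary f' -> supp f' \subset J -> f' =1 f].

Lemma reward_sub f c t : reward (fun a => f a - t * c a) = reward f - t * reward c.
Proof.
rewrite /reward mulr_sumr -sumrB; apply: eq_bigr => a _; lra.
Qed.

(** A linear reward is maximal at a vertex. If a second stationary flow lives on the support, the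
    line through both is followed until a coordinate vanishes, and the size of the support
    decreases. *)
Lemma simple_exists f : stationary f ->
  exists J f', [/\ simple J f', J \subset supp f & reward f <= reward f'].
Proof.
have [n] := ubnP #|supp f|; elim: n f => // n ih f; rewrite ltnS => fn sf.
have [h|] := pselect (simple (supp f) f); first by exists (supp f), f.
move=> nsimple.
have [f' [sf' ff' [b /eqP fb]]] : exists f', [/\ stationary f', supp f' \subset supp f &
    exists a, f' a <> f a].
  apply: contrapT => nf'; apply: nsimple; split => // f' sf' ff' a.
  by apply: contrapT => fa; apply: nf'; exists f'; split => //; exists a.
have [[f0 nf] f1] := sf; have [[f'0 nf'] f'1] := sf'.
(* Moving away from [f'] or towards it, whichever does not decrease the reward. *)
have reduce (e : R) : (e = 1 \/ e = -1) -> e * (reward f' - reward f) <= 0 ->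
    exists J f2, [/\ simple J f2, J \subset supp f & reward f <= reward f2].
  move=> e1 er; have e0 : e != 0 by case: e1 => ->; rewrite ?oppr_eq0 oner_eq0.
  pose c a := e * (f' a - f a).
  have sumc : \sum_a c a = 0 by rewrite -mulr_sumr sumrB f1 f'1 subrr mulr0.
  have cf a : c a != 0 -> 0 < f a.
    move=> ca; rewrite lt0r f0 andbT; apply: contraNneq ca => fa0.
    rewrite /c fa0 subr0 (_ : f' a = 0) ?mulr0//.
    apply/eqP; apply: contraT => f'a.
    have : a \in supp f by apply: (fintype.subsetP ff'); rewrite inE.
    by rewrite inE fa0 eqxx.
  (* The direction [c] is nonzero with sum zero, so it has a positive coordinate. *)
  have [a ca] : exists a, 0 < c a.
    apply: contrapT => nc.
    have c0 a : 0 <= - c a by rewrite oppr_ge0 leNgt; apply/negP => ca; apply: nc; exists a.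
    have : \sum_a - c a = 0 by rewrite sumrN sumc oppr0.
    move/eqP; rewrite psumr_eq0// => /allP/(_ b (mem_index_enum _)) /=.
    by rewrite oppr_eq0 mulf_eq0 (negbTE e0) subr_eq0 (negbTE fb).
  have [t [t0 ft prop]] := reduce_support f0 cf (ex_intro _ a ca).
  have netc s : net c s = 0.
    have -> : net c s = e * (net f' s - net f s); last by rewrite nf nf' subrr mulr0.
    rewrite /net /c -mulr_sumr sumrB.
    have -> : \sum_a e * (f' a - f a) * delta a s =
        e * (\sum_a f' a * delta a s - \sum_a f a * delta a s).
      by rewrite -sumrB mulr_sumr; apply: eq_bigr => ? _; ring.
    by ring.
  have [||J [f2 [J2 Jf rf]]] := ih (fun a => f a - t * c a).
  - exact: leq_trans (proper_card prop) fn.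
  - split; last by rewrite sumrB -mulr_sumr sumc mulr0 subr0.
    by split=> // s; rewrite net_sub netc nf mulr0 subr0.
  exists J, f2; split => //; first exact: fintype.subset_trans (proper_sub prop).
  apply: le_trans rf; rewrite reward_sub.
  have -> : reward c = e * (reward f' - reward f).
    by rewrite /reward -sumrB mulr_sumr; apply: eq_bigr => a' _; rewrite /c; lra.
  by rewrite lerDl oppr_ge0 mulr_ge0_le0.
have [h|h] := leP (reward f') (reward f).
  by apply: (reduce 1); [left|rewrite mul1r subr_le0].
by apply: (reduce (-1)); [right|rewrite mulN1r oppr_le0 subr_ge0 ltW].
Qed.

Definition reward_bound : R := \sum_s `|ratr (r s)|.

Lemma ler_reward_bound s : `|ratr (r s) : R| <= reward_bound.
Proof. by rewrite /reward_bound (bigD1 s)//= lerDl sumr_ge0. Qed.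

Lemma reward_ge f : stationary f -> - reward_bound <= reward f.
Proof.
move=> [[f0 _] f1].
have -> : - reward_bound = \sum_a f a * - reward_bound by rewrite -mulr_suml f1 mul1r.
apply: ler_sum => a _; rewrite ler_wpM2l// lerNl (le_trans _ (ler_reward_bound (owner a)))//.
by rewrite -normrN ler_norm.
Qed.

(* Sets carrying no simple flow get the least possible mean payoff. *)
Definition gain J : R :=
  if pselect (exists f, simple J f) is left ex then reward (sval (cid ex))
  else - reward_bound.

Lemma gainE J f : simple J f -> gain J = reward f.
Proof.
move=> sJ; rewrite /gain; case: pselect => [ex|[]]; last by exists f.
case: cid => f' /= [sf' f'J _]; case: sJ => _ _ /(_ _ sf').
rewrite f'J subxx => /(_ isT) ff'.
by apply: eq_bigr => a _; rewrite ff'.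
Qed.

Lemma gain_ge J : - reward_bound <= gain J.
Proof.
rewrite /gain; case: pselect => // ex; case: cid => f' /= [sf' _ _].
exact: reward_ge.
Qed.

(* All sets of actions, sorted by gain: the position in this list breaks ties. *)
Definition ranking : seq {set action M} :=
  sort (fun J K => gain J <= gain K) (index_enum {set action M}).

Definition rank J := index J ranking.

Lemma rank_lt J : (rank J < size ranking)%N.
Proof. by rewrite index_mem mem_sort mem_index_enum. Qed.

Lemma nth_rank J : nth (@finset.set0 (action M)) ranking (rank J) = J.
Proof. by rewrite nth_index// mem_sort mem_index_enum. Qed.

Definition level_value (k : nat) : R :=
  if k is k'.+1 then gain (nth (@finset.set0 (action M)) ranking k') else - reward_bound.

Lemma level_value_le j k : (j <= k <= size ranking)%N -> level_value j <= level_value k.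
Proof.
case/andP; case: j k => [|j] [|k]//= jk kn; first exact: gain_ge.
have tr : transitive (fun J K => gain J <= gain K) by move=> ? ? ?; exact: le_trans.
have so : sorted (fun J K => gain J <= gain K) ranking.
  by apply: sort_sorted => J K; exact: le_total.
have re : reflexive (fun J K => gain J <= gain K) by move=> J; exact: lexx.
by apply: (sorted_leq_nth tr re (@finset.set0 (action M)) so); rewrite ?inE// (leq_ltn_trans _ kn).
Qed.

(** The successor reserves 0, the value of the empty maximum, for states on no simple flow. A
    positive level determines the set [J], which the real value of a state would not. *)
Definition lev (s : state M) : nat :=
  \max_(J | `[< exists f, simple J f >] && (s \in @owner _ M @: J)) (rank J).+1.

Definition state_value (s : state M) : R := level_value (lev s).

Lemma lev_le_size s : (lev s <= size ranking)%N.
Proof. by apply/bigmax_leqP => J _; exact: rank_lt. Qed.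

Lemma state_value_le s s' : (lev s <= lev s')%N -> state_value s <= state_value s'.
Proof. by move=> h; apply: level_value_le; rewrite h lev_le_size. Qed.

Lemma rank_lt_lev J f a : simple J f -> a \in J -> (rank J < lev (owner a))%N.
Proof.
move=> sJ aJ; apply: (@leq_bigmax_cond _ _ (fun J => (rank J).+1) J).
by rewrite imset_f// andbT; apply/asboolP; exists f.
Qed.

Lemma reward_le_state_value J f a : simple J f -> a \in J -> reward f <= state_value (owner a).
Proof.
move=> sJ aJ; rewrite -(gainE sJ) -(nth_rank J).
apply: (@level_value_le (rank J).+1); rewrite lev_le_size andbT.
exact: rank_lt_lev sJ aJ.
Qed.

Lemma levP s : lev s = 0%N \/ exists J f, [/\ lev s = (rank J).+1, simple J f & s \in @owner _ M @: J].
Proof.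
pose P (J : {set action M}) := `[< exists f, simple J f >] && (s \in @owner _ M @: J).
have [[J PJ]|noJ] := pselect (exists J, P J).
  right; have : (0 < #|P|)%N by apply/card_gt0P; exists J.
  move=> /(eq_bigmax_cond (fun J => (rank J).+1))[K /andP[/asboolP[f Kf] sK] levE].
  by exists K, f.
by left; rewrite /lev big1// => J PJ; case: noJ; exists J.
Qed.

(** At level 0 the choice is arbitrary and only has to be available at [s]. *)
Definition best_action (s : state M) : action M :=
  odflt (sval (cid (avail_ex s)))
    [pick a in nth (@finset.set0 (action M)) ranking (lev s).-1 | owner a == s].

Lemma owner_best_action s : owner (best_action s) = s.
Proof.
rewrite /best_action; case: pickP => [a /andP[_ /eqP]//|_] /=.
by apply/eqP; rewrite -ownerP; exact: svalP (cid (avail_ex s)).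
Qed.

Lemma best_action_in s J : lev s = (rank J).+1 -> s \in @owner _ M @: J -> best_action s \in J.
Proof.
move=> sJ /imsetP[a aJ as']; rewrite /best_action sJ /= nth_rank; case: pickP => [b /andP[]//|].
by move=> /(_ a); rewrite aJ as' eqxx.
Qed.

(** The best action carries positive weight in the simple flow of [s], so this flow enters [s'];
    being stationary, it also leaves [s'] by some action of [J]. *)
Lemma lev_best_action s s' : 0 < delta (best_action s) s' -> (lev s <= lev s')%N.
Proof.
move=> ps'; have [->//|[J [f [sJ Jf sJ']]]] := levP s.
have piJ := best_action_in sJ sJ'.
have [[[f0 nf] f1] fJ _] := Jf.
have fpi : 0 < f (best_action s) by rewrite lt0r f0 andbT; move: piJ; rewrite -fJ inE.
have : 0 < \sum_(a | owner a == s') f a.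
  have /eqP := nf s'; rewrite subr_eq0 => /eqP ->.
  rewrite (bigD1 (best_action s))//= ltr_pwDl ?mulr_gt0// sumr_ge0// => a _.
  by rewrite mulr_ge0// distr_ge0.
move=> /lt0r_neq0/eqP/(psumr_neq0P (fun a _ => f0 a))[a /andP[/eqP <- fa]].
rewrite sJ; apply: (rank_lt_lev Jf).
by rewrite -fJ inE gt_eqF.
Qed.

End levels.

(** * Mean payoff of balanced runs *)

Section limit_inferior.
Variables (R : realType) (u : nat -> R) (B : R).
Hypothesis uB : forall n, `|u n| <= B.

Let u_lb : has_lbound (range u).
Proof. by exists (- B) => _ [n _ <-]; have := uB n; rewrite ler_norml => /andP[]. Qed.

Let u_ub : has_ubound (range u).
Proof. by exists B => _ [n _ <-]; have := uB n; rewrite ler_norml => /andP[]. Qed.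

Let infs_cvg : infs u n @[n --> \oo] --> limn_inf u.
Proof.
have h := cvg_infs_sup u_ub u_lb.
by rewrite /limn_inf (cvg_lim (@Rhausdorff R) h).
Qed.

Let infs_le_limn_inf n : infs u n <= limn_inf u.
Proof.
have -> : limn_inf u = sup (range (infs u)).
  by rewrite /limn_inf; apply: (cvg_lim (@Rhausdorff R)); exact: cvg_infs_sup.
apply: ub_le_sup; last by exists n.
exists B => _ [m _ <-]; apply: (@le_trans _ _ (u m)); last first.
  by have := uB m; rewrite ler_norml => /andP[].
apply: ge_inf; last by exists m => /=.
by case: u_lb => b bP; exists b => _ [k _ <-]; apply: bP; exists k.
Qed.

(** The tail infima lie below [u] and still converge to the limit inferior along the finer filter
    [U]. *)
Lemma limn_inf_le_ultra (U : set_system nat) (UU : UltraFilter U) (sub : \oo `<=` U) (l : R) :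
  u n @[n --> U] --> l -> limn_inf u <= l.
Proof.
move=> ul; have iU : infs u n @[n --> U] --> limn_inf u by move=> A /infs_cvg; exact: sub.
rewrite -subr_ge0; apply: (@cvg_ge _ _ _ _ (fun n => u n - infs u n)); first exact: cvgB.
apply: filterE => n /=; rewrite subr_ge0; apply: ge_inf; last by exists n => /=.
by case: u_lb => b bP; exists b => _ [k _ <-]; apply: bP; exists k.
Qed.

(** The midpoint [c'] leaves a gap below [c] that survives a passage to the limit. *)
Lemma limn_inf_lt_often (c : R) : limn_inf u < c ->
  exists2 c', c' < c & forall n, exists2 m, (n <= m)%N & u m <= c'.
Proof.
move=> uc; pose c' := (limn_inf u + c) / 2.
have c'1 : limn_inf u < c' by rewrite /c'; lra.
exists c'; first by rewrite /c'; lra.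
move=> n; apply: contrapT => h.
have : c' <= infs u n.
  apply: lb_le_inf; first by exists (u n), n => /=.
  move=> _ [m /= nm <-]; rewrite leNgt; apply/negP => um; apply: h.
  by exists m => //; exact: ltW.
by rewrite leNgt (le_lt_trans (infs_le_limn_inf n) c'1).
Qed.

Lemma limn_inf_norm : `|limn_inf u| <= B.
Proof.
have [U [UU sub]] := ultraFilterLemma eventually_filter.
have [l ul] : exists l : R, u n @[n --> U] --> l.
  apply: (@cvg_ultra_bounded _ _ _ _ _ (- B) B); apply: filterE => n /=.
  by rewrite -ler_norml.
rewrite ler_norml; apply/andP; split; last first.
  apply: le_trans (limn_inf_le_ultra UU sub ul) _.
  rewrite -subr_ge0; apply: (@cvg_ge _ _ _ _ (fun n => B - u n)).
    by apply: cvgB => //; exact: cvg_cst.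
  by apply: filterE => n /=; rewrite subr_ge0; have := uB n; rewrite ler_norml => /andP[].
rewrite leNgt; apply/negP => /limn_inf_lt_often[c' c'B /(_ 0%N)[m _ um]].
by have := uB m; rewrite ler_norml leNgt (le_lt_trans um c'B).
Qed.

End limit_inferior.

(** * Limits of empirical action frequencies *)

Section frequencies.
Variables (R : realType) (M : mdp R) (r : state M -> rat).
Variable rho : run M.

Definition consistent := forall n, owner (rho n).2 = (rho n).1.

Definition imbalance (s : state M) (n : nat) : R :=
  \sum_(0 <= i < n) (((rho i).1 == s)%:R - delta (rho i).2 s).

(** For a consistent run this says that the net flow of the empirical frequencies vanishes
    asymptotically. *)
Definition balanced := forall s, n.+1%:R^-1 * imbalance s n.+1 @[n --> \oo] --> 0.

Definition freq (n : nat) (a : action M) : R :=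
  n.+1%:R^-1 * \sum_(0 <= i < n.+1) ((rho i).2 == a)%:R.

Hypotheses (cons : consistent) (bal : balanced).

Lemma sum_indicator (F : action M -> R) i : \sum_a ((rho i).2 == a)%:R * F a = F (rho i).2.
Proof.
rewrite (bigD1 (rho i).2)//= eqxx mul1r big1 ?addr0// => a.
by rewrite eq_sym => /negbTE ->; rewrite mul0r.
Qed.

Lemma sum_freq (F : action M -> R) n :
  \sum_a freq n a * F a = n.+1%:R^-1 * \sum_(0 <= i < n.+1) F (rho i).2.
Proof.
rewrite /freq; under eq_bigr do rewrite -mulrA mulr_suml.
rewrite -mulr_sumr exchange_big/=; congr (_ * _).
by apply: eq_bigr => i _; rewrite sum_indicator.
Qed.

Lemma net_freq s n : net (freq n) s = n.+1%:R^-1 * imbalance s n.+1.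
Proof.
rewrite /net /imbalance sumrB mulrBr sum_freq; congr (_ - _).
rewrite big_mkcond/= (eq_bigr (fun a => freq n a * (owner a == s)%:R)); last first.
  by move=> a _; case: ifP => _; rewrite ?mulr1 ?mulr0.
by rewrite sum_freq; congr (_ * _); apply: eq_bigr => i _; rewrite cons.
Qed.

Lemma reward_freq n :
  reward r (freq n) = arithmetic_mean (fun i => ratr (r (rho i).1)) n.
Proof.
rewrite /reward (sum_freq (fun a => ratr (r (owner a)))) /arithmetic_mean seriesEnat/=.
by congr (_ * _); apply: eq_bigr => i _; rewrite cons.
Qed.

Lemma freq_ge0 n a : 0 <= freq n a.
Proof. by rewrite /freq mulr_ge0 ?invr_ge0// sumr_ge0. Qed.

Lemma freq_sum1 n : \sum_a freq n a = 1.
Proof.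
under eq_bigr do rewrite -[freq _ _]mulr1.
by rewrite (sum_freq (fun=> 1)) sumr_const_nat subn0 mulVf.
Qed.

Lemma freq_le1 n a : freq n a <= 1.
Proof.
by rewrite -(freq_sum1 n) (bigD1 a)//= lerDl sumr_ge0// => b _; exact: freq_ge0.
Qed.

Variables (U : set_system nat) (phi : nat -> nat).
Hypotheses (UU : UltraFilter U) (sub : \oo `<=` U) (phi_ge : forall n, (n <= phi n)%N).

Lemma cvg_phi (v : nat -> R) (l : R) : v n @[n --> \oo] --> l -> v (phi n) @[n --> U] --> l.
Proof.
move=> vl A /vl [N _ NA]; apply: sub; exists N => // n /= Nn.
by apply: NA => /=; exact: leq_trans (phi_ge n).
Qed.

(** The index map [phi] allows the limit to be taken along chosen times, such as those at which the
    average reward is low. *)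
Lemma freq_limit : exists f, [/\ stationary f,
  (reward r (freq (phi n)) @[n --> U] --> reward r f),
  (forall a, f a != 0 -> forall m, exists2 n, (m <= n)%N & (rho n).2 = a) &
  (forall a, freq (phi n) a @[n --> U] --> f a)].
Proof.
have /choice[f ff] : forall a, exists l : R, freq (phi n) a @[n --> U] --> l.
  move=> a; apply: (@cvg_ultra_bounded _ _ _ _ _ 0 1); apply: filterE => n /=.
  by rewrite freq_ge0 freq_le1.
have f0 a : 0 <= f a by apply: (cvg_ge (ff a)); apply: filterE => n; exact: freq_ge0.
exists f; split => //.
- split; first split => // s.
    have h := @cvg_net _ _ _ _ UU _ _ s ff.
    apply: (cvg_unique (@Rhausdorff R) h).
    rewrite (_ : (fun n => _) = (fun n => (phi n).+1%:R^-1 * imbalance s (phi n).+1)).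
      exact: (cvg_phi (bal s)).
    by apply/funext => n; rewrite net_freq.
  have : (\sum_a freq (phi n) a) @[n --> U] --> \sum_a f a by exact: cvg_sumr.
  rewrite (_ : (fun n => _) = fun=> 1); last by apply/funext => n; rewrite freq_sum1.
  move=> h; apply/esym; apply: (cvg_unique (@Rhausdorff R) _ h); exact: cvg_cst.
- by apply: cvg_sumr => a; apply: cvgMl; exact: ff.
- move=> a fa m; apply: contrapT => h; move/eqP: fa; apply.
  apply: (cvg_unique (@Rhausdorff R) (ff a)).
  apply: (@cvg_phi (fun n => freq n a) 0).
  (* An action never played from time [m] on has been played at most [m] times, so its frequency is
     at most [m / (n + 1)]. *)
  have m0 : (m%:R * n.+1%:R^-1 : R) @[n --> \oo] --> 0.
    by rewrite -[X in _ --> X](mulr0 m%:R); apply: cvgM; [exact: cvg_cst|exact: cvg_harmonic].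
  apply: (squeeze_cvgr _ (cvg_cst 0) m0); apply: nearW => n; rewrite freq_ge0/=.
  rewrite /freq mulrC ler_pM2r ?invr_gt0//.
  apply: (@le_trans _ _ (\sum_(0 <= i < n.+1) (i < m)%N%:R)).
    apply: ler_sum => i _; rewrite ler_nat; case: eqP => //= ria.
    by rewrite ltnNge; case: (leqP m i) => // mi; case: h; exists i.
  rewrite -natr_sum ler_nat; elim: n.+1 => [|k ih]; first by rewrite big_nil.
  rewrite big_nat_recr//=; case: (ltnP k m) => km; last by rewrite addn0.
  rewrite addn1; apply: leq_ltn_trans km.
  rewrite -[leqRHS]muln1 -[in leqRHS](subn0 k) -sum_nat_const_nat.
  by apply: leq_sum => i _; case: (_ < _)%N.
Qed.

End frequencies.

Section mean_payoff_bounds.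
Variables (R : realType) (M : mdp R) (r : state M -> rat).
Implicit Type rho : run M.

Lemma avg_bound rho n :
  `|arithmetic_mean (fun i => ratr (r (rho i).1) : R) n| <= reward_bound r.
Proof.
rewrite /arithmetic_mean normrM ger0_norm// ler_pdivrMl// seriesEnat/=.
rewrite (le_trans (ler_norm_sum _ _ _))//.
rewrite mulr_natl -[in leRHS](subn0 n.+1) -sumr_const_nat.
by apply: ler_sum => i _; exact: ler_reward_bound.
Qed.

Lemma mean_payoff_bound rho : `|mean_payoff r rho| <= reward_bound r.
Proof. apply: limn_inf_norm; exact: avg_bound. Qed.

Lemma mean_payoff_le_state_value rho : consistent rho -> balanced rho ->
  exists2 s, (forall m, exists2 n, (m <= n)%N & (rho n).1 = s) &
    mean_payoff r rho <= state_value r s.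
Proof.
move=> cons bal; have [U [UU sub]] := ultraFilterLemma eventually_filter.
have [f [sf rf fio _]] := freq_limit r cons bal UU sub (fun n => leqnn n).
have [J [f' [Jf' Jf ff']]] := simple_exists r sf.
have [[[f'0 _] f'1] f'J _] := Jf'.
have [a aJ] : exists a, a \in J.
  apply: contrapT => h; move: f'1; rewrite big1 => [/esym/eqP|a _]; first by rewrite oner_eq0.
  by apply/eqP; apply: contrapT => fa; apply: h; exists a; rewrite -f'J inE; exact/negP.
exists (owner a).
  have fa : f a != 0 by have := fintype.subsetP Jf a aJ; rewrite inE.
  by move=> m; have [n mn <-] := fio a fa m; exists n => //; rewrite cons.
apply: le_trans (reward_le_state_value r Jf' aJ); apply: le_trans ff'.
apply: (limn_inf_le_ultra (avg_bound rho) UU sub).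
by under eq_cvg do rewrite -(reward_freq r cons).
Qed.

Lemma state_value_le_mean_payoff rho n0 : consistent rho -> balanced rho ->
  (forall n, (n0 <= n)%N -> (rho n).2 = best_action r (rho n).1) ->
  (forall n, 0 < delta (rho n).2 (rho n.+1).1) ->
  state_value r (rho n0).1 <= mean_payoff r rho.
Proof.
move=> cons bal rpi rpos.
pose L n := lev r (rho n).1.
have Ln m n : (n0 <= m)%N -> (m <= n)%N -> (L m <= L n)%N.
  move=> n0m; elim: n => [|n ih]; first by rewrite leqn0 => /eqP ->.
  rewrite leq_eqVlt => /predU1P[->//|]; rewrite ltnS => mn.
  apply: leq_trans (ih mn) _; apply: lev_best_action; rewrite -rpi//.
  exact: leq_trans mn.
(* The level is nondecreasing from [n0] on and bounded, hence eventually constant. *)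
have [n1 n01 Lmax] : exists2 n1, (n0 <= n1)%N & forall n, (n1 <= n)%N -> L n = L n1.
  have ex : exists k, `[< exists2 n, (n0 <= n)%N & L n = k >].
    by exists (L n0); apply/asboolP; exists n0.
  have ub k : `[< exists2 n, (n0 <= n)%N & L n = k >] -> (k <= size (ranking r))%N.
    by move=> /asboolP[n _ <-]; exact: lev_le_size.
  have [k /asboolP[n1 n01 Lk] kmax] := ex_maxnP ex ub.
  exists n1 => // n n1n; apply/eqP; rewrite eqn_leq (Ln n1 n)// andbT Lk.
  by apply: kmax; apply/asboolP; exists n => //; exact: leq_trans n1n.
apply: (@le_trans _ _ (state_value r (rho n1).1)); first by apply: state_value_le; exact: Ln.
have [L0|[J [f [LJ Jf _]]]] := levP r (rho n1).1.
  rewrite /state_value L0 /=; have := mean_payoff_bound rho.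
  by rewrite ler_norml => /andP[].
have [_ fJ uni] := Jf.
(* A constant level means a constant set of actions, because a set is recovered from its rank. *)
have inJ n : (n1 <= n)%N -> (rho n).2 \in J.
  move=> n1n; have n0n := leq_trans n01 n1n.
  have LnJ : lev r (rho n).1 = (rank r J).+1 by rewrite -LJ; exact: Lmax.
  rewrite rpi//; apply: best_action_in => //.
  have [|[K [g [LK _]]]] := levP r (rho n).1; first by rewrite LnJ.
  suff -> : J = K by [].
  by rewrite -(nth_rank r J) -(nth_rank r K); congr nth; apply: succn_inj; rewrite -LK -LnJ.
rewrite /state_value LJ /= nth_rank (gainE r Jf) leNgt; apply/negP.
move=> /(limn_inf_lt_often (avg_bound rho))[c' c'f often].
(* Along times with average at most [c'] the frequencies have a stationary limit supported in [J],
   which is [f] by uniqueness; its reward would be at most [c'], below [reward f]. *)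
have /choice[phi phiP] : forall n, exists m,
    (n <= m)%N /\ arithmetic_mean (fun i => ratr (r (rho i).1) : R) m <= c'.
  by move=> n; have [m] := often n; exists m.
have [U [UU sub]] := ultraFilterLemma eventually_filter.
have [g [sg rg gio _]] := freq_limit r cons bal UU sub (fun n => (phiP n).1).
have gf : g =1 f.
  apply: uni => //; apply/fintype.subsetP => a; rewrite inE => ga.
  by have [n n1n <-] := gio a ga n1; exact: inJ.
have : 0 <= c' - reward r g.
  apply: (@cvg_ge _ _ _ _ (fun n => c' - reward r (freq rho (phi n)))).
    by apply: cvgB => //; exact: cvg_cst.
  by apply: filterE => n /=; rewrite subr_ge0 (reward_freq r cons); exact: (phiP n).2.
have -> : reward r g = reward r f by apply: eq_bigr => a _; rewrite gf.
by rewrite subr_ge0 leNgt c'f.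
Qed.

End mean_payoff_bounds.

(** * Law of large numbers *)

Section fibers.
Context d (X : measurableType d) (R : realType) (P : probability X R).

Definition prob (A : set X) : R := fine (P A).

Lemma probE A : measurable A -> P A = (prob A)%:E.
Proof. by move=> mA; rewrite /prob fineK// fin_num_measure. Qed.

Lemma prob_ge0 A : 0 <= prob A.
Proof. exact: fine_ge0. Qed.

Lemma prob_le A B : measurable A -> measurable B -> A `<=` B -> prob A <= prob B.
Proof. by move=> mA mB AB; rewrite -lee_fin -!probE// le_measure// inE. Qed.

Lemma measure_fibers (V : countType) (g : X -> V) (E : set X) :
  measurable E -> (forall v, measurable [set u | g u = v]) ->
  P E = (\esum_(v in [set: V]) P (E `&` [set u | g u = v]))%E.
Proof.
move=> mE mg; rewrite esum_pickle//.
pose F k := oapp (fun v => E `&` [set u | g u = v]) set0 (@pickle_inv V k).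
have mF k : measurable (F k).
  by rewrite /F; case: pickle_inv => //= v; exact: measurableI.
have -> : P E = P (\bigcup_k F k).
  congr (P _); apply/seteqP; split=> [u Eu|u [k _]]; last first.
    by rewrite /F; case: pickle_inv => //= v [].
  by exists (pickle (g u)) => //; rewrite /F pickleK_inv.
rewrite measure_semi_bigcup//; last 2 first.
- apply/trivIsetP => i j _ _ ij; apply/seteqP; split=> // u.
  rewrite /F; case Ei : (pickle_inv i) => [v|] [] //= [_ gv].
  case Ej : (pickle_inv j) => [w|] //= [_ gw].
  have := @pickle_invK V i; have := @pickle_invK V j; rewrite Ei Ej /= -gv -gw => ji ii.
  by move: ij; rewrite -ji -ii eqxx.
- exact: bigcupT_measurable.
by apply: eq_eseriesr => k _; rewrite /F; case: pickle_inv => //=; rewrite measure0.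
Qed.

Lemma prob_fibers (V : finType) (g : X -> V) (E : set X) :
  measurable E -> (forall v, measurable [set u | g u = v]) ->
  prob E = \sum_v prob (E `&` [set u | g u = v]).
Proof.
move=> mE mg; rewrite {1}/prob (measure_fibers mE mg).
have -> : (\esum_(v in [set: V]) P (E `&` [set u | g u = v]) =
    \esum_(v in [set: V]) (prob (E `&` [set u | g u = v]))%:E)%E.
  by apply: eq_esum => v _; rewrite probE//; exact: measurableI.
by rewrite esum_fin// => v; exact: prob_ge0.
Qed.

Lemma prob_setU_le (A B : set X) : measurable A -> measurable B ->
  prob (A `|` B) <= prob A + prob B.
Proof.
move=> mA mB; rewrite -lee_fin EFinD -!probE//; last exact: measurableU.
exact: measureU2.
Qed.

Lemma prob_setC (A : set X) : measurable A -> prob (~` A) = 1 - prob A.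
Proof. by move=> mA; rewrite {1}/prob probability_setC// probE// -EFinB. Qed.

End fibers.

Section prefixes.
Variables (T : countType) (x0 : T).

Lemma measurable_prefix n (Q : set (seq T)) :
  measurable [set u : traj x0 | Q (mkseq u n)].
Proof.
rewrite (_ : [set _ | _] = \bigcup_k oapp
    (fun w => if `[< size w = n /\ Q w >] then cylinder x0 w
              else set0) set0 (@pickle_inv (seq T) k)).
  apply: bigcupT_measurable => k; case: (pickle_inv k) => [w|] //=.
  by case: ifP => // _; exact: measurable_cylinder.
apply/seteqP; split=> [u /= Qu|u [k _]].
  exists (pickle (mkseq u n)) => //; rewrite pickleK_inv /= asboolT ?size_mkseq//.
  by rewrite /cylinder /mkset size_mkseq.
case: (pickle_inv k) => [w|] //=; case: asboolP => // -[sw Qw].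
by rewrite /cylinder/= sw => uw; rewrite -uw in Qw.
Qed.

Lemma measurable_coord_eq n (x : T) : measurable [set u : traj x0 | u n = x].
Proof. exact: (@measurable_coord _ x0 n [set x]). Qed.

Lemma mkseqS_rcons (u : nat -> T) n : mkseq u n.+1 = rcons (mkseq u n) (u n).
Proof. by rewrite /mkseq -addn1 iotaD map_cat cats1. Qed.

Lemma cylinder_rcons (h : seq T) x : cylinder x0 (rcons h x) =
  cylinder x0 h `&` [set u | u (size h) = x].
Proof.
apply/seteqP; split=> u /=; rewrite /cylinder /mkset size_rcons mkseqS_rcons.
  by move=> /rcons_inj[-> ->].
by move=> [-> ->].
Qed.

End prefixes.

(** * Expectations over finite prefixes *)

Section words.
Variables (R : realType) (T : finType) (x0 : T) (P : probability (traj x0) R).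
Implicit Types (F G : seq T -> R) (h : seq T).

Definition word_prob h : R := prob P (cylinder x0 h).

(** When [F] is weighted by [word_prob], this is an unnormalized conditional expectation given the
    prefix [h]; moments of prefixes become iterated finite sums. *)
Definition next_sum F h : R := \sum_(x : T) F (rcons h x).

(* The expectation of [F] over the first [k] letters. *)
Definition word_mean k F : R := iter k next_sum (fun h => F h * word_prob h) [::].

Lemma iter_next_sum_le k F G h : (forall h', size h' = (size h + k)%N -> F h' <= G h') ->
  iter k next_sum F h <= iter k next_sum G h.
Proof.
elim: k h => [|k ih] h FG /=; first by apply: FG; rewrite addn0.
by apply: ler_sum => x _; apply: ih => h' sh'; apply: FG; rewrite sh' size_rcons addSnnS.
Qed.

Lemma iter_next_sum_lin k F G c h : iter k next_sum (fun h => F h + c * G h) h =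
  iter k next_sum F h + c * iter k next_sum G h.
Proof.
elim: k h => //= k ih h; rewrite /next_sum mulr_sumr -big_split/=.
by apply: eq_bigr => x _; rewrite -ih.
Qed.

Lemma word_prob_next h (C : pred T) : \sum_(x | C x) word_prob (rcons h x) =
  prob P (cylinder x0 h `&` [set u | C (u (size h))]).
Proof.
rewrite (@prob_fibers _ _ _ P _ (fun u : traj x0 => u (size h))); last 2 first.
- apply: measurableI; first exact: measurable_cylinder.
  exact: (@measurable_coord _ x0 _ [set x | C x]).
- by move=> v; exact: measurable_coord_eq.
rewrite big_mkcond; apply: eq_bigr => x _; case: ifPn => Cx.
  congr (prob P _); rewrite cylinder_rcons; apply/seteqP; split=> u /=.
    by move=> [hu ux]; rewrite ux.
  by move=> [[hu _] ux].
rewrite (_ : _ `&` _ = set0) ?/prob ?measure0//.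
by apply/seteqP; split=> // u /= [[_ Cu] ux]; rewrite ux (negbTE Cx) in Cu.
Qed.

Lemma next_sum_prob h : next_sum word_prob h = word_prob h.
Proof.
rewrite /next_sum (word_prob_next h predT) /word_prob; congr (prob P _).
by apply/seteqP; split=> [u []|].
Qed.

Lemma iter_next_sum_prob k h : iter k next_sum word_prob h = word_prob h.
Proof.
elim: k h => //= k ih h; rewrite -[RHS]next_sum_prob.
by apply: eq_bigr => x _; exact: ih.
Qed.

Lemma word_prob0 : word_prob [::] = 1.
Proof.
rewrite /word_prob /prob (_ : cylinder _ _ = setT) ?probability_setT//.
by apply/seteqP; split.
Qed.

Lemma prob_prefix_iter (Q : pred (seq T)) k h :
  prob P (cylinder x0 h `&` [set u | Q (mkseq u (size h + k))]) =
  iter k next_sum (fun h => (Q h)%:R * word_prob h) h.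
Proof.
elim: k h => [|k ih] h /=.
  rewrite addn0; case: (boolP (Q h)) => Qh; rewrite ?mul1r ?mul0r.
    congr (prob P _); apply/seteqP; split=> [u []//|u hu]; split=> //=.
    by rewrite hu.
  rewrite (_ : _ `&` _ = set0) ?/prob ?measure0//.
  by apply/seteqP; split=> // u /= [-> Qu]; rewrite Qu in Qh.
rewrite (@prob_fibers _ _ _ P _ (fun u : traj x0 => u (size h))); last 2 first.
- apply: measurableI; first exact: measurable_cylinder.
  exact: (@measurable_prefix _ x0 _ [set h | Q h]).
- by move=> v; exact: measurable_coord_eq.
apply: eq_bigr => x _; rewrite -ih; congr (prob P _).
by rewrite cylinder_rcons size_rcons addSnnS setIAC.
Qed.

Lemma prob_prefix (Q : pred (seq T)) k :
  prob P [set u | Q (mkseq u k)] = word_mean k (fun h => (Q h)%:R).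
Proof.
rewrite /word_mean -prob_prefix_iter /=; congr (prob P _).
by apply/seteqP; split=> u // [].
Qed.

Lemma word_prob_ge0 h : 0 <= word_prob h.
Proof. exact: prob_ge0. Qed.

Lemma prob_prefix_markov (F : seq T -> R) (c : R) k : 0 < c -> (forall h, 0 <= F h) ->
  prob P [set u | c <= F (mkseq u k)] <= c^-1 * word_mean k F.
Proof.
move=> c0 F0; rewrite (prob_prefix (fun h => c <= F h)) /word_mean.
have -> : c^-1 * iter k next_sum (fun h => F h * word_prob h) [::] =
    iter k next_sum (fun h => 0 * F h + c^-1 * (F h * word_prob h)) [::].
  rewrite iter_next_sum_lin; suff -> : iter k next_sum (fun h => 0 * F h) [::] = 0.
    by rewrite add0r.
  elim: k [::] => [|k ih] h /=; first by rewrite mul0r.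
  by rewrite /next_sum big1// => x _; exact: ih.
apply: iter_next_sum_le => h _; rewrite mul0r add0r mulrA ler_wpM2r ?word_prob_ge0//.
case: (leP c (F h)) => [cF|_]; last by rewrite mulr_ge0// invr_ge0 ltW.
by rewrite ler_pdivlMl ?mulr1.
Qed.

End words.

(** * Martingale deviations of visit counts *)

Section play_laws.
Variables (R : realType) (M : mdp R).

Definition run_point : state M * action M :=
  (init_state M, sval (cid (avail_ex (init_state M)))).

(** What every strategy leaves on runs once its memory is erased: given any past, the successor
    state is drawn from [delta]. Arguments from this record apply to all memories. *)
Record play_law (P : probability (run M) R) : Prop := PlayLaw {
  law_step : forall n (Q : set (seq (state M * action M))) a s,
    prob P [set rho | [/\ Q (mkseq rho n.+1), (rho n).2 = a & (rho n.+1).1 = s]] =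
    prob P [set rho | Q (mkseq rho n.+1) /\ (rho n).2 = a] * delta a s ;
  law_init : P [set rho | (rho 0%N).1 <> init_state M] = 0%E ;
  law_consistent : forall n, P [set rho | owner (rho n).2 <> (rho n).1] = 0%E
}.

Variables (P : probability (run M) R).
Hypothesis law : play_law P.

Local Notation T := (state M * action M)%type.
Local Notation mu := (word_prob P).
Local Notation W := (@next_sum R T).

Definition deviation (rho : nat -> T) (s : state M) (n : nat) : R :=
  \sum_(0 <= i < n) (((rho i.+1).1 == s)%:R - delta (rho i).2 s).

Lemma step_bound (x : bool) (a : action M) s : `|x%:R - delta a s| <= 1.
Proof.
have := distr_ge0 (delta a) s; have := distr_le1 (delta a) s.
by rewrite ler_norml; case: x => /= ? ?; apply/andP; split; lra.
Qed.

Lemma deviation_bound rho s n : `|deviation rho s n| <= n%:R.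
Proof.
rewrite /deviation (le_trans (ler_norm_sum _ _ _))//.
rewrite -[n in leRHS]subn0 -sumr_const_nat; apply: ler_sum => i _; exact: step_bound.
Qed.

Lemma deviationS rho s n : deviation rho s n.+1 =
  deviation rho s n + (((rho n.+1).1 == s)%:R - delta (rho n).2 s).
Proof. by rewrite /deviation big_nat_recr. Qed.

Lemma deviation_prefix (rho : nat -> T) s k :
  deviation (nth run_point (mkseq rho k.+1)) s k = deviation rho s k.
Proof.
apply: eq_big_nat => i /andP[_ ik]; rewrite !nth_mkseq//.
exact: ltnW.
Qed.

Lemma deviation_rcons h x s k : size h = k.+1 ->
  deviation (nth run_point (rcons h x)) s k.+1 =
  deviation (nth run_point h) s k + ((x.1 == s)%:R - delta (nth run_point h k).2 s).
Proof.
move=> sh; rewrite deviationS nth_rcons sh ltnn eqxx nth_rcons sh ltnSn; congr (_ + _).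
apply: eq_big_nat => i /andP[_ ik]; rewrite !nth_rcons sh !ltnS ik.
by rewrite (ltnW ik).
Qed.

(** The martingale property: given the past, the increments of [deviation] have mean zero. *)
Lemma sum_step h s k : size h = k.+1 ->
  \sum_(x : T) ((x.1 == s)%:R - delta (nth run_point h k).2 s) * mu (rcons h x) = 0.
Proof.
move=> sh; under eq_bigr do rewrite mulrBl.
rewrite sumrB -mulr_sumr -[\sum_x mu (rcons h x)]/(next_sum mu h) next_sum_prob.
have -> : \sum_(x : T) (x.1 == s)%:R * mu (rcons h x) =
    \sum_(x : T | x.1 == s) mu (rcons h x).
  by rewrite [RHS]big_mkcond; apply: eq_bigr => x _; case: ifP; rewrite ?mul1r ?mul0r.
rewrite (word_prob_next P h (fun x : T => x.1 == s)) sh.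
set a := (nth run_point h k).2.
have := law_step law k [set h] a s.
have -> : [set rho : run M | [/\ [set h] (mkseq rho k.+1), (rho k).2 = a & (rho k.+1).1 = s]] =
    cylinder run_point h `&` [set u | (u k.+1).1 == s].
  apply/seteqP; split=> u /=; rewrite /cylinder /mkset sh.
    by move=> [hu _ /eqP].
  move=> [hu /eqP us]; split=> //.
  by rewrite /a -hu nth_mkseq.
have -> : [set rho : run M | [set h] (mkseq rho k.+1) /\ (rho k).2 = a] = cylinder run_point h.
  apply/seteqP; split=> u /=; rewrite /cylinder /mkset sh; first by case.
  by move=> hu; split=> //; rewrite /a -hu nth_mkseq.
by move=> ->; rewrite mulrC subrr.
Qed.

Lemma iter_next_sumSr k F h : iter k.+1 W F h = iter k W (W F) h.
Proof. by rewrite iterSr. Qed.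

Lemma second_moment s k :
  word_mean P k.+1 (fun h => deviation (nth run_point h) s k ^+ 2) <= k%:R.
Proof.
elim: k => [|k ih].
  rewrite /word_mean (le_trans (_ : _ <= iter 1 W (fun h => 0 * mu h) [::]))//.
    by apply: iter_next_sum_le => h _; rewrite /deviation big_geq// expr0n.
  by rewrite /= /next_sum big1// => x _; rewrite mul0r.
rewrite /word_mean iter_next_sumSr.
apply: (@le_trans _ _ (iter k.+1 W
    (fun h => deviation (nth run_point h) s k ^+ 2 * mu h + 1 * mu h) [::])).
  apply: iter_next_sum_le => h; rewrite add0n => sh.
  rewrite /next_sum; set m := deviation _ s k.
  pose X (x : T) : R := (x.1 == s)%:R - delta (nth run_point h k).2 s.
  (* In the expansion of [(m + X x) ^+ 2] the cross term has mean zero and the last square is at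
     most 1. *)
  apply: (@le_trans _ _ (\sum_(x : T) (2 * m * (X x * mu (rcons h x)) + (m ^+ 2 + 1) * mu (rcons h x)))).
    apply: ler_sum => x _; rewrite deviation_rcons// -/m -/(X x) mulrA -mulrDl.
    apply: ler_wpM2r; first exact: word_prob_ge0.
    have : X x ^+ 2 <= 1 by rewrite -real_normK ?num_real// expr_le1// step_bound.
    nra.
  rewrite big_split/= -!mulr_sumr sum_step// mulr0 add0r.
  by rewrite -[\sum_x mu (rcons h x)]/(next_sum mu h) next_sum_prob mulrDl.
rewrite iter_next_sum_lin iter_next_sum_prob word_prob0 mulr1 -natr1.
by rewrite lerD2r.
Qed.

(** The second moment would give deviation probabilities of order [1 / k], which are not summable;
    the fourth gives [1 / k ^+ 2]. One step adds at most six times the second moment plus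
    [4 * k + 1], hence at most [10 * k + 1], and the constant 5 absorbs this. *)
Lemma fourth_moment s k :
  word_mean P k.+1 (fun h => deviation (nth run_point h) s k ^+ 4) <= 5 * k%:R ^+ 2.
Proof.
elim: k => [|k ih].
  rewrite /word_mean (le_trans (_ : _ <= iter 1 W (fun h => 0 * mu h) [::]))//.
    by apply: iter_next_sum_le => h _; rewrite /deviation big_geq// expr0n.
  by rewrite /= /next_sum expr0n mulr0 big1// => x _; rewrite mul0r.
rewrite /word_mean iter_next_sumSr.
pose D h : R := deviation (nth run_point h) s k.
apply: (@le_trans _ _ (iter k.+1 W (fun h => (D h ^+ 4 * mu h + 6 * (D h ^+ 2 * mu h)) +
    (4 * k%:R + 1) * mu h) [::])).
  apply: iter_next_sum_le => h; rewrite add0n => sh.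
  rewrite /next_sum; pose m := D h.
  pose X (x : T) : R := (x.1 == s)%:R - delta (nth run_point h k).2 s.
  apply: (@le_trans _ _ (\sum_(x : T) (4 * m ^+ 3 * (X x * mu (rcons h x)) +
      (m ^+ 4 + 6 * m ^+ 2 + (4 * k%:R + 1)) * mu (rcons h x)))).
    apply: ler_sum => x _; rewrite deviation_rcons// -/(D h) -/m -/(X x) mulrA -mulrDl.
    apply: ler_wpM2r; first exact: word_prob_ge0.
    have X1 : `|X x| <= 1 by exact: step_bound.
    have X2 : X x ^+ 2 <= 1 by rewrite -real_normK ?num_real// expr_le1.
    have X4 : X x ^+ 4 <= 1 by rewrite (exprM _ 2 2) expr_le1// sqr_ge0.
    have mX : m * X x ^+ 3 <= k%:R.
      rewrite (le_trans (ler_norm _))// normrM -[k%:R]mulr1 ler_pM//.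
        exact: deviation_bound.
      by rewrite normrX expr_le1.
    have m2X : m ^+ 2 * X x ^+ 2 <= m ^+ 2 by rewrite ler_piMr// sqr_ge0.
    have -> : (m + X x) ^+ 4 = m ^+ 4 + 4 * m ^+ 3 * X x + 6 * (m ^+ 2 * X x ^+ 2) +
      4 * (m * X x ^+ 3) + X x ^+ 4 by ring.
    lra.
  rewrite big_split/= -!mulr_sumr sum_step// mulr0 add0r.
  rewrite -[\sum_x mu (rcons h x)]/(next_sum mu h) next_sum_prob -/m.
  by rewrite le_eqVlt; apply/orP; left; apply/eqP; ring.
rewrite !iter_next_sum_lin iter_next_sum_prob word_prob0 mulr1.
have := second_moment s k; rewrite /word_mean in ih *; rewrite -/D.
rewrite -natr1 => h2; move: ih; rewrite -/D => h4.
have := ler0n R k.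
nra.
Qed.

Lemma prob_deviation s k (e : R) : 0 < e ->
  prob P [set rho | e * k.+1%:R <= `|deviation rho s k|] <=
  5 / e ^+ 4 * (k.+1%:R ^- 2).
Proof.
move=> e0; have k0 : 0 < e * k.+1%:R by rewrite mulr_gt0.
have -> : [set rho : run M | e * k.+1%:R <= `|deviation rho s k|] =
    [set rho | (e * k.+1%:R) ^+ 4 <= deviation (nth run_point (mkseq rho k.+1)) s k ^+ 4].
  apply/seteqP; split=> rho /=; rewrite deviation_prefix -[deviation _ _ _ ^+ 4]ger0_norm;
    rewrite ?(exprM _ 2 2) ?sqr_ge0// -!exprM normrX ler_pXn2r// ?nnegrE ?ltW//.
apply: le_trans (prob_prefix_markov P
  (F := fun h => deviation (nth run_point h) s k ^+ 4) _ _ _) _.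
- by rewrite exprn_gt0.
- by move=> h; rewrite (exprM _ 2 2) sqr_ge0.
have -> : 5 / e ^+ 4 * k.+1%:R ^- 2 = (e * k.+1%:R) ^- 4 * (5 * k.+1%:R ^+ 2).
  rewrite exprMn; field.
  by rewrite addrC natr1 pnatr_eq0/= gt_eqF.
rewrite ler_wpM2l ?invr_ge0 ?exprn_ge0 ?(ltW k0)//.
apply: le_trans (fourth_moment s k) _.
by rewrite ler_wpM2l// ler_pXn2r ?nnegrE// ler_nat.
Qed.

Lemma measurable_deviation s k (B : set R) :
  measurable [set rho : run M | B (deviation rho s k)].
Proof.
have -> : [set rho : run M | B (deviation rho s k)] =
    [set rho | [set h | B (deviation (nth run_point h) s k)] (mkseq rho k.+1)].
  by apply/seteqP; split=> rho /=; rewrite deviation_prefix.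
exact: measurable_prefix.
Qed.

(** The subtracted term closes the induction: an inverse square is at most a difference of
    consecutive inverses. *)
Lemma sum_inv_sqr n : \sum_(0 <= k < n.+1) (k.+1%:R ^- 2 : R) <= 2 - n.+1%:R^-1.
Proof.
elim: n => [|n ih]; first by rewrite big_nat1 expr1n !invr1; lra.
rewrite big_nat_recr//= (le_trans (lerD ih (lexx _)))//.
set x : R := n.+1%:R.
have x0 : 0 < x by rewrite ltr0n.
have -> : n.+2%:R = x + 1 :> R by rewrite /x natr1.
rewrite -subr_ge0.
have -> : 2 - (x + 1)^-1 - (2 - x^-1 + (x + 1) ^- 2) = x^-1 * (x + 1) ^- 2.
  by field; lra.
by rewrite mulr_ge0 ?invr_ge0 ?exprn_ge0//; lra.
Qed.

(** Borel-Cantelli for each threshold [1 / (j + 1)], then a countable intersection over [j]. *)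
Lemma deviation_cvg0 s :
  {ae P, forall rho : run M, n.+1%:R^-1 * deviation rho s n @[n --> \oo] --> 0}.
Proof.
pose F j k : set (run M) := [set rho | j.+1%:R^-1 * k.+1%:R <= `|deviation rho s k|].
have mF j k : measurable (F j k).
  exact: (measurable_deviation s k [set x | j.+1%:R^-1 * k.+1%:R <= `|x|]).
have F0 j : P (lim_sup_set (F j)) = 0%E.
  apply: lim_sup_set_cvg0 => //.
  pose C : R := 5 / j.+1%:R^-1 ^+ 4.
  apply: (@le_lt_trans _ _ (C * 2)%:E); last exact: ltry.
  apply: lime_le; first by apply: is_cvg_nneseries.
  apply: nearW => -[|n]; first by rewrite big_geq// lee_fin mulr_ge0 ?divr_ge0 ?exprn_ge0.
  rewrite (eq_bigr (fun k => (prob P (F j k))%:E)); last by move=> k _; exact: probE.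
  rewrite sumEFin lee_fin (le_trans (_ : _ <= C * (\sum_(0 <= k < n.+1) k.+1%:R ^- 2)))//.
    by rewrite mulr_sumr; apply: ler_sum => k _; apply: prob_deviation; rewrite invr_gt0.
  rewrite ler_wpM2l ?divr_ge0 ?exprn_ge0// (le_trans (sum_inv_sqr n))//.
  by rewrite gerBl invr_ge0.
have : {ae P, forall rho, forall j, ~ lim_sup_set (F j) rho}.
  apply/ae_foralln => j; exists (lim_sup_set (F j)); split => //.
    by apply: bigcap_measurable => // n _; exact: bigcup_measurable.
    exact: F0.
  by move=> rho /= /contrapT.
apply: filterS => rho h; apply/cvgrPdist_lt => e e0.
have [j je] : exists j, j.+1%:R^-1 < e.
  exists (Num.trunc e^-1).
  by rewrite -[ltRHS]invrK ltf_pV2 ?posrE ?invr_gt0// Num.Theory.truncnS_gt.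
have /existsNP[N /= hN] : ~ forall n, (\bigcup_(k in [set k | (n <= k)%N]) F j k) rho.
  by move=> H; apply: (h j) => n _; exact: H.
exists N => // n /= Nn; rewrite sub0r normrN normrM ger0_norm ?invr_ge0//.
rewrite (lt_trans _ je)// ltr_pdivrMl// mulrC ltNge; apply/negP => Fn.
by apply: hN; exists n.
Qed.

Lemma imbalance_deviation (rho : run M) s n : imbalance rho s n =
  deviation rho s n + ((rho 0%N).1 == s)%:R - ((rho n).1 == s)%:R.
Proof.
elim: n => [|n ih]; first by rewrite /imbalance /deviation !big_geq// add0r subrr.
by rewrite /imbalance big_nat_recr//= -/(imbalance rho s n) ih deviationS; ring.
Qed.

Lemma law_balanced : {ae P, forall rho, balanced rho}.
Proof.
have : {ae P, forall rho : run M, forall s, n.+1%:R^-1 * deviation rho s n @[n --> \oo] --> 0}.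
  (* States are enumerated so that the exceptional null sets are indexed by natural numbers. *)
  have H : forall i, {ae P, forall rho : run M,
      n.+1%:R^-1 * deviation rho (nth (init_state M) (enum (state M)) i) n @[n --> \oo] --> 0}.
    by move=> i; exact: deviation_cvg0.
  move/ae_foralln : H; apply: filterS => rho h s.
  by have := h (index s (enum (state M))); rewrite nth_index// mem_enum.
apply: filterS => rho h s.
have inv0 : (n.+1%:R^-1 : R) @[n --> \oo] --> 0 by exact: cvg_harmonic.
have -> : (fun n => n.+1%:R^-1 * imbalance rho s n.+1) =
    (fun n => n.+1%:R^-1 * deviation rho s n +
      n.+1%:R^-1 * (((rho 0%N).1 == s)%:R - delta (rho n).2 s)).
  by apply/funext => n; rewrite imbalance_deviation deviationS; ring.
rewrite -[X in _ --> X](addr0 0); apply: cvgD; first exact: h.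
apply/cvgr0Pnorm_le => e e0.
have /cvgr0Pnorm_le/(_ e e0)[N _ hN] := inv0.
exists N => // n /hN; apply: le_trans; rewrite normrM ler_piMr//.
exact: step_bound.
Qed.

Lemma law_consistent_ae : {ae P, forall rho, consistent rho}.
Proof.
have H n : {ae P, forall rho : run M, owner (rho n).2 = (rho n).1}.
  exists [set rho : run M | owner (rho n).2 <> (rho n).1]; split => //.
    exact: (@measurable_coord _ _ n [set x | owner x.2 <> x.1]).
  exact: law_consistent.
exact/ae_foralln.
Qed.

End play_laws.

(** * Runs of a strategy *)

Section distribution_mass.
Variable R : realType.

Lemma dbindE (T U : countType) (d : distr R T) (k : T -> distr R U) y :
  (dbind d k y)%:E = (\esum_(x in [set: T]) (d x * k x y)%:E)%E.
Proof.
rewrite /= fineK// ge0_fin_numE; last first.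
  by apply: esum_ge0 => x _; rewrite lee_fin mulr_ge0// distr_ge0.
apply: (@le_lt_trans _ _ 1%E); last exact: ltry.
rewrite -(distr_sum1 d); apply: le_esum => x _.
by rewrite lee_fin ler_piMr ?distr_ge0 ?distr_le1.
Qed.

Lemma esum_single (T : countType) (f : T -> \bar R) x : (forall y, 0 <= f y)%E ->
  (forall y, y != x -> f y = 0%E) -> (\esum_(y in [set: T]) f y = f x)%E.
Proof.
move=> f0 fx; rewrite (esumID [set x])//.
rewrite setTI esum_set1// esum1 ?adde0// => y [_ /= yx].
by apply: fx; exact/eqP.
Qed.

Lemma dbind_single (T U : countType) (d : distr R T) (k : T -> distr R U) x y :
  (forall x', x' != x -> k x' y = 0) -> dbind d k y = d x * k x y.
Proof.
move=> kx; apply: EFin_inj; rewrite dbindE (@esum_single _ _ x)//.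
  by move=> x'; rewrite lee_fin mulr_ge0// distr_ge0.
by move=> x' /kx ->; rewrite mulr0.
Qed.

Definition mass (T : countType) (d : distr R T) (B : set T) : \bar R :=
  (\esum_(x in B) (d x)%:E)%E.

Lemma mass_dbind (T U : countType) (d : distr R T) (k : T -> distr R U) (B : set U) :
  mass (dbind d k) B = (\esum_(x in [set: T]) ((d x)%:E * mass (k x) B))%E.
Proof.
have dk0 x y : (0 <= (d x * k x y)%:E)%E by rewrite lee_fin mulr_ge0// distr_ge0.
rewrite /mass; under eq_esum do rewrite dbindE.
rewrite esum_esum//.
transitivity (\esum_(x in [set: T]) \esum_(y in B) (d x * k x y)%:E)%E.
  rewrite esum_esum//; symmetry.
  rewrite (@reindex_esum _ _ _ (B `*`` fun=> [set: T])
    ([set: T] `*`` fun=> B) (fun p => (p.2, p.1)))//.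
  split => //=; first by move=> [? ?] [? ?] /=.
    by move=> [? ?] [? ?] _ _ /= [-> ->].
  by move=> [x y] /= [_ By]; exists (y, x).
apply: eq_esum => x _; rewrite [in LHS]esum_mkcond [in RHS]esum_mkcond.
rewrite -esumZl ?distr_ge0//; last by move=> y; case: ifP => // _; rewrite lee_fin distr_ge0.
by apply: eq_esum => y _; case: ifP => _; rewrite ?mule0// EFinM.
Qed.

Lemma mass_dunit (T : countType) (x : T) (B : set T) :
  mass (dunit R x) B = (\1_B x)%:E.
Proof.
rewrite /mass esum_mkcond (@esum_single _ _ x).
- by rewrite indicE; case: ifP => //= _; rewrite eqxx.
- by move=> y; case: ifP => // _; rewrite lee_fin distr_ge0.
- by move=> y /negbTE yx; case: ifP => //= _; rewrite yx.
Qed.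

Lemma mass_dbind_cst (T U : countType) (d : distr R T) (k : T -> distr R U) (B : set U) (c : R) :
  0 <= c -> (forall x, mass (k x) B = c%:E) -> mass (dbind d k) B = c%:E.
Proof.
move=> c0 kc; rewrite mass_dbind; under eq_esum do rewrite kc muleC.
rewrite esumZl//; last by move=> x; rewrite lee_fin distr_ge0.
by rewrite distr_sum1 mule1.
Qed.

End distribution_mass.

(** * The Markov property *)

Section chains.
Variables (R : realType) (C : markov_chain R).
Local Notation L := (location C).
Local Notation P := (chain_prob C).
Local Notation init := (@chain_init R C).
Local Notation trans := (@chain_trans R C).

Lemma word_weight_rcons d x w y :
  word_weight d (rcons (x :: w) y) = word_weight d (x :: w) * trans (last x w) y.
Proof.
elim: w d x => [|x' w ih] d x /=; first by rewrite !mulr1.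
by have /= e := ih (trans x) x'; rewrite e !mulrA.
Qed.

(** The event of the past splits into words of length [n + 1] ending in [l]; on each cylinder the
    next letter contributes the factor [trans l l']. *)
Lemma chain_markov1 n (Q : set (seq L)) l l' :
  P [set u | [/\ Q (mkseq u n.+1), u n = l & u n.+1 = l']] =
  (P [set u | Q (mkseq u n.+1) /\ u n = l] * (trans l l')%:E)%E.
Proof.
have mg (v : seq L) : measurable [set u : traj (chain_point C) | mkseq u n.+1 = v].
  exact: (@measurable_prefix _ (chain_point C) n.+1 [set v]).
have mE : measurable [set u : traj (chain_point C) | [/\ Q (mkseq u n.+1), u n = l & u n.+1 = l']].
  have -> : [set u : traj (chain_point C) | [/\ Q (mkseq u n.+1), u n = l & u n.+1 = l']] =
    [set u | Q (mkseq u n.+1)] `&` [set u | u n = l] `&` [set u | u n.+1 = l'].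
    by apply/seteqP; split=> u /=; [move=> []|move=> [[]]].
  by apply: measurableI; [apply: measurableI; [exact: measurable_prefix|]|];
    exact: measurable_coord_eq.
have mF : measurable [set u : traj (chain_point C) | Q (mkseq u n.+1) /\ u n = l].
  by apply: measurableI; [exact: measurable_prefix|exact: measurable_coord_eq].
rewrite (@measure_fibers _ _ _ P _ (fun u => mkseq u n.+1))//.
rewrite [in RHS](@measure_fibers _ _ _ P _ (fun u => mkseq u n.+1))//.
rewrite muleC -esumZl ?distr_ge0//.
apply: eq_esum => w _.
have [[sw Qw lw]|nw] := pselect [/\ size w = n.+1, Q w & nth l w n = l]; last first.
  have F0 : [set u : traj (chain_point C) | Q (mkseq u n.+1) /\ u n = l] `&`
      [set u | mkseq u n.+1 = w] = set0.
    apply/seteqP; split=> // u /= [[Qu ul] uw]; apply: nw.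
    by rewrite -uw size_mkseq nth_mkseq.
  have E0 : [set u : traj (chain_point C) | [/\ Q (mkseq u n.+1), u n = l & u n.+1 = l']] `&`
      [set u | mkseq u n.+1 = w] = set0.
    apply/seteqP; split=> // u /= [[Qu ul _] uw]; apply: nw.
    by rewrite -uw size_mkseq nth_mkseq.
  by rewrite E0 F0 measure0 mule0.
have -> : [set u | Q (mkseq u n.+1) /\ u n = l] `&` [set u | mkseq u n.+1 = w] =
    cylinder (chain_point C) w.
  apply/seteqP; split=> u /=; rewrite /cylinder /mkset sw; first by case.
  by move=> uw; split=> //; rewrite uw; split=> //; rewrite -lw -uw nth_mkseq.
have -> : [set u | [/\ Q (mkseq u n.+1), u n = l & u n.+1 = l']] `&` [set u | mkseq u n.+1 = w] =
    cylinder (chain_point C) (rcons w l').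
  rewrite cylinder_rcons; apply/seteqP; split=> u /=; rewrite /cylinder /mkset sw.
    by move=> [[? ? ?] ?].
  by move=> [uw ul']; split=> //; rewrite uw; split=> //; rewrite -lw -uw nth_mkseq.
rewrite !chain_probE; case: w sw Qw lw => // x w [sw] Qw lw.
rewrite word_weight_rcons EFinM muleC (_ : last x w = l)//.
by rewrite -[RHS]lw -sw; exact: (esym (nth_last l (x :: w))).
Qed.

Lemma chain_markov n (Q : set (seq L)) l (B : set L) :
  P [set u | [/\ Q (mkseq u n.+1), u n = l & B (u n.+1)]] =
  (P [set u | Q (mkseq u n.+1) /\ u n = l] * mass (trans l) B)%E.
Proof.
have mF : measurable [set u : traj (chain_point C) | Q (mkseq u n.+1) /\ u n = l].
  by apply: measurableI; [exact: measurable_prefix|exact: measurable_coord_eq].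
have mE : measurable [set u : traj (chain_point C) | [/\ Q (mkseq u n.+1), u n = l & B (u n.+1)]].
  have -> : [set u : traj (chain_point C) | [/\ Q (mkseq u n.+1), u n = l & B (u n.+1)]] =
    [set u | Q (mkseq u n.+1) /\ u n = l] `&` [set u | B (u n.+1)].
    by apply/seteqP; split=> u /=; [move=> []|move=> [[]]].
  by apply: measurableI => //; exact: measurable_coord.
rewrite (@measure_fibers _ _ _ P _ (fun u => u n.+1))//; last by move=> v; exact: measurable_coord_eq.
rewrite /mass [in RHS]esum_mkcond probE// -esumZl ?prob_ge0//; last first.
  by move=> x; case: ifP => // _; rewrite lee_fin distr_ge0.
apply: eq_esum => l' _; case: ifPn => [|]; rewrite ?inE ?notin_setE => Bl'.
  rewrite -probE// -chain_markov1; congr (P _).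
  by apply/seteqP; split=> u /=; [move=> [[? ? ?] ?]|move=> [? ? ->]].
rewrite mule0 (_ : _ `&` _ = set0) ?measure0//.
by apply/seteqP; split=> // u /= [[_ _ Bu] ul']; rewrite ul' in Bu.
Qed.

Lemma chain_start l : P [set u | u 0%N = l] = (init l)%:E.
Proof.
have -> : [set u : traj (chain_point C) | u 0%N = l] = cylinder (chain_point C) [:: l].
  by apply/seteqP; split=> u /=; rewrite /cylinder /mkset /mkseq /=; [move=> ->|case].
by rewrite chain_probE /= mulr1.
Qed.

Lemma chain_step n l l' : P [set u | u n = l /\ u n.+1 = l'] =
  (P [set u | u n = l] * (trans l l')%:E)%E.
Proof.
have := chain_markov1 n setT l l'.
rewrite (_ : [set u | [/\ _, _ & _]] = [set u | u n = l /\ u n.+1 = l']); last first.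
  by apply/seteqP; split=> u /=; case.
by rewrite (_ : [set u | setT _ /\ _] = [set u | u n = l])//; apply/seteqP; split=> u /=; [case|].
Qed.

Lemma chain_null n l : init l = 0 -> (forall l0, trans l0 l = 0) ->
  P [set u | u n = l] = 0%E.
Proof.
case: n => [|n] il tl; first by rewrite chain_start il.
rewrite (@measure_fibers _ _ _ P _ (fun u => u n)); last 2 first.
- exact: measurable_coord_eq.
- by move=> v; exact: measurable_coord_eq.
apply: esum1 => l0 _.
by rewrite setIC [LHS]chain_step tl mule0.
Qed.

Lemma chain_null_set n (B : set L) :
  (forall l, B l -> init l = 0 /\ forall l0, trans l0 l = 0) ->
  P [set u | B (u n)] = 0%E.
Proof.
move=> B0; rewrite (@measure_fibers _ _ _ P _ (fun u => u n)); last 2 first.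
- exact: measurable_coord.
- by move=> v; exact: measurable_coord_eq.
apply: esum1 => l _; have [Bl|nBl] := pselect (B l).
  rewrite (_ : _ `&` _ = [set u | u n = l]); first by apply: chain_null; apply B0.
  by apply/seteqP; split=> u /=; [case|move=> ->].
rewrite (_ : _ `&` _ = set0) ?measure0//.
by apply/seteqP; split=> // u /= [+ ul]; rewrite ul.
Qed.

Lemma chain_trans_pos : {ae P, forall u, forall n, 0 < trans (u n) (u n.+1)}.
Proof.
apply/ae_foralln => n.
have mE : measurable [set u : traj (chain_point C) | trans (u n) (u n.+1) = 0].
  have -> : [set u : traj (chain_point C) | trans (u n) (u n.+1) = 0] =
      [set u | [set w | trans (nth (chain_point C) w n) (nth (chain_point C) w n.+1) = 0]
        (mkseq u n.+2)].
    have e (u : traj (chain_point C)) : (nth (chain_point C) (mkseq u n.+2) n = u n) *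
        (nth (chain_point C) (mkseq u n.+2) n.+1 = u n.+1).
      by split; rewrite nth_mkseq.
    apply/seteqP; split=> u; have [e1 e2] := e u; rewrite /mkset e1 e2//.
  exact: measurable_prefix.
have P0 : P [set u | trans (u n) (u n.+1) = 0] = 0%E.
  rewrite (@measure_fibers _ _ _ P _ (fun u => u n))//; last by move=> v; exact: measurable_coord_eq.
  apply: esum1 => l _.
  have := chain_markov n setT l [set l' | trans l l' = 0].
  have -> : mass (trans l) [set l' | trans l l' = 0] = 0%E by apply: esum1 => l' /= ->.
  rewrite mule0 => <-; congr (P _).
  by apply/seteqP; split=> u /=; [move=> [+ ul]; rewrite ul|move=> [_ ->]].
exists [set u | trans (u n) (u n.+1) = 0]; split => //.
move=> u /= tu; apply: contrapT => h; apply: tu.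
by rewrite lt0r distr_ge0 andbT; exact/eqP.
Qed.

End chains.

Section plays.
Variables (R : realType) (M : mdp R) (Mem : countType) (sigma : strategy M Mem).
Local Notation C := (play_chain sigma).
Local Notation P := (chain_prob C).

Lemma play_initE s m a : chain_init C (s, m, a) =
  mem_init sigma m * (next_move sigma (init_state M) m a * (s == init_state M)%:R).
Proof.
have inner m' a' : (dlet a <- next_move sigma (init_state M) m' in
    dunit R (init_state M, m', a)) (s, m, a') =
    next_move sigma (init_state M) m' a' * ((s, m, a') == (init_state M, m', a'))%:R.
  rewrite (@dbind_single _ _ _ _ _ a')// => b ba'; rewrite /= !xpair_eqE.
  by rewrite eq_sym in ba'; rewrite (negbTE ba') andbF.
rewrite [LHS](@dbind_single _ _ _ _ _ m) => [|m' mm'].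
  by rewrite inner !xpair_eqE !eqxx !andbT.
rewrite inner !xpair_eqE; rewrite eq_sym in mm'.
by rewrite (negbTE mm') andbF mulr0.
Qed.

Lemma play_transE s m a s' m' a' : chain_trans (m := C) (s, m, a) (s', m', a') =
  delta a s' * (mem_update sigma a s' m m' * next_move sigma s' m' a').
Proof.
have inner s2 m2 : (dlet a <- next_move sigma s2 m2 in
    dunit R (s2, m2, a)) (s', m', a') =
    next_move sigma s2 m2 a' * ((s', m', a') == (s2, m2, a'))%:R.
  rewrite (@dbind_single _ _ _ _ _ a')// => b ba'; rewrite /= !xpair_eqE.
  by rewrite eq_sym in ba'; rewrite (negbTE ba') andbF.
have middle s2 : (dlet m2 <- mem_update sigma a s2 m in
    dlet a2 <- next_move sigma s2 m2 in
    dunit R (s2, m2, a2)) (s', m', a') =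
    mem_update sigma a s2 m m' * (next_move sigma s2 m' a' * (s' == s2)%:R).
  rewrite (@dbind_single _ _ _ _ _ m') => [|m2 mm2].
    by rewrite inner !xpair_eqE !eqxx !andbT.
  by rewrite inner !xpair_eqE; rewrite eq_sym in mm2; rewrite (negbTE mm2) andbF mulr0.
rewrite [LHS](@dbind_single _ _ _ _ _ s') => [|s2 ss2].
  by rewrite middle eqxx mulr1.
by rewrite middle; rewrite eq_sym in ss2; rewrite (negbTE ss2) !mulr0.
Qed.

Lemma play_trans_state s m a s' :
  mass (chain_trans (m := C) (s, m, a)) [set l | l.1.1 = s'] = (delta a s')%:E.
Proof.
rewrite [LHS]mass_dbind (@esum_single _ _ _ s').
- rewrite (@mass_dbind_cst _ _ _ _ _ _ 1)// ?mule1// => m'.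
  apply: mass_dbind_cst => // a'; rewrite mass_dunit indicE mem_set//.
- by move=> s2; rewrite mule_ge0 ?lee_fin ?distr_ge0//; apply: esum_ge0 => ? _; rewrite lee_fin distr_ge0.
- move=> s2 /eqP ss2; rewrite (@mass_dbind_cst _ _ _ _ _ _ 0)// ?mule0// => m'.
  apply: mass_dbind_cst => // a'; rewrite mass_dunit indicE memNset//.
Qed.

Lemma run_probE (A : set (run M)) : run_prob sigma A = P (@erase_memory _ _ _ sigma @^-1` A).
Proof. by []. Qed.

Lemma erase_memoryE (u : traj (chain_point C)) n : erase_memory u n = ((u n).1.1, (u n).2).
Proof. by rewrite /erase_memory; case: (u n) => -[]. Qed.

Lemma owner_unavailable a s m : owner a <> s -> next_move sigma s m a = 0.
Proof.
move=> /eqP; apply: contraNeq => /next_move_avail; rewrite ownerP //.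
Qed.

(** The next state is drawn from the current action alone, before the memory is updated, so the
    transition mass towards a state is the same on all fibers over the erased memory. *)
Lemma run_prob_law : play_law (run_prob sigma).
Proof.
split.
- move=> n Q a s'; apply: EFin_inj; rewrite EFinM -!probE; last 2 first.
  + by apply: measurableI; [exact: measurable_prefix|exact: (@measurable_coord _ _ n [set x | x.2 = a])].
  + have -> : [set rho : run M | [/\ Q (mkseq rho n.+1), (rho n).2 = a & (rho n.+1).1 = s']] =
      [set rho | Q (mkseq rho n.+1)] `&` [set rho | (rho n).2 = a] `&` [set rho | (rho n.+1).1 = s'].
      by apply/seteqP; split=> u /=; [move=> []|move=> [[]]].
    apply: measurableI; last exact: (@measurable_coord _ _ n.+1 [set x | x.1 = s']).
    by apply: measurableI; [exact: measurable_prefix|exact: (@measurable_coord _ _ n [set x | x.2 = a])].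
  rewrite !run_probE.
  pose er (l : state M * Mem * action M) := (l.1.1, l.2).
  pose Q' : set (seq (location C)) := [set w | Q (map er w)].
  have erQ (u : traj (chain_point C)) : Q (mkseq (erase_memory u) n.+1) <-> Q' (mkseq u n.+1).
    have -> : mkseq (erase_memory u) n.+1 = map er (mkseq u n.+1) => //.
    by rewrite /mkseq -map_comp; apply: eq_map => i /=; rewrite erase_memoryE.
  have mF : measurable [set u : traj (chain_point C) | Q' (mkseq u n.+1) /\ (u n).2 = a].
    by apply: measurableI; [exact: measurable_prefix|exact: (@measurable_coord _ _ n [set x | x.2 = a])].
  have mE : measurable [set u : traj (chain_point C) |
      [/\ Q' (mkseq u n.+1), (u n).2 = a & (u n.+1).1.1 = s']].
    have -> : [set u : traj (chain_point C) |
      [/\ Q' (mkseq u n.+1), (u n).2 = a & (u n.+1).1.1 = s']] =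
      [set u | Q' (mkseq u n.+1) /\ (u n).2 = a] `&` [set u | (u n.+1).1.1 = s'].
      by apply/seteqP; split=> u /=; [move=> []|move=> [[]]].
    by apply: measurableI => //; exact: (@measurable_coord _ _ n.+1 [set x | x.1.1 = s']).
  have -> : @erase_memory _ _ _ sigma @^-1`
      [set rho | [/\ Q (mkseq rho n.+1), (rho n).2 = a & (rho n.+1).1 = s']] =
      [set u | [/\ Q' (mkseq u n.+1), (u n).2 = a & (u n.+1).1.1 = s']].
    by apply/seteqP; split=> u /=; rewrite !erase_memoryE/= => -[/erQ].
  have -> : @erase_memory _ _ _ sigma @^-1` [set rho | Q (mkseq rho n.+1) /\ (rho n).2 = a] =
      [set u | Q' (mkseq u n.+1) /\ (u n).2 = a].
    by apply/seteqP; split=> u /=; rewrite !erase_memoryE/= => -[/erQ].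
  rewrite (@measure_fibers _ _ _ P _ (fun u => u n))//; last by move=> v; exact: measurable_coord_eq.
  rewrite [in RHS](@measure_fibers _ _ _ P _ (fun u => u n))//; last first.
    by move=> v; exact: measurable_coord_eq.
  rewrite muleC -esumZl ?distr_ge0//; apply: eq_esum => -[[s m] b] _.
  have [->|ba] := eqVneq b a; last first.
    have E0 : [set u : traj (chain_point C) |
        [/\ Q' (mkseq u n.+1), (u n).2 = a & (u n.+1).1.1 = s']] `&`
        [set u | u n = (s, m, b)] = set0.
      apply/seteqP; split=> // u /= [[_ ua _] ub].
      by move: ba; rewrite -ua ub eqxx.
    have F0 : [set u : traj (chain_point C) | Q' (mkseq u n.+1) /\ (u n).2 = a] `&`
        [set u | u n = (s, m, b)] = set0.
      apply/seteqP; split=> // u /= [[_ ua] ub].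
      by move: ba; rewrite -ua ub eqxx.
    by rewrite E0 F0 measure0 mule0.
  have := chain_markov n Q' (s, m, a) [set l | l.1.1 = s'].
  rewrite play_trans_state muleC => h.
  transitivity (P [set u | [/\ Q' (mkseq u n.+1), u n = (s, m, a) & [set l | l.1.1 = s'] (u n.+1)]]).
    by congr (P _); apply/seteqP; split=> u /=; [move=> [[? ? ?] ?]|move=> [? -> ?]].
  rewrite h; congr (_ * P _)%E.
  by apply/seteqP; split=> u /=; [move=> [? ->]|move=> [[? ?] ?]].
- rewrite run_probE.
  have -> : @erase_memory _ _ _ sigma @^-1` [set rho | (rho 0%N).1 <> init_state M] =
      [set u | [set l | l.1.1 <> init_state M] (u 0%N)].
    by apply/seteqP; split=> u /=; rewrite erase_memoryE.
  rewrite (@measure_fibers _ _ _ P _ (fun u => u 0%N)); last 2 first.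
  + exact: (@measurable_coord _ _ 0 [set l | l.1.1 <> init_state M]).
  + by move=> v; exact: measurable_coord_eq.
  apply: esum1 => -[[s m] a] _; have [->|/eqP si] := eqVneq s (init_state M).
    rewrite (_ : _ `&` _ = set0) ?measure0//.
    by apply/seteqP; split=> // u /= [+ ul]; rewrite ul.
  rewrite (_ : _ `&` _ = [set u | u 0%N = (s, m, a)]).
    by rewrite [LHS]chain_start play_initE (negbTE (introN eqP si)) !mulr0.
  by apply/seteqP; split=> u /=; [case|move=> ->].
- move=> n; rewrite run_probE.
  have -> : @erase_memory _ _ _ sigma @^-1` [set rho | owner (rho n).2 <> (rho n).1] =
      [set u | [set l | owner l.2 <> l.1.1] (u n)].
    by apply/seteqP; split=> u /=; rewrite erase_memoryE.
  apply: chain_null_set => -[[s m] a] oa; have {}oa : owner a <> s by exact: oa.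
  split.
    rewrite play_initE; have [si|_] := eqVneq s (init_state M); last by rewrite /= !mulr0.
    by rewrite -si owner_unavailable// mul0r mulr0.
  by move=> -[[s0 m0] a0]; rewrite play_transE owner_unavailable// !mulr0.
Qed.

End plays.

(** * Stopping when the best value recurs *)

Section almost_sure_comparison.
Context d (X : measurableType d) (R : realType) (P : probability X R).

Lemma prob_le_ae (A B : set X) : measurable A -> measurable B ->
  {ae P, forall u, A u -> B u} -> prob P A <= prob P B.
Proof.
move=> mA mB [N [mN PN ABN]]; rewrite -lee_fin -!probE//.
apply: (@le_trans _ _ (P (B `|` N))).
  rewrite le_measure ?inE//; first exact: measurableU.
  move=> u Au; have [Nu|nNu] := pselect (N u); first by right.
  by left; apply: contrapT => nBu; apply: nNu; apply: ABN => /= /(_ Au).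
by rewrite (le_trans (measureU2 P mB mN))// [X in (_ + X)%E]PN adde0.
Qed.

Lemma prob_eq_ae (A B : set X) : measurable A -> measurable B ->
  {ae P, forall u, A u <-> B u} -> prob P A = prob P B.
Proof.
move=> mA mB AB; apply/le_anti/andP; split; apply: prob_le_ae => //;
  by apply: filterS AB => u [].
Qed.

Lemma prob_union (I : finType) (Q : pred I) (A : set X) (F : I -> set X) :
  measurable A -> (forall i, measurable (F i)) ->
  (forall u, A u -> exists2 i, Q i & F i u) -> prob P A <= \sum_(i | Q i) prob P (F i).
Proof.
move=> mA mF AF; rewrite -lee_fin -sumEFin -probE//.
under eq_bigr do rewrite -probE//.
have : A `<=` \big[setU/set0]_(i | Q i) F i.
  by move=> u /AF[i Qi Fi]; rewrite (bigD1 i)//=; left.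
have mS (s : seq I) : measurable (\big[setU/set0]_(i <- s | Q i) F i).
  elim: s => [|i s ih]; first by rewrite big_nil.
  by rewrite big_cons; case: ifP => // _; exact: measurableU.
move=> /(@le_measure _ _ _ P _ _ _ _); rewrite !inE => /(_ mA (mS _))/le_trans; apply.
elim: (index_enum I) => [|i s ih]; first by rewrite !big_nil measure0.
rewrite !big_cons; case: ifP => // Qi.
by rewrite (le_trans (measureU2 P (mF i) (mS s)))// leeD2l.
Qed.

Lemma prob_vanishing (F : nat -> set X) (e : R) : 0 < e ->
  (forall n, measurable (F n)) -> (forall m n, (m <= n)%N -> F n `<=` F m) ->
  (forall u, exists n, ~ F n u) -> exists N, forall n, (N <= n)%N -> prob P (F n) <= e.
Proof.
move=> e0 mF Fdec Fempty.
have F0 : \bigcap_n F n = set0.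
  by apply/seteqP; split=> // u Fu; have [n] := Fempty u; apply; exact: Fu.
have : P (F n) @[n --> \oo] --> P (\bigcap_n F n).
  apply: nonincreasing_cvg_mu => //.
  - by rewrite (le_lt_trans (probability_le1 P (mF _)))// ltry.
  - by rewrite F0.
  - by move=> m n mn; apply/subsetPset; exact: Fdec.
rewrite F0 measure0 => /fine_cvgP[_] /cvgr0Pnorm_le/(_ e e0)[N _ hN].
by exists N => n Nn; have /= := hN n Nn; apply: le_trans; exact: ler_norm.
Qed.

Lemma prob_vanishing_family (m : nat) (F : 'I_m -> nat -> set X) (e : R) : 0 < e ->
  (forall k n, measurable (F k n)) -> (forall k i j, (i <= j)%N -> F k j `<=` F k i) ->
  (forall k u, exists n, ~ F k n u) ->
  forall N0, exists2 N, (N0 <= N)%N & forall k, prob P (F k N) <= e.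
Proof.
move=> e0 mF Fdec Fempty N0.
have /choice[N hN] : forall k, exists N, forall n, (N <= n)%N -> prob P (F k n) <= e.
  by move=> k; exact: (prob_vanishing e0 (mF k) (Fdec k) (Fempty k)).
exists (maxn N0 (\max_k N k)); first exact: leq_maxl.
by move=> k; apply: hN; rewrite leq_max (leq_bigmax k) orbT.
Qed.

End almost_sure_comparison.

(** * The flow of a bounded stopping rule *)

Section stopping.
Variables (R : realType) (M : mdp R) (P : probability (run M) R).
Hypothesis law : play_law P.
Local Notation T := (state M * action M)%type.

(** Encodes that the event [B] depends on the first [k] positions only, as required of a stopping
    time. *)
Definition determined (k : nat) (B : (nat -> T) -> Prop) :=
  forall rho rho', (forall i, (i < k)%N -> rho i = rho' i) -> B rho -> B rho'.

Lemma determinedE k B : determined k B ->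
  [set rho : run M | B rho] = [set rho | [set h | B (nth (run_point M) h)] (mkseq rho k)].
Proof.
by move=> dB; apply/seteqP; split=> rho; apply: dB => i ik; rewrite nth_mkseq.
Qed.

Lemma measurable_determined k B : determined k B -> measurable [set rho : run M | B rho].
Proof. by move=> /determinedE ->; exact: measurable_prefix. Qed.

Lemma law_step_determined n B a s : determined n.+1 B ->
  prob P [set rho | [/\ B rho, (rho n).2 = a & (rho n.+1).1 = s]] =
  prob P [set rho | B rho /\ (rho n).2 = a] * delta a s.
Proof.
move=> dB; pose Q := [set h | B (nth (run_point M) h)].
have BQ (rho : run M) : B rho = Q (mkseq rho n.+1).
  exact: (congr1 (fun A : set (run M) => A rho) (determinedE dB)).
have -> : [set rho : run M | [/\ B rho, (rho n).2 = a & (rho n.+1).1 = s]] =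
    [set rho | [/\ Q (mkseq rho n.+1), (rho n).2 = a & (rho n.+1).1 = s]].
  by apply: eq_set => rho; rewrite BQ.
rewrite (law_step law); congr (prob P _ * _).
by apply: eq_set => rho; rewrite BQ.
Qed.

(* [st n rho] decides whether to stop on arrival in the [n]-th state. *)
Variables (st : nat -> (nat -> T) -> bool) (N : nat).
Hypothesis st_determined : forall n, determined n.+1 (st n).
Hypothesis st_horizon : forall rho, st N rho.

Definition alive n (rho : nat -> T) := forall i, (i < n)%N -> ~~ st i rho.

Lemma alive_determined n : determined n (alive n).
Proof.
move=> rho rho' rr h i ik; apply/negP => sti; move/negP: (h i ik); apply.
apply: (@st_determined i rho') => // j ji; rewrite rr//.
exact: leq_trans ik.
Qed.

Lemma determined_weaken k l B : (k <= l)%N -> determined k B -> determined l B.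
Proof. by move=> kl dB rho rho' rr; apply: dB => i ik; apply: rr; exact: leq_trans kl. Qed.

Lemma determined_coord n (C : T -> Prop) : determined n.+1 (fun rho => C (rho n)).
Proof. by move=> rho rho' rr; rewrite rr. Qed.

Lemma determinedI k B C : determined k B -> determined k C ->
  determined k (fun rho => B rho /\ C rho).
Proof. by move=> dB dC rho rho' rr [/(dB _ _ rr) ? /(dC _ _ rr) ?]. Qed.

(** Being alive at [n + 1] means that the action at time [n] is played before stopping; since the
    rule stops by time [N], a finite sum counts all such plays. *)
Definition stop_play a : R :=
  \sum_(n < N) prob P [set rho | alive n.+1 rho /\ (rho n).2 = a].

Definition stop_state s : R :=
  \sum_(n < N.+1) prob P [set rho | (alive n rho /\ st n rho) /\ (rho n).1 = s].

Let arrive n s : R := prob P [set rho | alive n rho /\ (rho n).1 = s].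

Let m_alive_coord n k (C : T -> Prop) : (n <= k.+1)%N ->
  measurable [set rho : run M | alive n rho /\ C (rho k)].
Proof.
move=> nk; apply: (@measurable_determined k.+1); apply: determinedI.
  exact: determined_weaken nk (@alive_determined n).
exact: determined_coord.
Qed.

Let m_stop n s : measurable [set rho : run M | (alive n rho /\ st n rho) /\ (rho n).1 = s].
Proof.
apply: (@measurable_determined n.+1); apply: (determinedI (C := fun rho => (rho n).1 = s)).
  apply: determinedI => //.
  exact: determined_weaken (leqnSn n) (@alive_determined n).
exact: (determined_coord (C := fun x => x.1 = s)).
Qed.

Lemma arrive_split n s : arrive n s =
  prob P [set rho | (alive n rho /\ st n rho) /\ (rho n).1 = s] +
  \sum_(a | owner a == s) prob P [set rho | alive n.+1 rho /\ (rho n).2 = a].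
Proof.
have -> : arrive n s = prob P [set rho | (alive n rho /\ st n rho) /\ (rho n).1 = s] +
    prob P [set rho | alive n.+1 rho /\ (rho n).1 = s].
  apply: EFin_inj; rewrite /arrive EFinD -!probE; last 3 first.
  - by apply: (@m_alive_coord _ _ (fun x => x.1 = s)); rewrite ?leqnSn.
  - exact: m_stop.
  - by apply: (@m_alive_coord _ _ (fun x => x.1 = s)); rewrite ?leqnSn.
  rewrite -measureU; last 3 first.
  - exact: m_stop.
  - by apply: (@m_alive_coord _ _ (fun x => x.1 = s)); rewrite ?leqnSn.
  - apply/seteqP; split=> // rho /= [[[_ sn] _] [al _]].
    by have := al n (ltnSn n); rewrite sn.
  congr (P _); apply/seteqP; split=> rho /=.
    move=> [al rs]; case: (boolP (st n rho)) => sn; [by left|right].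
    by split=> // i; rewrite ltnS leq_eqVlt => /predU1P[->|/al].
  by move=> [[[al _] ?]|[al ?]]; split=> // i ni; apply: al; exact: ltnW.
congr (_ + _).
rewrite (@prob_fibers _ _ _ P _ (fun rho => (rho n).2)); last 2 first.
- by apply: (@m_alive_coord _ _ (fun x => x.1 = s)); rewrite ?leqnSn.
- by move=> a; exact: (@measurable_coord _ _ n [set x | x.2 = a]).
rewrite [RHS]big_mkcond; apply: eq_bigr => a _.
have m1 : measurable ([set rho : run M | alive n.+1 rho /\ (rho n).1 = s] `&`
    [set rho | (rho n).2 = a]).
  apply: measurableI; first by apply: (@m_alive_coord _ _ (fun x => x.1 = s)); rewrite ?leqnSn.
  exact: (@measurable_coord _ _ n [set x | x.2 = a]).
case: eqP => oa.
  apply: prob_eq_ae => //; first by apply: (@m_alive_coord _ _ (fun x => x.2 = a)); rewrite ?leqnSn.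
  apply: filterS (law_consistent_ae law) => rho cons /=; split; first by move=> [[]].
  by move=> [? ra]; split=> //; split=> //; rewrite -cons ra.
transitivity (prob P set0); last by rewrite /prob measure0.
apply: prob_eq_ae => //.
apply: filterS (law_consistent_ae law) => rho cons /=; split=> // -[[_ rs] ra].
by apply: oa; rewrite -rs -cons ra.
Qed.

Lemma arrive0 s : arrive 0 s = (s == init_state M)%:R.
Proof.
have [->|si] := eqVneq s (init_state M).
  transitivity (prob P setT); last by rewrite /prob probability_setT.
  apply: prob_eq_ae => //; first by apply: (@m_alive_coord _ _ (fun x => x.1 = init_state M)); rewrite ?leqnSn.
  exists [set rho : run M | (rho 0%N).1 <> init_state M]; split.
  - exact: (@measurable_coord _ _ 0 [set x | x.1 <> init_state M]).
  - exact: law_init law.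
  - by move=> rho /= h e; apply: h; split.
transitivity (prob P set0); last by rewrite /prob measure0.
apply: prob_eq_ae => //; first by apply: (@m_alive_coord _ _ (fun x => x.1 = s)); rewrite ?leqnSn.
exists [set rho : run M | (rho 0%N).1 <> init_state M]; split.
- exact: (@measurable_coord _ _ 0 [set x | x.1 <> init_state M]).
- exact: law_init law.
- move=> rho /= h e; apply: h; split=> // -[_ rs].
  by move: si; rewrite -rs e eqxx.
Qed.

Lemma arriveS n s : arrive n.+1 s =
  \sum_a prob P [set rho | alive n.+1 rho /\ (rho n).2 = a] * delta a s.
Proof.
rewrite /arrive (@prob_fibers _ _ _ P _ (fun rho => (rho n).2)); last 2 first.
- by apply: (@m_alive_coord _ _ (fun x => x.1 = s)); rewrite ?leqnSn.
- by move=> a; exact: (@measurable_coord _ _ n [set x | x.2 = a]).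
apply: eq_bigr => a _; rewrite -law_step_determined; last exact: alive_determined.
congr (prob P _); apply/seteqP; split=> rho /=; first by move=> [[]].
by move=> [].
Qed.

(** Arrivals in [s] before stopping are counted twice: by what follows, a stop or one action of [s],
    and by what precedes, the start or a transition into [s]. *)
Lemma stopping_flow : flow stop_play stop_state.
Proof.
split.
- by move=> a; apply: sumr_ge0 => n _; exact: prob_ge0.
- by move=> s; apply: sumr_ge0 => n _; exact: prob_ge0.
move=> s.
(* No action is played at the horizon, so the sum over [N.+1] arrival times involves plays at [N]
   times only. *)
have last0 a : prob P [set rho | alive N.+1 rho /\ (rho N).2 = a] = 0.
  rewrite (_ : [set _ | _] = set0) ?/prob ?measure0//.
  by apply/seteqP; split=> // rho /= [/(_ N (ltnSn N))]; rewrite st_horizon.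
have e1 : \sum_(n < N.+1) arrive n s = stop_state s + \sum_(a | owner a == s) stop_play a.
  under eq_bigr do rewrite arrive_split.
  rewrite big_split/=; congr (_ + _); rewrite exchange_big/=; apply: eq_bigr => a _.
  by rewrite big_ord_recr/= last0 addr0.
have e2 : \sum_(n < N.+1) arrive n s = (s == init_state M)%:R + \sum_a stop_play a * delta a s.
  rewrite big_ord_recl arrive0; congr (_ + _).
  under [RHS]eq_bigr do rewrite /stop_play mulr_suml.
  rewrite exchange_big/=; apply: eq_bigr => n _; exact: arriveS.
by rewrite /net addrA -e1 e2 addrK.
Qed.

Lemma stop_state_ge (A : set (run M)) (C : pred (state M)) : measurable A ->
  (forall rho, A rho -> exists n, [/\ alive n rho, st n rho & C (rho n).1]) ->
  prob P A <= \sum_(s | C s) stop_state s.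
Proof.
move=> mA AC; rewrite /stop_state pair_big_dep/=; under eq_bigl do rewrite andbT.
apply: (@prob_union _ _ _ P _ (fun p : state M * 'I_N.+1 => C p.1) A
  (fun p => [set rho | (alive p.2 rho /\ st p.2 rho) /\ (rho p.2).1 = p.1])) => //.
move=> rho /AC[n [al sn Cn]].
have nN : (n < N.+1)%N.
    by rewrite ltnS leqNgt; apply/negP => /al; rewrite st_horizon.
by exists ((rho n).1, Ordinal nN).
Qed.

End stopping.

(** * Guessing the recurrent level from finite windows *)

Section classification.
Variables (R : realType) (M : mdp R) (P : probability (run M) R) (lev : state M -> nat).
Hypothesis law : play_law P.
Local Notation T := (state M * action M)%type.
Implicit Type rho : run M.

Definition recurrent k rho := forall m, exists2 n, (m <= n)%N & (k <= lev (rho n).1)%N.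

Lemma measurable_lev k n : measurable [set rho : run M | (k <= lev (rho n).1)%N].
Proof. exact: (@measurable_coord _ _ n [set x | (k <= lev x.1)%N]). Qed.

Lemma measurable_lev_after k m :
  measurable [set rho : run M | exists2 n, (m <= n)%N & (k <= lev (rho n).1)%N].
Proof.
have -> : [set rho : run M | exists2 n, (m <= n)%N & (k <= lev (rho n).1)%N] =
    \bigcup_(n in [set n | (m <= n)%N]) [set rho | (k <= lev (rho n).1)%N].
  by apply/seteqP; split=> rho /= [n]; exists n.
by apply: bigcup_measurable => n _; exact: measurable_lev.
Qed.

Lemma measurable_recurrent k : measurable [set rho | recurrent k rho].
Proof.
have -> : [set rho | recurrent k rho] =
    \bigcap_m [set rho : run M | exists2 n, (m <= n)%N & (k <= lev (rho n).1)%N].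
  by apply/seteqP; split=> rho /=; [move=> h m _; exact: h|move=> h m; exact: h].
by apply: bigcapT_measurable => m; exact: measurable_lev_after.
Qed.

(** Together with [absence], the ways in which a finite window misjudges recurrence: a level seen
    late although it does not recur, or a recurrent level missed. Both events shrink to the empty
    set as the window moves on or grows. *)
Definition late_visit k N : set (run M) :=
  [set rho | ~ recurrent k rho /\ exists2 n, (N <= n)%N & (k <= lev (rho n).1)%N].

Definition absence k N N' : set (run M) :=
  [set rho | recurrent k rho /\ forall n, (N <= n < N')%N -> (lev (rho n).1 < k)%N].

Lemma measurable_late_visit k N : measurable (late_visit k N).
Proof.
apply: measurableI; last exact: measurable_lev_after.
by apply: measurableC; exact: measurable_recurrent.
Qed.

Lemma measurable_absence k N N' : measurable (absence k N N').
Proof.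
have -> : absence k N N' = [set rho | recurrent k rho] `&`
    \bigcap_(n in [set n | (N <= n < N')%N]) ~` [set rho | (k <= lev (rho n).1)%N].
  apply/seteqP; split=> rho /= -[? h]; split=> // n /h; first by rewrite ltnNge => /negP.
  by rewrite ltnNge => /negP.
apply: measurableI; first exact: measurable_recurrent.
by apply: bigcap_measurableType => n _; apply: measurableC; exact: measurable_lev.
Qed.

Definition top N1 N2 (rho : nat -> T) := (\max_(N1 <= i < N2) lev (rho i).1)%N.

(* After [N2], stop as soon as the best level seen between [N1] and [N2] recurs. *)
Definition stop_rule N1 N2 N3 n (rho : nat -> T) : bool :=
  (n == N3) || (N2 <= n)%N && (top N1 N2 rho <= lev (rho n).1)%N.

Lemma stop_rule_determined N1 N2 N3 n :
  determined n.+1 (fun rho => stop_rule N1 N2 N3 n rho).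
Proof.
move=> rho rho' rr; rewrite /stop_rule; case: eqP => //= _ /andP[n2 h].
rewrite n2 -rr// (_ : top N1 N2 rho' = top N1 N2 rho)//.
apply: eq_big_nat => i /andP[_ i2]; rewrite rr// ltnS (leq_trans _ n2)//.
exact: ltnW.
Qed.

Lemma top_attained N1 N2 rho : top N1 N2 rho = 0%N \/
  exists2 i, (N1 <= i < N2)%N & lev (rho i).1 = top N1 N2 rho.
Proof.
rewrite /top; have [h|h] := posnP (\max_(N1 <= i < N2) lev (rho i).1)%N; first by left.
right; apply: contrapT => ne.
set m := (\max_(N1 <= i < N2) lev (rho i).1)%N in h ne *.
have /existsNP[i /not_implyP[iN il]] : ~ forall i, (N1 <= i < N2)%N -> (lev (rho i).1 <= m.-1)%N.
  move=> H; suff : (m <= m.-1)%N by rewrite -ltnS prednK// ltnn.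
  by rewrite {1}/m big_nat_cond; apply/bigmax_leqP_seq => i _ /andP[+ _]; exact: H.
apply: ne; exists i => //; apply/eqP; rewrite eqn_leq; apply/andP; split.
  by apply: leq_bigmax_seq; rewrite ?mem_index_iota.
by move/negP: il; rewrite -ltnNge prednK.
Qed.

Lemma leq_top N1 N2 rho i : (N1 <= i < N2)%N -> (lev (rho i).1 <= top N1 N2 rho)%N.
Proof. by move=> h; apply: leq_bigmax_seq; rewrite ?mem_index_iota. Qed.

(** Without late visits the top level of the first window is recurrent, so it occurs again in the
    second; without absences this top is at least every recurrent level, in particular [k]. *)
Lemma stop_rule_success N1 N2 N3 k rho :
  recurrent k rho -> (forall j, ~ late_visit j N1 rho) ->
  (forall j, ~ absence j N1 N2 rho) -> (forall j, ~ absence j N2 N3 rho) ->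
  exists n, [/\ alive (stop_rule N1 N2 N3) n rho, stop_rule N1 N2 N3 n rho &
    (k <= lev (rho n).1)%N].
Proof.
move=> rk nlate nabs1 nabs2; set t := top N1 N2 rho.
have rt : recurrent t rho.
  have [t0|[i /andP[Ni _] it]] := top_attained N1 N2 rho.
    by move=> m; exists m => //; rewrite /t t0.
  apply: contrapT => nrt; apply: (nlate t); split=> //.
  by exists i => //; rewrite it.
have visit j N N' : recurrent j rho -> (forall j, ~ absence j N N' rho) ->
    exists2 n, (N <= n < N')%N & (j <= lev (rho n).1)%N.
  move=> rj /(_ j) na; apply: contrapT => h; apply: na; split=> // n nN.
  by rewrite ltnNge; apply/negP => jn; apply: h; exists n.
have [n0 /andP[N2n0 n0N3] tn0] := visit _ _ _ rt nabs2.
have ex : exists n, stop_rule N1 N2 N3 n rho.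
  by exists n0; rewrite /stop_rule N2n0 tn0 orbT.
have [n sn nmin] := ex_minnP ex.
exists n; split=> //.
  by move=> i ni; apply/negP => /nmin; rewrite leqNgt ni.
(* The stop happens before the forced one at [N3], so it is due to the level reached. *)
have nN3 : (n < N3)%N.
  by apply: leq_ltn_trans n0N3; apply: nmin; rewrite /stop_rule N2n0 tn0 orbT.
move: sn; rewrite /stop_rule (ltn_eqF nN3) /= => /andP[_]; apply: leq_trans.
have [i iN ki] := visit _ _ _ rk nabs1.
exact: leq_trans ki (leq_top rho iN).
Qed.

Lemma approximate_flow (e : R) : 0 < e -> exists y z, flow y z /\
  forall k, prob P [set rho | recurrent k rho] - e <= \sum_(s | (k <= lev s)%N) z s.
Proof.
move=> e0; pose L := (\max_s lev s).+1.
have levL s : (lev s < L)%N by rewrite ltnS; exact: leq_bigmax.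
(* There are [L] levels and three error events for each. *)
pose d := e / (3 * L%:R).
have L0 : 0 < L%:R :> R by rewrite ltr0n.
have d0 : 0 < d by rewrite divr_gt0// mulr_gt0.
have [||| N1 _ h1] := @prob_vanishing_family _ _ _ P L (fun k N => late_visit k N) d d0 _ _ _ 0%N.
- by move=> k n; exact: measurable_late_visit.
- by move=> k i j ij rho [nr [n jn kn]]; split=> //; exists n => //; exact: leq_trans jn.
- move=> k rho; have [rk|nr] := pselect (recurrent k rho); first by exists 0%N => -[].
  move/existsNP: (nr) => [m hm]; exists m => -[_ [n mn kn]]; apply: hm; by exists n.
have abs_vanish N : exists2 N', (N <= N')%N & forall k : 'I_L, prob P (absence k N N') <= d.
  apply: prob_vanishing_family => //.
  - by move=> k n; exact: measurable_absence.
  - move=> k i j ij rho [rk h]; split=> // n /andP[Nn ni]; apply: h.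
    by rewrite Nn (leq_trans ni).
  - move=> k rho; have [rk|nr] := pselect (recurrent k rho); last by exists 0%N => -[].
    have [n Nn kn] := rk N; exists n.+1 => -[_ /(_ n)].
    by rewrite Nn ltnSn => /(_ isT); rewrite ltnNge kn.
have [N2 N12 h2] := abs_vanish N1; have [N3 N23 h3] := abs_vanish N2.
have sd n : determined n.+1 (stop_rule N1 N2 N3 n) by exact: stop_rule_determined.
have horizon rho : stop_rule N1 N2 N3 N3 rho by rewrite /stop_rule eqxx.
have fl := stopping_flow law sd horizon.
exists (stop_play P (stop_rule N1 N2 N3) N3), (stop_state P (stop_rule N1 N2 N3) N3).
split=> // k; have [kL|Lk] := ltnP k L; last first.
  rewrite (_ : [set rho | recurrent k rho] = set0) ?/prob ?measure0 ?sub0r.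
    apply: (@le_trans _ _ 0); first by rewrite oppr_le0 ltW.
    by apply: sumr_ge0 => s _; have [_ + _] := fl; apply.
  apply/seteqP; split=> // rho /(_ 0%N)[n _]; rewrite leqNgt; apply: contraNP => _.
  exact: leq_trans (levL _) Lk.
pose Bad : set (run M) := [set rho | exists j : 'I_L,
  late_visit j N1 rho \/ (absence j N1 N2 rho \/ absence j N2 N3 rho)].
have mF (j : 'I_L) : measurable (late_visit j N1 `|` (absence j N1 N2 `|` absence j N2 N3)).
  apply: measurableU; first exact: measurable_late_visit.
  by apply: measurableU; exact: measurable_absence.
have mBad : measurable Bad.
  have -> : Bad = \bigcup_(j : 'I_L) (late_visit j N1 `|` (absence j N1 N2 `|` absence j N2 N3)).
    by apply/seteqP; split=> rho /=; [move=> [j ?]; exists j|move=> [j _ ?]; exists j].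
  by apply: fin_bigcup_measurable => // j _; exact: mF.
have Bad_le : prob P Bad <= e.
  apply: (@le_trans _ _ (\sum_(p : 'I_L * 'I_3) d)).
    apply: le_trans (_ : _ <= \sum_(p : 'I_L * 'I_3)
      prob P (nth set0 [:: late_visit p.1 N1; absence p.1 N1 N2; absence p.1 N2 N3] p.2)) _.
      apply: (@prob_union _ _ _ P _ predT Bad (fun p : 'I_L * 'I_3 =>
        nth set0 [:: late_visit p.1 N1; absence p.1 N1 N2; absence p.1 N2 N3] p.2)) => //.
        move=> [j [[|[|[|//]]] ?]] /=; first exact: measurable_late_visit.
          exact: measurable_absence.
        exact: measurable_absence.
      move=> rho [j [h|[h|h]]].
      - by exists (j, Ordinal (isT : (0 < 3)%N)).
      - by exists (j, Ordinal (isT : (1 < 3)%N)).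
      - by exists (j, Ordinal (isT : (2 < 3)%N)).
    by apply: ler_sum => -[j [[|[|[|//]]] ?]] _ /=.
  rewrite sumr_const card_prod !card_ord -mulr_natr /d natrM.
  by rewrite le_eqVlt; apply/orP; left; apply/eqP; field; rewrite gt_eqF.
have mr := measurable_recurrent k.
have : prob P [set rho | recurrent k rho] <= prob P ([set rho | recurrent k rho] `\` Bad) + prob P Bad.
  rewrite -lee_fin EFinD -!probE//; last exact: measurableD.
  apply: le_trans (measureU2 P _ mBad); last exact: measurableD.
  rewrite le_measure ?inE//; first by apply: measurableU => //; exact: measurableD.
  move=> rho rk; have [bad|nbad] := pselect (Bad rho); first by right.
  by left.
have : prob P ([set rho | recurrent k rho] `\` Bad) <=
    \sum_(s | (k <= lev s)%N) stop_state P (stop_rule N1 N2 N3) N3 s.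
  apply: (@stop_state_ge _ _ P _ N3 sd horizon _ (fun s => (k <= lev s)%N)).
    exact: measurableD.
  move=> rho [rk nbad]; apply: stop_rule_success => // j.
  - have [jL|Lj] := ltnP j L; last first.
      by move=> [_ [n _]]; rewrite leqNgt (leq_trans (levL _) Lj).
    by move=> h; apply: nbad; exists (Ordinal jL); left.
  - have [jL|Lj] := ltnP j L; last first.
      by move=> [/(_ 0%N)[n _]]; rewrite leqNgt (leq_trans (levL _) Lj).
    by move=> h; apply: nbad; exists (Ordinal jL); right; left.
  - have [jL|Lj] := ltnP j L; last first.
      by move=> [/(_ 0%N)[n _]]; rewrite leqNgt (leq_trans (levL _) Lj).
    by move=> h; apply: nbad; exists (Ordinal jL); right; right.
move: Bad_le; lra.
Qed.

Lemma dominating_flow : exists y z, flow y z /\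
  forall k, prob P [set rho | recurrent k rho] <= \sum_(s | (k <= lev s)%N) z s.
Proof.
by apply: (flow_closed (c := fun k => prob P [set rho | recurrent k rho])); exact: approximate_flow.
Qed.

End classification.

(** * The two-memory strategy *)

Section two_memory_strategy.
Variables (R : realType) (M : mdp R) (r : state M -> rat).
Variables (y : action M -> R) (z : state M -> R).
Hypothesis yz : flow y z.

Let y0 a : 0 <= y a. Proof. by case: yz. Qed.
Let z0 s : 0 <= z s. Proof. by case: yz. Qed.

Definition outflow s : R := \sum_(a | owner a == s) y a.
Definition inflow s : R := z s + outflow s.
(** The conditional probability of stopping at an arrival in [s]. If [inflow s] is zero the quotient
    is 0, which agrees with [z s] being zero. *)
Definition switch_prob s : R := z s / inflow s.

Lemma outflow_ge0 s : 0 <= outflow s. Proof. exact: sumr_ge0. Qed.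

Lemma inflow_ge0 s : 0 <= inflow s. Proof. by rewrite addr_ge0// outflow_ge0. Qed.

Lemma inflowE s : inflow s = (s == init_state M)%:R + \sum_a y a * delta a s.
Proof.
have [_ _ /(_ s)] := yz; rewrite /net -/(outflow s) /inflow => <-.
by rewrite addrA subrK.
Qed.

Lemma inflow_switch s : inflow s * switch_prob s = z s.
Proof.
rewrite /switch_prob; have [i0|i0] := eqVneq (inflow s) 0; last by rewrite mulrC mulfVK.
rewrite i0 mul0r; have := z0 s; have := outflow_ge0 s; move: i0; rewrite /inflow => ? ? ?.
lra.
Qed.

Lemma switch_prob_ge0 s : 0 <= switch_prob s.
Proof. by rewrite divr_ge0// inflow_ge0. Qed.

Lemma switch_prob_le1 s : switch_prob s <= 1.
Proof.
rewrite /switch_prob; have [->|i0] := eqVneq (inflow s) 0; first by rewrite invr0 mulr0.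
by rewrite ler_pdivrMr ?lt0r ?i0 ?inflow_ge0// mul1r lerDl outflow_ge0.
Qed.

Lemma inflow_stay s : inflow s * (1 - switch_prob s) = outflow s.
Proof. by rewrite mulrBr mulr1 inflow_switch /inflow addrAC subrr add0r. Qed.

Definition coin_fun (s : state M) (b : bool) : R :=
  if b then switch_prob s else 1 - switch_prob s.

Lemma coin_ge0 s b : 0 <= coin_fun s b.
Proof. by case: b; rewrite /= ?switch_prob_ge0// subr_ge0 switch_prob_le1. Qed.

Lemma coin_sum s : \sum_b coin_fun s b = 1.
Proof. by rewrite big_bool/= addrC subrK. Qed.

Definition coin s : distr R bool := fin_distr (coin_ge0 s) (coin_sum s).

(** Actions of [s] are drawn in proportion to [y]. When nothing flows out, any available action
    satisfies [outflow_move]. *)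
Definition flow_move_fun (s : state M) (a : action M) : R :=
  if outflow s == 0 then (a == best_action r s)%:R
  else (owner a == s)%:R * y a / outflow s.

Lemma flow_move_ge0 s a : 0 <= flow_move_fun s a.
Proof.
rewrite /flow_move_fun; case: ifP => _; first exact: ler0n.
by rewrite divr_ge0 ?outflow_ge0// mulr_ge0.
Qed.

Lemma flow_move_sum s : \sum_a flow_move_fun s a = 1.
Proof.
rewrite /flow_move_fun; have [_|o0] := eqVneq (outflow s) 0.
  by rewrite (bigD1 (best_action r s))//= eqxx big1 ?addr0// => a /negbTE ->.
rewrite -mulr_suml (_ : \sum_a _ = outflow s) ?divff//.
by rewrite /outflow [RHS]big_mkcond; apply: eq_bigr => a _; case: eqP; rewrite ?mul1r ?mul0r.
Qed.

Definition flow_move s : distr R (action M) := fin_distr (flow_move_ge0 s) (flow_move_sum s).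

Lemma outflow_move s a : outflow s * flow_move s a = (owner a == s)%:R * y a.
Proof.
rewrite /= /flow_move_fun; have [out0|out0] := eqVneq (outflow s) 0; last by rewrite mulrC mulfVK.
rewrite out0 mul0r; case: eqP => oa; rewrite ?mul0r// mul1r.
move: out0; rewrite /outflow => /eqP; rewrite psumr_eq0// => /allP/(_ a (mem_index_enum a)).
by rewrite oa eqxx/= => /eqP ->.
Qed.

Definition next_move_of (s : state M) (b : bool) : distr R (action M) :=
  if b then dunit R (best_action r s) else flow_move s.

Lemma next_move_of_avail s b a : next_move_of s b a != 0 -> a \in avail s.
Proof.
rewrite ownerP; case: b => /=.
  by rewrite pnatr_eq0 eqb0 negbK => /eqP ->; rewrite owner_best_action.
rewrite /flow_move_fun; case: ifP => _.
  by rewrite pnatr_eq0 eqb0 negbK => /eqP ->; rewrite owner_best_action.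
by have [//|_] := eqVneq (owner a) s; rewrite mulr0n !mul0r eqxx.
Qed.

(* Memory [false] follows the flow; on entering [s] it switches to [true] with
   probability [switch_prob s], and then plays [best_action] for ever. *)
Definition flow_strategy : strategy M bool :=
  Strategy (fun (a : action M) s (b : bool) => if b then dunit R true else coin s)
    next_move_of_avail (coin (init_state M)).

Local Notation C := (play_chain flow_strategy).
Local Notation P := (chain_prob C).
Local Notation L := (state M * bool * action M)%type.

(** Probability of entering [s] at time [n] without an earlier switch, before the coin of [s] is
    tossed. The recursive form can be set against the flow equations without measures. *)
Fixpoint arrival n s : R := if n is n'.+1
  then \sum_(s0 : state M) \sum_(a : action M)
    arrival n' s0 * ((1 - switch_prob s0) * flow_move s0 a) * delta a s
  else (s == init_state M)%:R.

Lemma arrival_ge0 n s : 0 <= arrival n s.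
Proof.
elim: n s => [|n ih] s /=; first exact: ler0n.
apply: sumr_ge0 => s0 _; apply: sumr_ge0 => a _.
by rewrite !mulr_ge0 ?ih ?subr_ge0 ?switch_prob_le1 ?distr_ge0// flow_move_ge0.
Qed.

(** [inflow] is a nonnegative solution of the linear equations whose iterates from zero are these
    partial sums, so it bounds them. Equality can fail where [y] contains a circulation that is
    never reached. *)
Lemma sum_arrival N s : \sum_(n < N) arrival n s <= inflow s.
Proof.
case: N => [|N]; first by rewrite big_ord0 inflow_ge0.
elim: N s => [|N ih] s.
  rewrite big_ord_recl big_ord0 addr0 inflowE lerDl sumr_ge0// => a _.
  by rewrite mulr_ge0// distr_ge0.
rewrite big_ord_recl inflowE; apply: lerD => //.
rewrite [leLHS](_ : _ = \sum_(s0 : state M) \sum_(a : action M)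
  (\sum_(n < N.+1) arrival n s0) * ((1 - switch_prob s0) * flow_move s0 a) * delta a s); last first.
  rewrite exchange_big/=; apply: eq_bigr => s0 _.
  by rewrite exchange_big/=; apply: eq_bigr => a _; rewrite !mulr_suml.
apply: (@le_trans _ _ (\sum_(s0 : state M) \sum_(a : action M)
    (owner a == s0)%:R * y a * delta a s)).
  apply: ler_sum => s0 _; apply: ler_sum => a _.
  apply: ler_wpM2r; first exact: distr_ge0.
  rewrite -outflow_move -inflow_stay -mulrA; apply: ler_wpM2r => //.
  by rewrite mulr_ge0 ?subr_ge0 ?switch_prob_le1// flow_move_ge0.
rewrite exchange_big/=; apply: ler_sum => a _.
rewrite (bigD1 (owner a))//= eqxx mul1r big1 ?addr0// => s0.
by rewrite eq_sym => /negbTE ->; rewrite !mul0r.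
Qed.

Let mu n (l : L) : R := prob P [set u | u n = l].

Let tr (l l' : L) : R := chain_trans (m := C) l l'.

Let trE s b a s' b' a' : tr (s, b, a) (s', b', a') =
  delta a s' * (mem_update flow_strategy a s' b b' * next_move_of s' b' a').
Proof. exact: play_transE. Qed.

Let mu_step n (l' : L) : mu n.+1 l' = \sum_(l : L) mu n l * tr l l'.
Proof.
rewrite /mu (@prob_fibers _ _ _ P L (fun u => u n)); last 2 first.
- exact: measurable_coord_eq.
- by move=> v; exact: measurable_coord_eq.
apply: eq_bigr => l _; apply: EFin_inj; rewrite EFinM -!probE; last 2 first.
- exact: measurable_coord_eq.
- by apply: measurableI; exact: measurable_coord_eq.
by rewrite -chain_step setIC.
Qed.

Let sum_triple (F : L -> R) : \sum_l F l = \sum_s \sum_b \sum_a F (s, b, a).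
Proof.
rewrite pair_bigA/= pair_bigA/=; apply: eq_big => [[[s b] a]|[[s b] a] _] //=.
Qed.

Lemma follow_prob n s a : mu n (s, false, a) =
  arrival n s * ((1 - switch_prob s) * flow_move s a).
Proof.
elim: n s a => [|n ih] s a.
  rewrite /mu /prob chain_start play_initE/=.
  by case: eqP => [->|_]; rewrite ?mulr1 ?mul1r ?mulr0 ?mul0r.
rewrite mu_step sum_triple mulr_suml; apply: eq_bigr => s0 _.
rewrite big_bool/= big1 ?add0r => [|a0 _]; last first.
  by rewrite trE/= mul0r !mulr0.
rewrite mulr_suml; apply: eq_bigr => a0 _.
by rewrite ih trE/= !mulrA.
Qed.

Let prob_pair n (D : L -> L -> bool) : prob P [set u | D (u n) (u n.+1)] =
  \sum_(l : L) \sum_(l' : L) mu n l * ((D l l')%:R * tr l l').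
Proof.
have mD : measurable [set u : traj (chain_point C) | D (u n) (u n.+1)].
  have -> : [set u : traj (chain_point C) | D (u n) (u n.+1)] =
      [set u | [set w | D (nth (chain_point C) w n) (nth (chain_point C) w n.+1)] (mkseq u n.+2)].
    by apply/seteqP; split=> u; rewrite /mkset !nth_mkseq.
  exact: measurable_prefix.
rewrite (@prob_fibers _ _ _ P L (fun u => u n))//; last by move=> v; exact: measurable_coord_eq.
apply: eq_bigr => l _.
rewrite (@prob_fibers _ _ _ P L (fun u => u n.+1)); last 2 first.
- by apply: measurableI => //; exact: measurable_coord_eq.
- by move=> v; exact: measurable_coord_eq.
apply: eq_bigr => l' _; have [Dl|nDl] := boolP (D l l'); last first.
  rewrite mul0r mulr0 (_ : _ `&` _ = set0) ?/prob ?measure0//.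
  by apply/seteqP; split=> // u /= [[+ ul] ul']; rewrite ul ul' (negbTE nDl).
rewrite mul1r; apply: EFin_inj; rewrite EFinM -!probE; last 2 first.
- exact: measurable_coord_eq.
- by apply: measurableI; [apply: measurableI => //|]; exact: measurable_coord_eq.
rewrite -chain_step; congr (P _).
by apply/seteqP; split=> u /=; [move=> [[]]|move=> [-> ->]].
Qed.

(** Time 0 is separate because the initial memory is itself drawn by the coin of the initial
    state. *)
Definition switch_at n s : set (traj (chain_point C)) :=
  if n is n'.+1 then [set u | ~~ (u n').1.2 && ((u n).1 == (s, true))]
  else [set u | (u 0%N).1 == (s, true)].

Lemma measurable_switch_at n s : measurable (switch_at n s).
Proof.
case: n => [|n]; first exact: (@measurable_coord _ _ 0 [set l | l.1 == (s, true)]).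
rewrite /switch_at (_ : [set u | _ && _] = [set u : traj (chain_point C) | ~~ (u n).1.2] `&`
    [set u | (u n.+1).1 == (s, true)]).
  apply: measurableI; first exact: (@measurable_coord _ _ n [set l | ~~ l.1.2]).
  exact: (@measurable_coord _ _ n.+1 [set l | l.1 == (s, true)]).
by apply/seteqP; split=> u /=; [move=> /andP[]|move=> [-> ->]].
Qed.

Lemma switch_at_prob n s : prob P (switch_at n s) = arrival n s * switch_prob s.
Proof.
case: n => [|n].
  rewrite (@prob_fibers _ _ _ P L (fun u => u 0%N)); last 2 first.
  - exact: measurable_switch_at.
  - by move=> v; exact: measurable_coord_eq.
  rewrite sum_triple (bigD1 s)//= [X in _ + X]big1 ?addr0 => [|s1 s1s]; last first.
    apply: big1 => b _; apply: big1 => a _.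
    rewrite (_ : _ `&` _ = set0) ?/prob ?measure0//.
    apply/seteqP; split=> // u /= [+ us]; rewrite us xpair_eqE.
    by rewrite (negbTE s1s).
  rewrite big_bool/= [X in _ + X]big1 ?addr0 => [|a _]; last first.
    rewrite (_ : _ `&` _ = set0) ?/prob ?measure0//.
    by apply/seteqP; split=> // u /= [+ us]; rewrite us xpair_eqE andbF.
  transitivity (\sum_a (s == init_state M)%:R * switch_prob s * next_move_of s true a).
    apply: eq_bigr => a _.
    have -> : [set u : traj (chain_point C) | (u 0%N).1 == (s, true)] `&` [set u | u 0%N = (s, true, a)] =
        [set u | u 0%N = (s, true, a)].
      by apply/seteqP; split=> u /=; [case|move=> ->; rewrite eqxx].
    rewrite /prob chain_start play_initE/=.
    by have [->|_] := eqVneq s (init_state M); rewrite ?mulr1 ?mul1r ?mulr0 ?mul0r.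
  by rewrite -mulr_sumr distr_sum mulr1.
rewrite /switch_at (prob_pair n (fun l l' => ~~ l.1.2 && (l'.1 == (s, true)))) sum_triple/=.
rewrite mulr_suml; apply: eq_bigr => s0 _.
rewrite big_bool/= big1 ?add0r => [|a0 _]; last first.
  by apply: big1 => l' _; rewrite mul0r mulr0.
rewrite mulr_suml; apply: eq_bigr => a0 _.
rewrite -mulr_sumr follow_prob -!mulrA; do 3 congr (_ * _).
rewrite sum_triple (bigD1 s)//= [X in _ + X]big1 ?addr0 => [|s1 s1s]; last first.
  apply: big1 => b _; apply: big1 => a _.
  by rewrite xpair_eqE (negbTE s1s) mul0r.
rewrite big_bool/= [X in _ + X]big1 ?addr0 => [|a _]; last first.
  by rewrite xpair_eqE andbF mul0r.
under eq_bigr do rewrite eqxx mul1r trE/= mulrA.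
by rewrite -mulr_sumr (distr_sum (dunit R (best_action r s))) mulr1.
Qed.

Lemma follow_le N : prob P [set u | ~~ (u N).1.2] <= \sum_s arrival N s.
Proof.
rewrite (@prob_fibers _ _ _ P L (fun u => u N)); last 2 first.
- exact: (@measurable_coord _ _ N [set l | ~~ l.1.2]).
- by move=> v; exact: measurable_coord_eq.
rewrite sum_triple; apply: ler_sum => s _.
rewrite big_bool/= big1 ?add0r => [|a _]; last first.
  rewrite (_ : _ `&` _ = set0) ?/prob ?measure0//.
  by apply/seteqP; split=> // u /= [+ us]; rewrite us.
apply: (@le_trans _ _ (\sum_a arrival N s * ((1 - switch_prob s) * flow_move s a))).
  apply: ler_sum => a _; rewrite -follow_prob; apply: prob_le.
  - apply: measurableI; first exact: (@measurable_coord _ _ N [set l | ~~ l.1.2]).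
    exact: measurable_coord_eq.
  - exact: measurable_coord_eq.
  - by move=> u [].
rewrite -!mulr_sumr distr_sum mulr1 ler_piMr ?arrival_ge0//.
by rewrite gerBl switch_prob_ge0.
Qed.

(** The arrivals summed over time are bounded by the total inflow, so they cannot stay above [e].
    With [follow_le] this makes late switching unlikely. *)
Lemma arrival_small e : 0 < e -> exists N, \sum_s arrival N s <= e.
Proof.
move=> e0; apply: contrapT => /forallNP h.
have big N : N%:R * e <= \sum_s inflow s.
  apply: (@le_trans _ _ (\sum_s \sum_(n < N) arrival n s)).
    rewrite exchange_big/= mulr_natl -[X in _ *+ X]card_ord -sumr_const.
    by apply: ler_sum => n _; rewrite ltW// ltNge; exact/negP/h.
  by apply: ler_sum => s _; exact: sum_arrival.
pose N := (Num.trunc ((\sum_s inflow s) / e)).+1.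
by have := big N; rewrite -ler_pdivlMr// leNgt Num.Theory.truncnS_gt.
Qed.

Lemma switch_total N s : \sum_(n < N) prob P (switch_at n s) <= z s.
Proof.
under eq_bigr do rewrite switch_at_prob.
by rewrite -mulr_suml -inflow_switch ler_wpM2r ?switch_prob_ge0 ?sum_arrival.
Qed.

End two_memory_strategy.

Section start_and_runs.
Variables (R : realType).

Lemma chain_init_pos (C : markov_chain R) :
  {ae chain_prob C, forall u, 0 < chain_init C (u 0%N)}.
Proof.
have P0 : chain_prob C [set u | [set l | chain_init C l = 0] (u 0%N)] = 0%E.
  rewrite (@measure_fibers _ _ _ (chain_prob C) _ (fun u : traj (chain_point C) => u 0%N)); last 2 first.
  - exact: measurable_coord.
  - by move=> v; exact: measurable_coord_eq.
  apply: esum1 => l _; have [l0|nl0] := pselect (chain_init C l = 0).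
    rewrite (_ : _ `&` _ = [set u | u 0%N = l]); first by rewrite [LHS]chain_start l0.
    by apply/seteqP; split=> u /=; [case|move=> ->].
  rewrite (_ : _ `&` _ = set0) ?measure0//.
  by apply/seteqP; split=> // u /= [+ ul]; rewrite ul.
exists [set u | [set l | chain_init C l = 0] (u 0%N)]; split => //.
  exact: measurable_coord.
move=> u /= tu; apply: contrapT => h; apply: tu.
by rewrite lt0r distr_ge0 andbT; exact/eqP.
Qed.

Variables (M : mdp R) (Mem : countType) (sigma : strategy M Mem).

Lemma measurable_erase_preimage (A : set (run M)) : measurable A ->
  measurable (@erase_memory _ _ _ sigma @^-1` A).
Proof.
move=> mA; rewrite -[_ @^-1` _]setTI.
exact: measurable_funP.
Qed.

Lemma run_prob_ae (Q : run M -> Prop) : {ae run_prob sigma, forall rho, Q rho} ->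
  {ae chain_prob (play_chain sigma), forall u, Q (erase_memory u)}.
Proof.
move=> [N [mN PN QN]]; exists (@erase_memory _ _ _ sigma @^-1` N); split=> //.
  exact: measurable_erase_preimage.
by move=> u /= nQ; apply: QN.
Qed.

(** Almost every play uses only choices of positive probability, so supports of the distributions
    become facts about single runs. *)
Lemma play_positive : {ae chain_prob (play_chain sigma), forall u, forall n,
  [/\ 0 < next_move sigma (u n).1.1 (u n).1.2 (u n).2,
      0 < delta (u n).2 (u n.+1).1.1 &
      0 < mem_update sigma (u n).2 (u n.+1).1.1 (u n).1.2 (u n.+1).1.2]}.
Proof.
have F : Filter (almost_everywhere (chain_prob (play_chain sigma))).
  exact: ae_filter_ringOfSetsType.
apply: filterS2 (chain_init_pos (play_chain sigma)) (chain_trans_pos (play_chain sigma)) => u u0 ut n.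
have pos (a b : R) : 0 <= a -> 0 <= b -> 0 < a * b -> 0 < a /\ 0 < b.
  move=> a0 b0; rewrite lt0r mulf_eq0 negb_or => /andP[/andP[? ?] _].
  by rewrite !lt0r a0 b0 !andbT.
have step k : [/\ 0 < next_move sigma (u k.+1).1.1 (u k.+1).1.2 (u k.+1).2,
    0 < delta (u k).2 (u k.+1).1.1 &
    0 < mem_update sigma (u k).2 (u k.+1).1.1 (u k).1.2 (u k.+1).1.2].
  have := ut k; case: (u k) (u k.+1) => [[s m] a] [[s' m'] a'].
  rewrite play_transE => /pos[||? /pos[||? ?]]; rewrite ?mulr_ge0 ?distr_ge0//.
have [_ d0 u1] := step n; split=> // {d0 u1}.
case: n => [|n]; last by have [] := step n.
move: u0; case: (u 0%N) => [[s m] a]; rewrite play_initE.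
move=> /pos[||_]; rewrite ?mulr_ge0 ?distr_ge0//=.
have [->|_] := eqVneq s (init_state M); first by rewrite mulr1.
by rewrite mulr0 ltxx.
Qed.

End start_and_runs.

(** * Payoff of the two-memory strategy *)

Section flow_strategy_payoff.
Variables (R : realType) (M : mdp R) (r : state M -> rat).
Variables (y : action M -> R) (z : state M -> R).
Hypothesis yz : flow y z.
Local Notation sigma := (flow_strategy r yz).
Local Notation P := (chain_prob (play_chain sigma)).

Lemma switch_value N : {ae P, forall u : traj (chain_point (play_chain sigma)), (u N).1.2 ->
  exists n s, [/\ (n <= N)%N, switch_at n s u & state_value r s <= mean_payoff r (erase_memory u)]}.
Proof.
have law := run_prob_law sigma.
have F : Filter (almost_everywhere P) by exact: ae_filter_ringOfSetsType.
apply: filterS3 (play_positive sigma) (run_prob_ae (law_balanced law))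
  (run_prob_ae (law_consistent_ae law)) => u pos bal cons uN.
have stay n : (u n).1.2 -> (u n.+1).1.2.
  have [_ _] := pos n; move=> + un; rewrite /= un /=.
  by case: (u n.+1).1.2 => //; rewrite ltxx.
(* The first time with memory [true] is the switching time, and by [stay] the memory never returns
   to [false]. *)
have [n un nmin] := ex_minnP (ex_intro (fun n => (u n).1.2 : bool) N uN).
exists n, (u n).1.1; split; first exact: nmin.
  have un1 : (u n).1 == ((u n).1.1, true) by rewrite [X in X == _]surjective_pairing un.
  case: n un nmin un1 => [|n] un nmin un1 //=; rewrite un1 andbT.
  by apply/negP => /nmin; rewrite ltnn.
have on m : (n <= m)%N -> (u m).1.2.
  elim: m => [|m ih]; first by rewrite leqn0 => /eqP <-.
  by rewrite leq_eqVlt => /predU1P[<-//|]; rewrite ltnS => /ih; exact: stay.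
have := @state_value_le_mean_payoff _ _ r (erase_memory u) n cons bal.
rewrite erase_memoryE/=; apply.
  move=> m nm; rewrite erase_memoryE/=; have [+ _ _] := pos m.
  by rewrite /= (on m nm) /=; case: eqP => //; rewrite ltxx.
by move=> m; rewrite !erase_memoryE/=; have [] := pos m.
Qed.

(** Up to probability [e] the switch has occurred by time [N]; a payoff below [x] then forces a
    switch at a state of value below [x], and the union bound over times gives at most [z s] for
    each such state. *)
Lemma flow_strategy_low (x : R) :
  prob (run_prob sigma) [set rho | mean_payoff r rho < x] <=
  \sum_(s | state_value r s < x) z s.
Proof.
apply/ler_addgt0Pr => e e0; have [N Ne] := arrival_small r yz e0.
have mlow : measurable [set rho : run M | mean_payoff r rho < x].
  exact: (@measurable_lt _ _ _ (run_prob sigma) (mean_payoff r)).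
pose B0 : set (traj (chain_point (play_chain sigma))) := [set u | ~~ (u N).1.2].
pose B1 : set (traj (chain_point (play_chain sigma))) :=
  [set u | exists2 p : state M * 'I_N.+1, state_value r p.1 < x & switch_at p.2 p.1 u].
have mB0 : measurable B0 by exact: (@measurable_coord _ _ N [set l | ~~ l.1.2]).
have mB1 : measurable B1.
  have -> : B1 = \bigcup_(p in [set p : state M * 'I_N.+1 | state_value r p.1 < x])
      switch_at p.2 p.1.
    by apply/seteqP; split=> u [p ? ?]; exists p.
  by apply: fin_bigcup_measurable => // p _; exact: measurable_switch_at.
have B0e : prob P B0 <= e := le_trans (follow_le r yz N) Ne.
have B1z : prob P B1 <= \sum_(s | state_value r s < x) z s.
  apply: (@le_trans _ _ (\sum_(s | state_value r s < x) \sum_(n < N.+1) prob P (switch_at n s))).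
    rewrite pair_big_dep/=; under eq_bigl do rewrite andbT.
    apply: (@prob_union _ _ _ P _ (fun p : state M * 'I_N.+1 => state_value r p.1 < x) B1
      (fun p => switch_at p.2 p.1)) => //.
    by move=> p; exact: measurable_switch_at.
  by apply: ler_sum => s _; exact: switch_total.
apply: (@le_trans _ _ (prob P (B0 `|` B1))); last first.
  by apply: le_trans (prob_setU_le P mB0 mB1) _; rewrite addrC; exact: lerD.
apply: (@prob_le_ae _ _ _ P (erase_memory (sigma := sigma) @^-1` _)).
- exact: measurable_erase_preimage.
- exact: measurableU.
apply: filterS (switch_value N) => u h /= ux.
have [uN|nuN] := boolP (u N).1.2; last by left.
have [n [s [nN sw vs]]] := h uN; right.
by exists (s, Ordinal (nN : (n < N.+1)%N)) => //=; exact: le_lt_trans ux.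
Qed.

End flow_strategy_payoff.

Section upper_bound.
Variables (R : realType) (M : mdp R) (r : state M -> rat).
Variable (P : probability (run M) R).
Hypothesis law : play_law P.

(** States of value at least [x] are exactly those whose level is at least that of a lowest one,
    [s1], so the hypothesis at the single level of [s1] suffices. *)
Lemma payoff_high (z : state M -> R) (x : R) : (forall s, 0 <= z s) ->
  (forall k, prob P [set rho | recurrent (lev r) k rho] <= \sum_(s | (k <= lev r s)%N) z s) ->
  prob P [set rho | x <= mean_payoff r rho] <= \sum_(s | x <= state_value r s) z s.
Proof.
move=> z0 zP.
have mhigh : measurable [set rho : run M | x <= mean_payoff r rho].
  have -> : [set rho : run M | x <= mean_payoff r rho] = ~` [set rho | mean_payoff r rho < x].
    by apply/seteqP; split=> rho /=; rewrite leNgt => /negP.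
  apply: measurableC; exact: (@measurable_lt _ _ _ P (mean_payoff r)).
have bound : {ae P, forall rho : run M, exists2 s,
    (forall m, exists2 n, (m <= n)%N & (rho n).1 = s) & mean_payoff r rho <= state_value r s}.
  apply: filterS2 (law_balanced law) (law_consistent_ae law) => rho bal cons.
  exact: mean_payoff_le_state_value.
have [[s0 xs0]|none] := pselect (exists s, x <= state_value r s); last first.
  apply: (@le_trans _ _ (prob P set0)); last by rewrite /prob measure0 sumr_ge0.
  apply: prob_le_ae => //; apply: filterS bound => rho [s _ Rs] /= xR.
  by apply: none; exists s; exact: le_trans Rs.
have [s1 xs1 s1min] : exists2 s1, x <= state_value r s1 &
    forall s, x <= state_value r s -> (lev r s1 <= lev r s)%N.
  by case: (@arg_minnP _ s0 (fun s => x <= state_value r s) (lev r) xs0) => s1; exists s1.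
apply: (@le_trans _ _ (prob P [set rho | recurrent (lev r) (lev r s1) rho])).
  apply: prob_le_ae => //; first exact: measurable_recurrent.
  apply: filterS bound => rho [s sio Rs] /= xR m.
  have [n mn ns] := sio m; exists n => //; rewrite ns; apply: s1min.
  exact: le_trans Rs.
apply: le_trans (zP _) _; rewrite [leRHS]big_mkcond [leLHS]big_mkcond/=.
apply: ler_sum => s _; case: ifP => [ls|_]; last by case: ifP.
by rewrite (le_trans xs1 (state_value_le ls)).
Qed.

End upper_bound.

Lemma two_memory_dominance (R : realType) (M : mdp R) (r : state M -> rat)
    (Mem : countType) (sigma : strategy M Mem) :
  exists sigma' : strategy M bool, forall x : R,
    (run_prob sigma' [set rho | (mean_payoff r rho < x)%R] <=
     run_prob sigma [set rho | (mean_payoff r rho < x)%R])%E.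
Proof.
have law := run_prob_law sigma.
have [y [z [yz zP]]] := dominating_flow (lev r) law.
exists (flow_strategy r yz) => x.
have mlow : measurable [set rho : run M | mean_payoff r rho < x].
  exact: (@measurable_lt _ _ _ (run_prob sigma) (mean_payoff r)).
have [_ z0 _] := yz.
rewrite !probE// lee_fin (le_trans (flow_strategy_low r yz x))//.
have high := payoff_high law x z0 zP.
have highE : prob (run_prob sigma) [set rho | x <= mean_payoff r rho] =
    1 - prob (run_prob sigma) [set rho | mean_payoff r rho < x].
  rewrite -prob_setC//; congr (prob _ _).
  by apply/seteqP; split=> rho /=; rewrite leNgt => /negP.
(* Total mass one turns the lower bound for the high values under [z] into an upper bound for the
   low ones. *)
have sum1 : \sum_(s | state_value r s < x) z s + \sum_(s | x <= state_value r s) z s = 1.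
  rewrite -(flow_sum yz) [RHS](bigID (fun s => state_value r s < x))/=; congr (_ + _).
  by apply: eq_bigl => s; rewrite leNgt.
lra.
Qed.

Theorem theorem5p10 (R : realType) (M : mdp R) (r : state M -> rat)
    (Mem : countType) (sigma : strategy M Mem) :
  exists (Mem' : finType) (sigma' : strategy M Mem'),
    [/\ #|Mem'| = 2%N,
        ('E_(run_prob sigma)[mean_payoff r] <=
         'E_(run_prob sigma')[mean_payoff r])%E &
        forall p : R, 0 < p < 1 ->
          VaR (run_prob sigma) (mean_payoff r) p <=
            VaR (run_prob sigma') (mean_payoff r) p /\
          (CVaR (run_prob sigma) (mean_payoff r) p <=
            CVaR (run_prob sigma') (mean_payoff r) p)%E].
Proof.
have [sigma' dom] := two_memory_dominance r sigma.
exists bool, sigma'; split; first exact: card_bool.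
  exact: (expectation_dominance (mean_payoff_bound r) (mean_payoff_bound r) dom).
move=> p p01; split.
  exact: (VaR_dominance (mean_payoff_bound r) (mean_payoff_bound r) dom p01).
exact: (CVaR_dominance (mean_payoff_bound r) (mean_payoff_bound r) dom p01).
Qed.
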